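(* Let $1\le k\le j\le\infty$, let $\mathcal F\in\mathrm{Op}^{\mathrm{un}}_{\le k}$ be a unital $k$-restricted $\infty$-operad, and let $\mathrm{R}_k\colon\mathrm{Op}^{\mathrm{un}}_{\le k}\to\mathrm{Op}^{\mathrm{un}}_{\le j}$ be the functor given by right Kan extension along $i_k\colon\Omega^c_{\le k}\hookrightarrow\Omega^c_{\le j}$. For every integer $n$ with $k\le n\le j$, the space $\mathrm{R}_k\mathcal F(\overline{C_n})$ is the limit $$\lim_{I\in(\mathcal P_{\le k}(v(r)))^{\mathrm{op}}}\mathcal F(\overline{C_I}),$$ where $r$ is the root of $\overline{C_n}$ and $\overline{C_I}$ is the closed sub-$|I|$-corolla of $\overline{C_n}$ corresponding to $I$. In particular, $\mathrm{R}_k\mathcal F$ has the same colours as $\mathcal F$. Moreover, given colours $X_1,\dots,X_n,Y$ in $\mathcal F$, we have $$\mathrm{Mul}_{\mathrm{R}_k\mathcal F}(X_1,\dots,X_n;Y)=\lim_{(i_1,\dots,i_l)\in(\mathcal P_{\le k}(v(r)))^{\mathrm{op}}}\mathrm{Mul}_{\mathcal F}(X_{i_1},\dots,X_{i_l};Y).$$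
   Context: **Trees.** A (dendroidal) tree $(T,L)$, often written $T$, is a finite poset $T$ with a minimal element (a least element, called the root) such that $\{y\le x\}$ is linearly ordered for every $x\in T$, together with a subset $L$ of the maximal elements of $T$ (the leaves). Elements of $T$ are called edges. For an edge $e$, $v(e)$ is the set of minimal elements of $T_{>e}$, and $|v(e)|$ is the valence of $e$. The edge $\eta$ is $(\{r\},\{r\})$; the $n$-corolla $C_n$ ($n\ge1$) is $\{0,1,\dots,n\}$ with $0$ least, $1,\dots,n$ pairwise incomparable and $L=\{1,\dots,n\}$; $C_0=(\{0\},\varnothing)$. **Category $\Omega$.** Objects are trees; $\mathrm{Hom}_\Omega(T,T')$ is the set of operad maps $\mathrm{Free}(T)\to\mathrm{Free}(T')$, where $\mathrm{Free}(T)$ is the coloured symmetric operad in sets with colours the edges of $T$, freely generated by one operation $v(e)\to e$ for each non-leaf edge $e$. **Closed trees.** A tree is closed if $L=\varnothing$; $\Omega^c\subset\Omega$ is the full subcategory of closed trees. (Explicitly: objects are finite rooted trees and morphisms are order-preserving maps that preserve independence, i.e. send incomparable pairs to incomparable pairs.) The inclusion $\Omega^c\hookrightarrow \Omega$ has left adjoint $(T,L)^c=(T,\varnothing)$; $\overline{C_n}:=C_n^c$. A tree is $k$-dendroidal if all its edges have valence $\le k$ (no condition if $k=\infty$); $\Omega^c_{\le k}\subset\Omega^c$ is the full subcategory of closed $k$-dendroidal trees, $\Omega^c_{\le\infty}=\Omega^c$. **Segal presheaves.** $\mathcal S$ is the $\infty$-category of spaces and $\mathcal P(\mathcal C)=\mathrm{Fun}(\mathcal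 C^{\mathrm{op}},\mathcal S)$. A morphism $f\colon T\to T'$ is a subtree inclusion if it is injective on edges and whenever $f(e_0)\le e'\le f(e_2)$ with $e'\in T'$, $e'$ lies in the image of $f$. For a tree $T$, $(\Omega^{\mathrm{el}})_{/T}\subset\Omega_{/T}$ is the full subcategory of subtree inclusions $f\colon X\to T$ with $X=\eta$ or $X=C_n$ for some $n$, where, if $X=C_n$ has root $x$, the edge $f(x)$ must also have valence $n$. A presheaf $\mathcal F$ on $\Omega^c_{\le k}$ is Segal if for every closed $k$-dendroidal $T$ the canonical map $\mathcal F(T)\to\lim_{X\in((\Omega^{\mathrm{el}})_{/T})^{\mathrm{op}}}\mathcal F(X^c)$ is an equivalence. Let $r\colon\Delta\to\Omega^c_{\le k}$ send $[n]$ to the closure of $(\{0\le1\le\dots\le n\},\{n\})$. A Segal presheaf $\mathcal F$ is complete if $r^*\mathcal F$ is a complete Segal space in the sense of Rezk. $\mathrm{Op}^{\mathrm{un}}_{\le k}$ is the full subcategory of $\mathcal P(\Omega^c_{\le k})$ on complete Segal presheaves; its objects are called unital $k$-restricted $\infty$-operads. Right Kan extension along $i_k$ sends $\mathrm{Op}^{\mathrm{un}}_{\le k}$ to $\mathrm{Op}^{\mathrm{un}}_{\le j}$. **Colours and multimorphisms.** $\mathcal F(\overline{C_0})$ is the space of colours of $\mathcal F$; for colours $X_1,\dots,X_n,Y$, $\mathrm{Mul}_{\mathcal F}(X_1,\dots,X_n;Y)=\mathcal F(\overline{C_n})\times_{\mathcal F(\overline{C_0})^{n+1}}\{(X_1,\dots,X_n,Y)\}$;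 for the empty list $\mathrm{Mul}_{\mathcal F}(\varnothing;Y)$ is a point. **Power sets.** $\mathcal P_{\le k}(S)$ is the poset (under inclusion, viewed as a category) of subsets $I\subset S$ with $|I|\le k$. For $I\subset v(r)$, $\overline{C_I}=\{r\}\cup I\subset\overline{C_n}$ (so $\overline{C_\varnothing}=\overline{C_0}$), and the functor $I\mapsto\mathcal F(\overline{C_I})$ uses restriction along the inclusions $\overline{C_I}\hookrightarrow\overline{C_{I'}}$ for $I\subset I'$. In the second limit $v(r)$ is identified with $\{1,\dots,n\}$ and $(i_1,\dots,i_l)$ denotes the subset $\{i_1,\dots,i_l\}$ of $v(r)$, $l\le k$. *)

(* Defs.v *)
From HB Require Import structures.
From mathcomp Require Import all_boot all_order.
From mathcomp Require Import boolp.
From Stdlib Require Import Relations.Relation_Operators.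

Set Implicit Arguments.
Unset Strict Implicit.
Unset Printing Implicit Defensive.

Import Order.TTheory.

Record category := Category {
  obj :> Type;
  hom : obj -> obj -> Type;
  idm : forall a, hom a a;
  comp : forall a b c, hom b c -> hom a b -> hom a c;
  comp1m : forall a b (f : hom a b), comp (idm b) f = f;
  compm1 : forall a b (f : hom a b), comp f (idm a) = f;
  compA : forall a b c d (h : hom c d) (g : hom b c) (f : hom a b),
    comp h (comp g f) = comp (comp h g) f }.
Arguments hom {_} _ _.
Arguments idm {_} _.
Arguments comp {_ _ _ _} _ _.

Record functor (C D : category) := Functor {
  fobj :> C -> D;
  fmap : forall a b, hom a b -> hom (fobj a) (fobj b);
  fmap1 : forall a, fmap (idm a) = idm (fobj a);
  fmapM : forall a b c (g : hom b c) (f : hom a b),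
    fmap (comp g f) = comp (fmap g) (fmap f) }.
Arguments fmap {_ _} _ {_ _} _.

Definition idF (C : category) : functor C C :=
  @Functor C C (fun a => a) (fun _ _ f => f)
    (fun _ => erefl) (fun _ _ _ _ _ => erefl).

Section CompF.
Variables (C D E : category) (G : functor D E) (F : functor C D).
Fact compF1 a : fmap G (fmap F (idm a)) = idm (G (F a)).
Proof. by rewrite !fmap1. Qed.
Fact compFM a b c (g : hom b c) (f : hom a b) :
  fmap G (fmap F (comp g f)) = comp (fmap G (fmap F g)) (fmap G (fmap F f)).
Proof. by rewrite !fmapM. Qed.
Definition compF : functor C E := Functor compF1 compFM.
End CompF.

Section Constant.
Variables (C D : category) (d : D).
Fact constFM (a b c : C) (g : hom b c) (f : hom a b) :
  idm d = comp (idm d) (idm d).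
Proof. by rewrite comp1m. Qed.
Definition constF : functor C D :=
  @Functor C D (fun=> d) (fun _ _ _ => idm d) (fun=> erefl) constFM.
End Constant.

Definition op (C : category) : category :=
  @Category C (fun a b => hom b a) (fun a => idm a)
    (fun _ _ _ g f => comp f g)
    (fun _ _ f => compm1 f) (fun _ _ f => comp1m f)
    (fun _ _ _ _ h g f => esym (compA f g h)).

Definition opF (C D : category) (F : functor C D) : functor (op C) (op D) :=
  @Functor (op C) (op D) F (fun _ _ f => fmap F f) (fun a => fmap1 F a)
    (fun _ _ _ g f => fmapM F f g).

Definition full (C : category) (I : Type) (o : I -> C) : category :=
  @Category I (fun i j => hom (o i) (o j)) (fun i => idm (o i))
    (fun _ _ _ g f => comp g f) (fun _ _ f => comp1m f) (fun _ _ f => compm1 f)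
    (fun _ _ _ _ h g f => compA h g f).

Definition fullF (C : category) (I : Type) (o : I -> C) : functor (full o) C :=
  @Functor (full o) C o (fun _ _ f => f) (fun=> erefl) (fun _ _ _ _ _ => erefl).

Section Poset.
Variables (T : Type) (r : rel T) (rr : reflexive r) (rt : transitive r).
Definition poset_cat : category.
Proof.
by exists T (fun x y => r x y) rr (fun x y z yz xy => rt xy yz) => *;
  apply: bool_irrelevance.
Defined.
End Poset.

Section Comma.
Variables (C D : category) (i : functor C D) (T : D).

Record comma_obj := CommaObj { cdom :> C; carr : hom (i cdom) T }.
Record comma_hom (x y : comma_obj) := CommaHom {
  chom :> hom (cdom x) (cdom y);
  chomP : comp (carr y) (fmap i chom) = carr x }.

Lemma comma_hom_eq x y (f g : comma_hom x y) : chom f = chom g -> f = g.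
Proof.
by case: f g => [f fP] [g gP] /= e; case: _ / e gP => gP;
  rewrite (Prop_irrelevance fP gP).
Qed.

Fact comma_idP (x : comma_obj) : comp (carr x) (fmap i (idm (cdom x))) = carr x.
Proof. by rewrite fmap1 compm1. Qed.
Fact comma_compP x y z (g : comma_hom y z) (f : comma_hom x y) :
  comp (carr z) (fmap i (comp g f)) = carr x.
Proof. by rewrite fmapM compA !chomP. Qed.

Definition comma : category.
Proof.
exists comma_obj comma_hom (fun x => CommaHom (comma_idP x))
  (fun x y z g f => CommaHom (comma_compP g f)).
- by move=> *; apply: comma_hom_eq; rewrite /= comp1m.
- by move=> *; apply: comma_hom_eq; rewrite /= compm1.
- by move=> *; apply: comma_hom_eq; rewrite /= compA.
Defined.

Definition comma_proj : functor comma C :=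
  @Functor comma C cdom (fun _ _ f => chom f)
    (fun=> erefl) (fun _ _ _ _ _ => erefl).
End Comma.

Section CommaPost.
Variables (C D : category) (i : functor C D) (T T' : D) (h : hom T T').
Definition cpost_obj (x : comma i T) : comma i T' :=
  CommaObj (comp h (carr x)).
Fact cpostP (x y : comma i T) (f : hom x y) :
  comp (carr (cpost_obj y)) (fmap i (chom f)) = carr (cpost_obj x).
Proof. by rewrite -compA chomP. Qed.
Definition comma_post : functor (comma i T) (comma i T').
Proof.
apply: (@Functor (comma i T) (comma i T') cpost_obj
  (fun x y f => @CommaHom _ _ i T' (cpost_obj x) (cpost_obj y) _ (cpostP f))).
- by move=> a; apply: comma_hom_eq.
- by move=> *; apply: comma_hom_eq.
Defined.
End CommaPost.

Definition slice (C : category) (d : C) : category := comma (idF C) d.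
Definition slice_id (C : category) (d : C) : slice d :=
  @CommaObj C C (idF C) d d (idm d).

Section SliceMap.
Variables (C D : category) (G : functor C D) (d : C).
Definition slice_map_obj (x : slice d) : slice (G d) :=
  @CommaObj D D (idF D) (G d) (G (cdom x)) (fmap G (carr x)).
Fact slice_mapP (x y : slice d) (f : hom x y) :
  comp (carr (slice_map_obj y)) (fmap G (chom f)) = carr (slice_map_obj x).
Proof. by rewrite -[RHS]/(fmap G (carr x)) -(chomP f) fmapM. Qed.
Definition slice_map : functor (slice d) (slice (G d)).
Proof.
apply: (@Functor (slice d) (slice (G d)) slice_map_obj
  (fun x y f => @CommaHom _ _ (idF D) (G d) (slice_map_obj x) (slice_map_obj y) _ (slice_mapP f))).
- by move=> a; apply: comma_hom_eq; rewrite /= fmap1.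
- by move=> *; apply: comma_hom_eq; rewrite /= fmapM.
Defined.
End SliceMap.

Section FunctorEq.

Lemma existT_inj (A : Type) (P : A -> Type) (a : A) (x y : P a) :
  existT P a x = existT P a y -> x = y.
Proof.
move=> e; have -> : y = eq_rect a P x a (projT1_eq e) by rewrite (projT2_eq e).
by rewrite (Prop_irrelevance (projT1_eq e) erefl).
Qed.

Inductive hom_eq (C : category) (a b : C) (f : hom a b) :
    forall a' b' : C, hom a' b' -> Prop :=
  HomEq : hom_eq f f.

Lemma hom_eqP (C : category) (a b : C) (f g : hom a b) : hom_eq f g -> f = g.
Proof.
move=> e.
pose P (p : C * C) := hom p.1 p.2.
suff: existT P (a, b) f = existT P (a, b) g by apply: existT_inj.
by refine (match e in @hom_eq _ _ _ _ a' b' h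
  return existT P (a, b) f = existT P (a', b') h with HomEq => erefl end).
Qed.

Lemma functor_eq (C D : category) (F G : functor C D) :
  (forall a, F a = G a) ->
  (forall a b (f : hom a b), hom_eq (fmap F f) (fmap G f)) -> F = G.
Proof.
case: F G => [F F' F1 FM] [G G' G1 GM] /= /funext eo.
case: _ / eo G' G1 GM => G' G1 GM eh.
have em : F' = G'.
  by apply: functional_extensionality_dep => a;
    apply: functional_extensionality_dep => b; apply: funext => f;
    apply: hom_eqP.
case: _ / em G1 GM {eh} => G1 GM.
by rewrite (Prop_irrelevance F1 G1) (Prop_irrelevance FM GM).
Qed.

Lemma comma_hom_heq (C D : category) (i : functor C D) (T : D) (c c' : C)
    (f g : hom (i c) T) (f' g' : hom (i c') T) (u : hom c c') fP gP :
  f = g -> f' = g' ->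
  hom_eq (C := comma i T) (@CommaHom _ _ i T (CommaObj f) (CommaObj f') u fP)
    (@CommaHom _ _ i T (CommaObj g) (CommaObj g') u gP).
Proof.
move=> e e'; case: _ / e gP => gP; case: _ / e' gP => gP.
by rewrite (Prop_irrelevance fP gP).
Qed.
End FunctorEq.

#[projections(primitive)]
Record mono (m n : nat) := Mono {
  mfun :> 'I_m.+1 -> 'I_n.+1;
  monoP : forall i j : 'I_m.+1, i <= j -> mfun i <= mfun j }.

Lemma mono_eq m n (f g : mono m n) : mfun f =1 mfun g -> f = g.
Proof.
by case: f g => [f fP] [g gP] /= /funext e; case: _ / e gP => gP;
  rewrite (Prop_irrelevance fP gP).
Qed.

Definition mid n : mono n n := Mono (fun (i j : 'I_n.+1) (ij : i <= j) => ij).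
Definition mcomp m n p (g : mono n p) (f : mono m n) : mono m p :=
  Mono (fun i j ij => monoP g (monoP f ij)).
Definition mconst m n (a : 'I_n.+1) : mono m n :=
  Mono (fun (i j : 'I_m.+1) (_ : i <= j) => leqnn a).

Definition Delta : category :=
  @Category nat mono mid mcomp (fun _ _ _ => erefl) (fun _ _ _ => erefl)
    (fun _ _ _ _ _ _ _ => erefl).

Record sset := SSet {
  simp :> nat -> Type;
  act : forall m n, mono m n -> simp n -> simp m;
  act1 : forall n (x : simp n), act (mid n) x = x;
  actM : forall m n p (g : mono n p) (f : mono m n) (x : simp p),
    act (mcomp g f) x = act f (act g x) }.
Arguments act {_ _ _} _ _.

Record smap (X Y : sset) := SMap {
  sfun :> forall n, X n -> Y n;
  sfunP : forall m n (f : mono m n) (x : X n),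
    sfun (act f x) = act f (sfun x) }.
Arguments sfun {_ _} _ {_} _.

Lemma smap_eq X Y (f g : smap X Y) : (forall n x, f n x = g n x) -> f = g.
Proof.
case: f g => [f fP] [g gP] /= e.
have {}e : f = g by apply: functional_extensionality_dep => n; apply/funext => x.
by case: _ / e gP => gP; rewrite (Prop_irrelevance fP gP).
Qed.

Definition sid (X : sset) : smap X X :=
  @SMap X X (fun _ x => x) (fun _ _ _ _ => erefl).
Section SComp.
Variables (X Y Z : sset) (g : smap Y Z) (f : smap X Y).
Fact scompP m n (t : mono m n) (x : X n) :
  g _ (f _ (act t x)) = act t (g _ (f _ x)).
Proof. by rewrite !sfunP. Qed.
Definition scomp : smap X Z := SMap scompP.
End SComp.

Section SubSSet.
Variables (X : sset) (P : forall n, X n -> Prop).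
Hypothesis Pact : forall m n (f : mono m n) (x : X n), P x -> P (act f x).
Definition ssub_act m n (f : mono m n) (x : {x : X n | P x}) : {x : X m | P x} :=
  exist _ (act f (sval x)) (Pact f (proj2_sig x)).
Definition ssub : sset.
Proof.
exists (fun n => {x : X n | P x}) ssub_act.
- by move=> n [x Px]; apply: eq_exist; rewrite /= act1.
- by move=> m n p g f [x Px]; apply: eq_exist; rewrite /= actM.
Defined.
End SubSSet.

Definition simplex (n : nat) : sset :=
  @SSet (fun m => mono m n) (fun _ _ f t => mcomp t f) (fun _ _ => erefl)
    (fun _ _ _ _ _ _ => erefl).

(* The horn: maps to [n] missing some vertex other than i. *)
Definition in_horn n (i : 'I_n.+1) m (t : simplex n m) : Prop :=
  exists2 j, j != i & forall a, t a != j.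
Fact in_horn_act n (i : 'I_n.+1) m p (f : mono m p) (t : simplex n p) :
  in_horn i t -> in_horn i (act f t).
Proof. by case=> j ji tj; exists j => // a; apply: tj. Qed.
Definition horn n (i : 'I_n.+1) : sset := ssub (@in_horn_act n i).

Definition Kan (X : sset) : Prop :=
  forall n (i : 'I_n.+2) (h : smap (horn i) X),
    exists x : X n.+1, forall m (t : horn i m), h m t = act (sval t) x.

Definition elementary_homotopy (X Y : sset) (f g : smap X Y) : Prop :=
  exists h : forall n, X n -> mono n 1 -> Y n,
    [/\ forall m n (t : mono m n) x e,
          h m (act t x) (mcomp e t) = act t (h n x e),
        forall n x, h n x (mconst n ord0) = f n x &
        forall n x, h n x (mconst n ord_max) = g n x].

(* The equivalence relation generated by one-step homotopies; when Y is a Kan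
   complex the latter already form an equivalence relation. *)
Definition homotopic (X Y : sset) : smap X Y -> smap X Y -> Prop :=
  clos_refl_sym_trans (smap X Y) (@elementary_homotopy X Y).

Definition equivalence (X Y : sset) (f : smap X Y) : Prop :=
  exists g : smap Y X, homotopic (scomp g f) (sid X) /\
                       homotopic (scomp f g) (sid Y).

Definition same_component (X : sset) : X 0 -> X 0 -> Prop :=
  clos_refl_sym_trans (X 0) (fun x y =>
    exists e : X 1, act (mconst 0 ord0) e = x /\ act (mconst 0 ord_max) e = y).

Section Paths.
Variable B : sset.

Record path_simp (n : nat) := PathSimp {
  pfun :> forall m, mono m n -> mono m 1 -> B m;
  pfunP : forall l m (f : mono l m) t e,
    pfun (mcomp t f) (mcomp e f) = act f (pfun t e) }.

Lemma path_eq n (p q : path_simp n) : (forall m t e, p m t e = q m t e) -> p = q.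
Proof.
case: p q => [p pP] [q qP] /= e.
have {}e : p = q.
  apply: functional_extensionality_dep => m.
  by apply/funext => t; apply/funext => u.
by case: _ / e qP => qP; rewrite (Prop_irrelevance pP qP).
Qed.

Definition path_act m n (f : mono m n) (p : path_simp n) : path_simp m.
Proof.
by exists (fun l t e => p l (mcomp f t) e) => *; rewrite -pfunP.
Defined.

Definition path_const n (b : B n) : path_simp n.
Proof. by exists (fun m t e => act t b) => *; rewrite -actM. Defined.

(* The path space of B, that is the internal hom from the 1-simplex. *)
Definition paths : sset.
Proof.
exists path_simp path_act => *; exact: path_eq.
Defined.
End Paths.

Section HFib.
(* The homotopy fibre over (b j)_j of the map A -> B^J given by v: points a of
   A together with a path from v j a to b j for each j. *)
Variables (J : Type) (A B : sset) (v : J -> smap A B) (b : J -> B 0).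

Record hfib_simp (n : nat) := HFibSimp {
  hpt : A n;
  hpath : J -> paths B n;
  hpath0 : forall j m (t : mono m n),
    hpath j m t (mconst m ord0) = act t (v j n hpt);
  hpath1 : forall j m (t : mono m n),
    hpath j m t (mconst m ord_max) = act (mconst m ord0) (b j) }.

Lemma hfib_eq n (x y : hfib_simp n) :
  hpt x = hpt y -> (forall j m t e, hpath x j m t e = hpath y j m t e) -> x = y.
Proof.
case: x y => [x p p0 p1] [y q q0 q1] /= exy epq.
have e : p = q by apply/funext => j; apply: path_eq.
case: _ / exy q0 => q0; case: _ / e q0 q1 {epq} => q0 q1.
by rewrite (Prop_irrelevance p0 q0) (Prop_irrelevance p1 q1).
Qed.

Definition hfib_act m n (f : mono m n) (x : hfib_simp n) : hfib_simp m.
Proof.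
exists (act f (hpt x)) (fun j => act f (hpath x j)).
- by move=> j l t; rewrite /= hpath0 actM sfunP.
- by move=> j l t; rewrite /= hpath1.
Defined.

Definition hfib : sset.
Proof.
exists hfib_simp hfib_act.
- by move=> n x; apply: hfib_eq => //=; rewrite act1.
- by move=> m n p g f x; apply: hfib_eq => //=; rewrite actM.
Defined.

Definition hfib_pt : smap hfib A := @SMap hfib A hpt (fun _ _ _ _ => erefl).

Definition hfib_const (a : A 0) (ab : forall j, v j 0 a = b j) : hfib 0.
Proof.
exists a (fun j => path_const (b j)).
- by move=> j m t; rewrite /= ab.
- by move=> j m t; rewrite /=; congr (act _ _); apply: mono_eq => i; rewrite !ord1.
Defined.
End HFib.

Section HFibMap.
Variables (J J' : Type) (A A' B : sset) (v : J -> smap A B) (b : J -> B 0)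
  (v' : J' -> smap A' B) (b' : J' -> B 0) (phi : J' -> J) (g : smap A A').
Hypothesis vg : forall j n (a : A n), v' j n (g n a) = v (phi j) n a.
Hypothesis bphi : forall j, b' j = b (phi j).

Definition hfib_fun n (x : hfib v b n) : hfib v' b' n.
Proof.
exists (g n (hpt x)) (fun j => hpath x (phi j)).
- by move=> j m t; rewrite hpath0 vg.
- by move=> j m t; rewrite hpath1 bphi.
Defined.

Definition hfib_map : smap (hfib v b) (hfib v' b').
Proof.
exists hfib_fun => m n f x; apply: hfib_eq => //=; exact: sfunP.
Defined.

Lemma hfib_map_const (a : A 0) ab a'b' :
  hfib_map 0 (hfib_const (a := a) ab) = hfib_const (a := g 0 a) a'b'.
Proof. by apply: hfib_eq => //= j m t e; rewrite bphi. Qed.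
End HFibMap.

Record diag (E : category) := Diag {
  dobj :> E -> sset;
  dact : forall a b, hom a b -> smap (dobj a) (dobj b);
  dact1 : forall a n (x : dobj a n), dact (idm a) n x = x;
  dactM : forall a b c (g : hom b c) (f : hom a b) n (x : dobj a n),
    dact (comp g f) n x = dact g n (dact f n x) }.
Arguments dact {_} _ {_ _} _.

(* Presheaves of spaces on a category: strict functors to simplicial sets.  When
   their values are Kan complexes they model all presheaves on C with values in
   the infinity-category of spaces. *)
Definition psh (C : category) := diag (op C).
Definition res (C : category) (F : psh C) (a b : C) (f : hom a b) :
  smap (F b) (F a) := dact F (f : hom (b : op C) a).

Section DComp.
Variables (E' E : category) (X : diag E) (G : functor E' E).
Fact dcomp1 a n (x : X (G a) n) : dact X (fmap G (idm a)) n x = x.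
Proof. by rewrite fmap1 dact1. Qed.
Fact dcompM a b c (g : hom b c) (f : hom a b) n (x : X (G a) n) :
  dact X (fmap G (comp g f)) n x = dact X (fmap G g) n (dact X (fmap G f) n x).
Proof. by rewrite fmapM dactM. Qed.
Definition dcomp : diag E' := Diag dcomp1 dcompM.
End DComp.

Definition ordinal_cat (n : nat) : category :=
  @poset_cat 'I_n.+1 (fun i j => i <= j) (fun i => leqnn i)
    (fun j i k => @leq_trans j i k).

Definition ordinal_functor m n (f : mono m n) :
  functor (ordinal_cat m) (ordinal_cat n).
Proof.
by exists (mfun f : ordinal_cat m -> ordinal_cat n) (fun i j ij => monoP f ij)
  => *; apply: bool_irrelevance.
Defined.

Section Nerve.
Variable C : category.
Definition nerve_act m n (f : mono m n) (s : functor (ordinal_cat n) C) :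
  functor (ordinal_cat m) C := compF s (ordinal_functor f).
Definition nerve : sset.
Proof.
exists (fun n => functor (ordinal_cat n) C) nerve_act.
- by move=> n s; apply: functor_eq.
- by move=> m n p g f s; apply: functor_eq.
Defined.
End Nerve.

Definition nerve_map (C D : category) (G : functor C D) : smap (nerve C) (nerve D).
Proof.
exists (fun n s => compF G s) => m n f s.
by apply: functor_eq.
Defined.

Section HoLim.
Variables (E : category) (X : diag E).

(* The Bousfield-Kan homotopy limit, that is the simplicial set of natural
   transformations from e |-> N(E/e) to X; it computes the limit of the
   corresponding diagram of spaces when X takes values in Kan complexes. *)
Record holim_simp (n : nat) := HoLimSimp {
  lfun :> forall (e : E) m, mono m n -> nerve (slice e) m -> X e m;
  lfun_act : forall e l m (f : mono l m) (t : mono m n) (s : nerve (slice e) m),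
    lfun (mcomp t f) (act f s) = act f (lfun t s);
  lfun_nat : forall e e' (u : hom e e') m (t : mono m n) (s : nerve (slice e) m),
    lfun t (nerve_map (comma_post (idF E) u) m s) = dact X u m (lfun t s) }.

Lemma holim_eq n (x y : holim_simp n) :
  (forall e m t s, x e m t s = y e m t s) -> x = y.
Proof.
case: x y => [x xa xn] [y ya yn] /= e.
have {}e : x = y.
  apply: functional_extensionality_dep => a.
  apply: functional_extensionality_dep => m.
  by apply/funext => t; apply/funext => s.
case: _ / e ya yn => ya yn.
by rewrite (Prop_irrelevance xa ya) (Prop_irrelevance xn yn).
Qed.

Definition holim_act m n (f : mono m n) (x : holim_simp n) : holim_simp m.
Proof.
exists (fun e l t s => x e l (mcomp f t) s).
- by move=> *; rewrite -lfun_act.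
- by move=> *; rewrite -lfun_nat.
Defined.

Definition holim : sset.
Proof. by exists holim_simp holim_act => *; apply: holim_eq. Defined.

Section Cone.
Variables (A : sset) (c : forall e : E, smap A (X e)).
Hypothesis cP : forall (e e' : E) (u : hom e e') n (a : A n),
  dact X u n (c e n a) = c e' n a.
Definition cone_fun n (a : A n) : holim n.
Proof.
exists (fun e m t s => c e m (act t a)).
- by move=> *; rewrite actM sfunP.
- by move=> *; rewrite cP.
Defined.
Definition to_holim : smap A holim.
Proof.
by exists cone_fun => m n f a; apply: holim_eq => *; rewrite /= actM.
Defined.
End Cone.
End HoLim.

Record dmap (E' E : category) (G : functor E' E) (X : diag E) (Y : diag E') :=
  DMap {
    dfun :> forall e : E', smap (X (G e)) (Y e);
    dfunP : forall (e e' : E') (u : hom e e') n (x : X (G e) n),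
      dfun e' n (dact X (fmap G u) n x) = dact Y u n (dfun e n x) }.

Section HoLimMap.
Variables (E' E : category) (G : functor E' E) (X : diag E) (Y : diag E').
Variable (al : dmap G X Y).

Definition holim_fun n (x : holim X n) : holim Y n.
Proof.
exists (fun e m t s => al e m (x (G e) m t (nerve_map (slice_map G e) m s))).
- move=> e l m f t s; rewrite -sfunP; congr (al e l _).
  by rewrite -lfun_act; congr (x _ _ _ _); rewrite -sfunP.
- move=> e e' u m t s; rewrite -dfunP -lfun_nat; congr (al e' m (x _ _ _ _)).
  apply: functor_eq => /= [a|a b f].
    by rewrite /slice_map_obj /cpost_obj /= fmapM.
  by apply: comma_hom_heq; rewrite /= fmapM.
Defined.

Definition holim_map : smap (holim X) (holim Y).
Proof. by exists holim_fun => *; apply: holim_eq. Defined.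
End HoLimMap.

Section HoLimMapEq.

Lemma holim_map_eq (E' E : category) (G H : functor E' E) (X : diag E)
    (Y : diag E') (al : dmap G X Y) (be : dmap H X Y) :
  G = H ->
  (forall e n (x : X (G e) n) (y : X (H e) n),
     existT (fun d : E => X d n) (G e) x = existT _ (H e) y ->
     al e n x = be e n y) ->
  forall n (x : holim X n), holim_map al n x = holim_map be n x.
Proof.
move=> e; case: _ / e be => be ab n x.
by apply: holim_eq => e m t s; apply: ab.
Qed.

Fact dmap_idP (E : category) (X : diag E) (e e' : E) (u : hom e e') n (x : X e n) :
  sid (X e') n (dact X (fmap (idF E) u) n x) = dact X u n (sid (X e) n x).
Proof. by []. Qed.
Definition dmap_id (E : category) (X : diag E) : dmap (idF E) X X :=
  @DMap E E (idF E) X X (fun e => sid (X e)) (@dmap_idP E X).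

Lemma holim_map_id (E : category) (X : diag E) n (x : holim X n) :
  holim_map (dmap_id X) n x = x.
Proof.
apply: holim_eq => e m t s /=; congr (lfun x t _).
apply: functor_eq => [a|a b f] /=; first by case: (fobj s a).
case: (fmap s f); case: (fobj s a) => ? ?; case: (fobj s b) => ? ? /= h hP.
exact: comma_hom_heq.
Qed.

Section DMapComp.
Variables (E'' E' E : category) (G : functor E' E) (H : functor E'' E').
Variables (X : diag E) (Y : diag E') (Z : diag E'').
Variables (al : dmap G X Y) (be : dmap H Y Z).
Fact dmap_compP (e e' : E'') (u : hom e e') n (x : X (G (H e)) n) :
  be e' n (al (H e') n (dact X (fmap G (fmap H u)) n x)) =
  dact Z u n (be e n (al (H e) n x)).
Proof. by rewrite !dfunP. Qed.
Definition dmap_comp : dmap (compF G H) X Z :=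
  @DMap _ _ (compF G H) X Z (fun e => scomp (be e) (al (H e))) dmap_compP.

Lemma holim_map_comp n (x : holim X n) :
  holim_map be n (holim_map al n x) = holim_map dmap_comp n x.
Proof.
apply: holim_eq => e m t s /=; congr (be _ _ (al _ _ (lfun x t _))).
apply: functor_eq => [a|a b f] //=.
exact: comma_hom_heq.
Qed.
End DMapComp.
End HoLimMapEq.

Section HRan.
Variables (C D : category) (i : functor C D) (F : psh C).

Definition ran_diag (T : D) : diag (op (comma i T)) :=
  dcomp F (opF (comma_proj i T)).

Definition ran_dmap (T T' : D) (h : hom T T') :
  dmap (opF (comma_post i h)) (ran_diag T') (ran_diag T).
Proof.
by exists (fun e : op (comma i T) => sid (F (cdom e))).
Defined.

Lemma comma_post1 (T : D) : comma_post i (idm T) = idF (comma i T).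
Proof.
apply: functor_eq => [[c f]|[c f] [c' f'] [u uP]].
  by rewrite /= /cpost_obj /= comp1m.
by apply: comma_hom_heq; rewrite comp1m.
Qed.

Lemma comma_postM (T T' T'' : D) (g : hom T' T'') (h : hom T T') :
  comma_post i (comp g h) = compF (comma_post i g) (comma_post i h).
Proof.
apply: functor_eq => [[c f]|[c f] [c' f'] [u uP]].
  by rewrite /= /cpost_obj /= compA.
by apply: comma_hom_heq; rewrite compA.
Qed.

Lemma ran_diag_inj (T : D) (d d' : op (comma i T)) n
    (x : ran_diag T d n) (y : ran_diag T d' n) :
  existT (fun d => ran_diag T d n) d x = existT _ d' y ->
  existT (fun c : C => F c n) (cdom d) x = existT _ (cdom d') y.
Proof.
exact: (congr1 (fun p : {d : op (comma i T) & ran_diag T d n} =>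
  existT (fun c : C => F c n) (cdom (projT1 p)) (projT2 p))).
Qed.

Fact ran_id (T : D) n (x : holim (ran_diag T) n) :
  holim_map (ran_dmap (idm T)) n x = x.
Proof.
rewrite -[RHS]holim_map_id; apply: holim_map_eq.
  by rewrite comma_post1.
move=> e m x' y /ran_diag_inj exy.
exact: (@existT_inj C (fun c => F c m) _ _ _ exy).
Qed.

Fact ran_comp (T T' T'' : D) (g : hom T' T'') (h : hom T T') n
    (x : holim (ran_diag T'') n) :
  holim_map (ran_dmap (comp g h)) n x =
  holim_map (ran_dmap h) n (holim_map (ran_dmap g) n x).
Proof.
rewrite holim_map_comp; apply: holim_map_eq.
  by rewrite comma_postM; apply: functor_eq.
move=> e m x' y /ran_diag_inj exy.
exact: (@existT_inj C (fun c => F c m) _ _ _ exy).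
Qed.

(* The pointwise right Kan extension of F along i (op): its value at T is the
   homotopy limit of F c over the pairs (c, i c -> T). *)
Definition hran : psh D :=
  @Diag (op D) (fun T => holim (ran_diag T))
    (fun T' T h => holim_map (ran_dmap (h : hom (T : D) T')))
    ran_id (fun _ _ _ h g => ran_comp g h).

(* The counit (i^* hran) -> F at c, evaluation at the identity of i c. *)
Definition hran_id (c : C) : op (comma i (i c)) := CommaObj (idm (i c)).
Definition hran_counit (c : C) : smap (hran (i c)) (F c).
Proof.
exists (fun n (x : holim (ran_diag (i c)) n) =>
  lfun x (mid n) (constF (ordinal_cat n) (slice_id (hran_id c)))).
move=> m n f x; apply: etrans (lfun_act x f (mid n) _); congr (lfun x _ _).
by apply: functor_eq.
Defined.

(* When i is fully faithful, with inverse j on arrows, the map F c -> hran (i c)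
   restricting x along all arrows to c; it is a section of the counit. *)
Section Unit.
Variable j : forall a b : C, hom (i a) (i b) -> hom a b.
Hypothesis fmapK : forall (a b : C) (f : hom a b), j (fmap i f) = f.
Hypothesis jK : forall (a b : C) (f : hom (i a) (i b)), fmap i (j f) = f.

Fact ran_coneP (c : C) (e e' : op (comma i (i c))) (u : hom e e') n (x : F c n) :
  dact (ran_diag (i c)) u n (res F (j (carr e)) n x) = res F (j (carr e')) n x.
Proof.
rewrite /= /res -dactM; congr (dact F _ n x) => /=.
by rewrite -(chomP u) -[in RHS](jK (carr e)) -fmapM fmapK.
Qed.
Definition hran_unit (c : C) : smap (F c) (hran (i c)) :=
  @to_holim _ (ran_diag (i c)) (F c)
    (fun e : op (comma i (i c)) => res F (j (carr e))) (@ran_coneP c).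

Lemma hran_unitK (c : C) n (x : F c n) : hran_counit c n (hran_unit c n x) = x.
Proof. by rewrite /= act1 /res -(fmap1 i) fmapK dact1. Qed.
End Unit.
End HRan.

Record tree := Tree {
  tdisp : Order.disp_t;
  edge :> finPOrderType tdisp;
  root : edge;
  leaves : {set edge};
  rootP : forall x : edge, (root <= x)%O;
  downP : forall x y z : edge, (y <= x)%O -> (z <= x)%O -> (y >=< z)%O;
  leavesP : forall l x : edge, l \in leaves -> (l <= x)%O -> x = l }.

Definition inputs (T : tree) (e : T) : {set T} :=
  [set x | (e < x)%O && [forall y : T, (e < y <= x)%O ==> (y == x)]].

Definition valence (T : tree) (e : T) : nat := #|inputs e|.

Definition closed_tree (T : tree) : Prop := leaves T = set0.

(* The operations s -> c of Free(T): the closure of the generators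
   v(e) -> e, for e not a leaf, under identities, partial compositions and
   permutations of the inputs.  Since distinct generators have distinct
   outputs and the inputs of a generator are distinct, an element of the free
   operad is determined by its inputs and its output, so that its sets of
   operations have at most one element and can be given as propositions; an
   operad map is then a map of colours under which operations are preserved. *)
Inductive free_op (T : tree) : seq T -> T -> Prop :=
| FreeId c : free_op [:: c] c
| FreeGen e : e \notin leaves T -> free_op (enum (inputs e)) e
| FreeComp s1 s2 s c d :
    free_op (s1 ++ c :: s2) d -> free_op s c -> free_op (s1 ++ s ++ s2) d
| FreePerm s s' c : perm_eq s s' -> free_op s c -> free_op s' c.

Record tree_hom (T T' : tree) := TreeHom {
  tfun :> T -> T';
  tfunP : forall s c, free_op s c -> free_op (map tfun s) (tfun c) }.

Lemma tree_hom_eq T T' (f g : tree_hom T T') : tfun f =1 tfun g -> f = g.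
Proof.
by case: f g => [f fP] [g gP] /= /funext e; case: _ / e gP => gP;
  rewrite (Prop_irrelevance fP gP).
Qed.

Definition tree_id (T : tree) : tree_hom T T.
Proof. by exists id => s c; rewrite map_id. Defined.

Definition tree_comp (T T' T'' : tree) (g : tree_hom T' T'') (f : tree_hom T T') :
  tree_hom T T''.
Proof.
by exists (fun x => g (f x)) => s c /(tfunP f) /(tfunP g); rewrite -map_comp.
Defined.

Definition Omega : category.
Proof. by exists tree tree_hom tree_id tree_comp => *; apply: tree_hom_eq. Defined.

Section Hom.

Lemma free_op_map (T T' : tree) (f : T -> T') :
  (forall e, e \notin leaves T -> free_op (map f (enum (inputs e))) (f e)) ->
  forall s c, free_op s c -> free_op (map f s) (f c).
Proof.
move=> fgen s c; elim=> {s c} [c|e /fgen //|s1 s2 s c d _ + _ IH|s s' c ss' _ IH].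
- exact: FreeId.
- rewrite !map_cat => /= IH1; exact: FreeComp IH1 IH.
- by apply: FreePerm IH; apply: perm_map.
Qed.

Variable T : tree.

Lemma free_op_flatten (g : T -> seq T) (s1 s : seq T) (c : T) :
  free_op (s1 ++ s) c -> {in s, forall d, free_op (g d) d} ->
  free_op (s1 ++ flatten (map g s)) c.
Proof.
elim: s s1 => [|d s IH] s1 //= op gP.
rewrite catA; apply: IH; last by move=> x xs; apply: gP; rewrite inE xs orbT.
by rewrite -catA; apply: FreeComp op _; apply: gP; rewrite mem_head.
Qed.

Lemma input_below (c x : T) :
  (c < x)%O -> exists2 d, d \in inputs c & (d <= x)%O.
Proof.
move=> cx; pose P (y : T) := (c < y <= x)%O.
have Px : P x by rewrite /P cx lexx.
have [d /andP[cd dx] dmin] := arg_minnP (fun y : T => #|[set z | (z <= y)%O]|) Px.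
exists d => //; rewrite inE cd; apply/forallP => y; apply/implyP => /andP[cy yd].
have := dmin y; rewrite /P cy (le_trans yd dx) => /(_ isT) le_card.
have sub : [set z | (z <= y)%O] \subset [set z | (z <= d)%O].
  by apply/subsetP => z; rewrite !inE => /le_trans; apply.
have /setP/(_ d) : [set z | (z <= y)%O] = [set z | (z <= d)%O].
  by apply/eqP; rewrite eqEcard sub.
by rewrite !inE lexx => dy; rewrite eq_le yd dy.
Qed.

Lemma input_below_eq (c d d' x : T) : d \in inputs c -> d' \in inputs c ->
  (d <= x)%O -> (d' <= x)%O -> d = d'.
Proof.
wlog dd' : d d' / (d <= d')%O => [H di d'i dx d'x|].
  by case/orP: (downP dx d'x) => ?; [apply: H | apply/esym; apply: H].
rewrite !inE => /andP[cd _] /andP[_ /forallP/(_ d)].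
by rewrite cd dd' => /eqP.
Qed.

Lemma free_op_closed (c : T) (s : seq T) : closed_tree T -> uniq s ->
  {in s, forall x, (c <= x)%O} -> {in s &, forall x y, (x <= y)%O -> x = y} ->
  free_op s c.
Proof.
move=> Tc; have [n] := ubnP #|[set x | (c < x)%O]|.
elim: n c s => // n IH c s /ltnSE le_n us sc anti.
case: (boolP (c \in s)) => cs.
  have -> : s = [:: c]; last exact: FreeId.
  case: s us sc anti cs {le_n} => [|a [|b s]] //= us sc anti.
    by rewrite inE => /eqP ->.
  move=> cs; have e x : x \in [:: a, b & s] -> c = x.
    by move=> xs; apply: anti => //; apply: sc.
  by move: us; rewrite -(e a) ?(mem_head) // -(e b) ?inE ?eqxx ?orbT.
have sc' x : x \in s -> (c < x)%O.
  by move=> xs; rewrite lt_neqAle sc // andbT; apply: contraNneq cs => ->.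
pose g d := [seq x <- s | (d <= x)%O].
apply: (@FreePerm _ (flatten (map g (enum (inputs c))))); last first.
  apply: (@free_op_flatten g [::]); first by apply: FreeGen; rewrite Tc inE.
  move=> d; rewrite mem_enum inE => /andP[cd _]; apply: IH.
  - apply: leq_trans le_n; apply: proper_card; apply/properP; split.
      by apply/subsetP => x; rewrite !inE; apply: lt_trans.
    by exists d; rewrite !inE // ltxx.
  - exact: filter_uniq.
  - by move=> x; rewrite mem_filter => /andP[].
  - by move=> x y; rewrite !mem_filter => /andP[_ xs] /andP[_ ys]; apply: anti.
apply: uniq_perm => //.
  have : {subset enum (inputs c) <= inputs c} by move=> d; rewrite mem_enum.
  elim: (enum _) (enum_uniq (inputs c)) => //= d ds IHd /andP[dds uds] sub.
  rewrite cat_uniq filter_uniq //= IHd //; last first.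
    by move=> e eds; apply: sub; rewrite inE eds orbT.
  rewrite andbT; apply/hasPn => x /flatten_mapP[d' d'ds].
  rewrite !mem_filter => /andP[d'x xs]; apply: contra dds => /andP[dx _].
  rewrite (@input_below_eq c d d' x) //; apply: sub; first exact: mem_head.
  by rewrite inE d'ds orbT.
move=> x; apply/flatten_mapP/idP => [[d _]|xs].
  by rewrite mem_filter => /andP[].
have [d di dx] := input_below (sc' x xs).
by exists d; rewrite ?mem_enum // mem_filter dx.
Qed.
End Hom.

Lemma independent_hom (T T' : tree) (f : T -> T') : closed_tree T' ->
  {homo f : x y / (x <= y)%O} -> {homo f : x y / (x >< y)%O} ->
  forall s c, free_op s c -> free_op (map f s) (f c).
Proof.
move=> Tc fo fi; apply: free_op_map => e _.
have inj : {in inputs e &, forall x y, (f x <= f y)%O -> x = y}.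
  move=> x y xe ye; case: (boolP (x >=< y)%O) => [/orP[] xy _|/fi].
  - exact: input_below_eq xe ye xy (lexx _).
  - by apply/esym; exact: input_below_eq ye xe xy (lexx _).
  by move=> + le; rewrite /Order.comparable le.
apply: free_op_closed => //.
- rewrite map_inj_in_uniq ?enum_uniq // => x y; rewrite !mem_enum => xe ye fxy.
  by apply: inj => //; rewrite fxy.
- move=> _ /mapP[x + ->]; rewrite mem_enum inE => /andP[/ltW ex _]; exact: fo.
- move=> _ _ /mapP[x + ->] /mapP[y + ->]; rewrite !mem_enum => xe ye le.
  by rewrite (inj x y).
Qed.


Section Converse.

Lemma free_op_ge (T : tree) (s : seq T) (c : T) :
  free_op s c -> {in s, forall x, (c <= x)%O}.
Proof.
elim=> {s c} [c x|e _ x|s1 s2 s c d _ IH1 _ IH2 x|s s' c ss' _ IH x].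
- by rewrite inE => /eqP ->.
- by rewrite mem_enum inE => /andP[/ltW].
- have dc : (d <= c)%O by apply: IH1; rewrite mem_cat mem_head orbT.
  rewrite !mem_cat; case/or3P => xs; last 1 first.
  + by apply: IH1; rewrite mem_cat inE xs !orbT.
  + by apply: IH1; rewrite mem_cat xs.
  + exact: le_trans dc (IH2 _ xs).
- by rewrite -(perm_mem ss'); apply: IH.
Qed.

Lemma free_op_antichain (T : tree) (s : seq T) (c : T) : free_op s c ->
  uniq s /\ {in s &, forall x y, (x <= y)%O -> x = y}.
Proof.
elim=> {s c} [c|e _|s1 s2 s c d _ [u1 a1] op [u2 a2]|s s' c ss' _ [us as_]].
- by split=> // x y; rewrite !inE => /eqP -> /eqP ->.
- split=> [|x y]; first exact: enum_uniq.
  by rewrite !mem_enum => xe ye xy; apply: input_below_eq xe ye xy (lexx _).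
- pose L := s1 ++ s2.
  have pL : perm_eq (s1 ++ c :: s2) (c :: L) by rewrite -cat1s perm_catCA.
  have psL : perm_eq (s1 ++ s ++ s2) (s ++ L) by rewrite perm_catCA.
  have a1' : {in c :: L &, forall x y, (x <= y)%O -> x = y}.
    by move=> x y; rewrite -!(perm_mem pL); apply: a1.
  have /= /andP[cL uL] : uniq (c :: L) by rewrite -(perm_uniq pL).
  have ge := free_op_ge op.
  have no x y : x \in s -> y \in L -> (x <= y)%O \/ (y <= x)%O -> False.
    move=> xs yL xy; move/negP: cL; apply.
    have yL' : y \in c :: L by rewrite inE yL orbT.
    suff -> : c = y by [].
    have cmp : (c >=< y)%O.
      case: xy => xy; first by rewrite /Order.comparable (le_trans (ge x xs) xy).
      exact: downP (ge x xs) xy.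
    case/orP: cmp => le; first by apply: a1' le; rewrite ?mem_head.
    by apply/esym; apply: a1' le; rewrite ?mem_head.
  split.
    rewrite (perm_uniq psL) cat_uniq u2 uL andbT /=; apply/hasPn => x xL.
    by apply/negP => xs; apply: (no x x) => //; left.
  have mem x : x \in s1 ++ s ++ s2 -> (x \in s) || (x \in L).
    by rewrite (perm_mem psL) (mem_cat x s L).
  move=> x y /mem /orP[xs|xL] /mem /orP[ys|yL] xy.
  + exact: a2.
  + by case: (no x y xs yL (or_introl xy)).
  + by case: (no y x ys xL (or_intror xy)).
  + by apply: a1' xy; rewrite inE ?xL ?yL orbT.
- by split=> [|x y]; rewrite -?(perm_uniq ss') -?(perm_mem ss') //; apply: as_.
Qed.

Variables (T T' : tree) (f : tree_hom T T').

Lemma free_gen_hom (c x : T) : (c < x)%O ->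
  free_op (map f (enum (inputs c))) (f c).
Proof.
move=> cx; apply/(tfunP f)/FreeGen/negP => cl.
by move: (cx); rewrite (leavesP cl (ltW cx)) ltxx.
Qed.

Lemma tree_hom_le : {homo f : x y / (x <= y)%O}.
Proof.
move=> x y; have [n] := ubnP #|[set z | (x < z)%O]|.
elim: n x => // n IH x /ltnSE le_n; rewrite le_eqVlt => /predU1P[-> //|xy].
have [d dx dy] := input_below xy.
apply: (@le_trans _ _ (f d)).
  by apply: (free_op_ge (free_gen_hom xy)); rewrite map_f ?mem_enum.
apply: IH dy; apply: leq_trans le_n; apply: proper_card.
move: dx; rewrite inE => /andP[xd _]; apply/properP; split.
  by apply/subsetP => z; rewrite !inE; apply: lt_trans.
by exists d; rewrite !inE // ltxx.
Qed.

Lemma tree_hom_independent : {homo f : x y / (x >< y)%O}.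
Proof.
move=> x y; rewrite /Order.comparable negb_or => /andP[xy yx].
pose P (z : T) := (z <= x)%O && (z <= y)%O.
have P0 : P (root T) by rewrite /P !rootP.
have [z /andP[zx zy] zmax] := arg_maxnP (fun z : T => #|[set t | (t <= z)%O]|) P0.
have zx' : (z < x)%O.
  by rewrite lt_neqAle zx andbT; apply: contraNneq xy => <-.
have zy' : (z < y)%O.
  by rewrite lt_neqAle zy andbT; apply: contraNneq yx => <-.
have [d dz dx] := input_below zx'; have [d' d'z d'y] := input_below zy'.
have dd' : d != d'.
  apply/eqP => e; subst d'.
  have := zmax d; rewrite /P dx d'y => /(_ isT); apply/negP; rewrite -ltnNge.
  move: dz; rewrite inE => /andP[zd _]; apply: proper_card; apply/properP; split.
    by apply/subsetP => t; rewrite !inE => /le_trans; apply; apply: ltW.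
  by exists d; rewrite !inE ?lexx // (lt_geF zd).
have [us anti] := free_op_antichain (free_gen_hom zx').
have md : f d \in map f (enum (inputs z)) by rewrite map_f ?mem_enum.
have md' : f d' \in map f (enum (inputs z)) by rewrite map_f ?mem_enum.
have ne : f d <> f d'.
  have nth_e (t : T) : t \in inputs z ->
      nth (f z) (map f (enum (inputs z))) (index t (enum (inputs z))) = f t.
    by move=> tz; rewrite (nth_map z) ?index_mem ?mem_enum // nth_index ?mem_enum.
  move=> e; move/eqP: dd'; apply.
  have := nth_uniq (f z) (i := index d (enum (inputs z)))
    (j := index d' (enum (inputs z))) _ _ us.
  rewrite !size_map !index_mem !mem_enum => /(_ dz d'z); rewrite !nth_e // e eqxx.
  move/esym/eqP/(congr1 (nth z (enum (inputs z)))).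
  by rewrite !nth_index ?mem_enum.
have no (t : T') : (f d <= t)%O -> (f d' <= t)%O -> False.
  move=> dt d't; apply: ne; case/orP: (downP dt d't) => le; first exact: anti.
  by apply/esym; apply: anti.
apply/norP; split; apply/negP => le.
  exact: no (le_trans (tree_hom_le dx) le) (tree_hom_le d'y).
exact: no (tree_hom_le dx) (le_trans (tree_hom_le d'y) le).
Qed.
End Converse.

(* Hence Omega^c, the full subcategory of Omega on closed trees, consists of the
   maps preserving the order and independence. *)
Lemma closed_homP (T T' : tree) (f : T -> T') : closed_tree T' ->
  (forall s c, free_op s c -> free_op (map f s) (f c)) <->
  ({homo f : x y / (x <= y)%O} /\ {homo f : x y / (x >< y)%O}).
Proof.
move=> T'c; split=> [fP|[]]; last exact: independent_hom.
by split; [apply: (tree_hom_le (TreeHom fP)) | apply: (tree_hom_independent (TreeHom fP))].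
Qed.

Section Closure.
Variable T : tree.
Fact clo_leavesP (l x : T) : l \in set0 -> (l <= x)%O -> x = l.
Proof. by rewrite inE. Qed.
Definition clo : tree := @Tree _ (edge T) (root T) set0 (@rootP T) (@downP T) clo_leavesP.
End Closure.

(* The adjunction between closure and inclusion: the transpose
   T^c -> T' of a morphism T -> T' to a closed tree. *)
Section CloAdj.
Variables (T T' : tree) (f : tree_hom T T').
Hypothesis T'c : closed_tree T'.
Fact clo_adjP s (c : clo T) : free_op s c -> free_op (map f s) (f c).
Proof.
move: s c; apply: (@free_op_map (clo T) T') => e _.
rewrite -[inputs e]/(inputs (e : T)).
have [el|enl] := boolP ((e : T) \in leaves T); last first.
  exact/(tfunP f)/FreeGen.
have -> : inputs (e : T) = set0.
  apply/setP => x; rewrite !inE; apply/andP => -[ex _].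
  by move: (ex); rewrite (leavesP el (ltW ex)) ltxx.
by rewrite enum_set0; apply: free_op_closed.
Qed.
Definition clo_adj : tree_hom (clo T) T' := @TreeHom (clo T) T' f clo_adjP.
End CloAdj.

Definition clo_unit (T : tree) : tree_hom T (clo T).
Proof.
exists (fun x : T => x : clo T) => s c; rewrite map_id.
elim=> {s c} [c|e _|s1 s2 s c d _ op1 _ op2|s s' c p _ op].
- exact: (@FreeId (clo T)).
- by apply: (@FreeGen (clo T)); rewrite inE.
- exact: (@FreeComp (clo T) _ _ _ _ _ op1 op2).
- exact: (@FreePerm (clo T) _ _ _ p op).
Defined.

Definition clo_hom (T T' : tree) (f : tree_hom T T') : tree_hom (clo T) (clo T') :=
  clo_adj (tree_comp (clo_unit T') f) (erefl : closed_tree (clo T')).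

Definition corolla_edge (S : finType) : Type := option S.
HB.instance Definition _ (S : finType) := Finite.on (corolla_edge S).

Section Corolla.
Variable S : finType.
Definition corolla_le (x y : corolla_edge S) := (x == None) || (x == y).
Fact corolla_refl : reflexive corolla_le.
Proof. by move=> x; rewrite /corolla_le eqxx orbT. Qed.
Fact corolla_anti : antisymmetric corolla_le.
Proof. by move=> [x|] [y|] //= /andP[/eqP]. Qed.
Fact corolla_trans : transitive corolla_le.
Proof. by move=> y x z /orP[/eqP->|/eqP->]. Qed.
Fact corolla_display : Order.disp_t. Proof. exact: Order.Disp tt tt. Qed.
HB.instance Definition _ := Order.Le_isPOrder.Build corolla_display
  (corolla_edge S) corolla_refl corolla_anti corolla_trans.
Fact corolla_bot (x : corolla_edge S) : ((None : corolla_edge S) <= x)%O.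
Proof. by []. Qed.

Lemma corolla_leE (x y : corolla_edge S) : (x <= y)%O = (x == None) || (x == y).
Proof. by []. Qed.

Fact corolla_downP (x y z : corolla_edge S) :
  (y <= x)%O -> (z <= x)%O -> (y >=< z)%O.
Proof.
rewrite /Order.comparable !corolla_leE.
by case/orP => [/eqP-> //|/eqP->] /orP[/eqP-> |/eqP->]; rewrite eqxx ?orbT.
Qed.
Fact corolla_leavesP (l x : corolla_edge S) :
  l \in [set Some s | s : S] -> (l <= x)%O -> x = l.
Proof. by case/imsetP => s _ -> /eqP. Qed.

(* The corolla with set of leaves S; its root is None. *)
Definition corolla : tree :=
  @Tree _ (corolla_edge S) None [set Some s | s : S] corolla_bot corolla_downP
    corolla_leavesP.

Lemma corolla_valence (e : corolla) :
  valence e = if e is None then #|S| else 0.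
Proof.
case: e => [s|]; rewrite /valence.
  suff -> : inputs (Some s : corolla) = set0 by rewrite cards0.
  apply/setP => x; rewrite !inE lt_neqAle corolla_leE /=.
  by case: eqP.
have inj : injective (@Some S) by move=> x y [].
rewrite -cardsT -(card_imset _ inj); apply: eq_card => x.
rewrite !inE lt_neqAle corolla_leE /=.
apply/idP/imsetP => [|[s _ ->]]; first by case: x => // s _; exists s.
apply/forallP => y; rewrite lt_neqAle !corolla_leE /=.
by apply/implyP => /andP[/andP[+ _]]; case: y.
Qed.
End Corolla.

Section Linear.
Variable n : nat.
Fact linear_rootP (x : 'I_n.+1) : (ord0 <= x)%O.
Proof. exact: leq0n. Qed.
Fact linear_downP (x y z : 'I_n.+1) : (y <= x)%O -> (z <= x)%O -> (y >=< z)%O.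
Proof. by move=> _ _; apply: le_total. Qed.
Fact linear_leavesP (l x : 'I_n.+1) :
  l \in [set ord_max] -> (l <= x)%O -> x = l.
Proof.
rewrite inE => /eqP -> le; apply/eqP; rewrite eq_le le andbT.
exact: leq_ord.
Qed.
Definition linear : tree :=
  @Tree _ 'I_n.+1 ord0 [set ord_max] linear_rootP linear_downP linear_leavesP.
Lemma linear_valence (e : linear) : valence e <= 1.
Proof.
rewrite leqNgt; apply/negP => /card_gt1P[x [y [xe ye /eqP]]]; apply.
have [xy|/ltW yx] := leP (x : 'I_n.+1) y.
  exact: input_below_eq xe ye xy (lexx _).
by apply/esym; exact: input_below_eq ye xe yx (lexx _).
Qed.
End Linear.

Definition eta : tree := linear 0.

(* Elements of {0, 1, ..., oo}, with None for oo. *)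
Definition natinf := option nat.
Definition le_inf (m n : natinf) : bool :=
  match m, n with
  | _, None => true
  | None, Some _ => false
  | Some m, Some n => m <= n
  end.

Lemma le_inf_trans m n p : le_inf m n -> le_inf n p -> le_inf m p.
Proof. by case: m n p => [m|] [n|] [p|] //=; apply: leq_trans. Qed.

Definition dendroidal (k : natinf) (T : tree) : Prop :=
  forall e : T, le_inf (Some (valence e)) k.

Record ctree (k : natinf) := CTree {
  ctree_tree :> tree;
  ctree_closed : closed_tree ctree_tree;
  ctree_dend : dendroidal k ctree_tree }.
Arguments ctree_dend {k} _ _.

Definition Omegac (k : natinf) : category := @full Omega (ctree k) (@ctree_tree k).

Section Inclusion.
Variables (k j : natinf) (kj : le_inf k j).
Definition incl_obj (T : ctree k) : ctree j :=
  CTree (ctree_closed T) (fun e => le_inf_trans (ctree_dend T e) kj).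
Definition incl : functor (Omegac k) (Omegac j) :=
  @Functor (Omegac k) (Omegac j) incl_obj (fun _ _ f => f)
    (fun=> erefl) (fun _ _ _ _ _ => erefl).
End Inclusion.

Section CloCorolla.
Variables (k : natinf) (S : finType) (Sk : le_inf (Some #|S|) k).
Fact ccorolla_dend : dendroidal k (clo (corolla S)).
Proof.
move=> e; apply: le_inf_trans Sk.
by rewrite /= -[valence _]/(valence (e : corolla S)) corolla_valence; case: e.
Qed.
Definition ccorolla : Omegac k :=
  CTree (erefl : closed_tree (clo (corolla S))) ccorolla_dend.
End CloCorolla.

Fact card_ord_le k n : le_inf (Some n) k -> le_inf (Some #|'I_n|) k.
Proof. by rewrite card_ord. Qed.
Definition cC k n (nk : le_inf (Some n) k) : Omegac k := ccorolla (card_ord_le nk).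

Fact le_inf0 k : le_inf (Some 0) k. Proof. by case: k. Qed.
Definition cC0 k : Omegac k := cC (le_inf0 k).

Section CorollaMap.
Variables (k : natinf) (S S' : finType).
Variables (Sk : le_inf (Some #|S|) k) (S'k : le_inf (Some #|S'|) k).
Variables (f : S -> S') (f_inj : injective f).
Definition cc_fun (x : clo (corolla S)) : clo (corolla S') :=
  if x is Some s then Some (f s) else None.
Fact cc_funP s (c : clo (corolla S)) : free_op s c -> free_op (map cc_fun s) (cc_fun c).
Proof.
apply: independent_hom => //.
  by move=> [x|] [y|] //; rewrite !corolla_leE => /eqP[->] /=.
move=> [x|] [y|]; rewrite /Order.comparable !corolla_leE //=.
by apply: contra => /orP[] /eqP[/f_inj ->]; rewrite eqxx ?orbT.
Qed.
Definition ccorolla_map : hom (ccorolla Sk) (ccorolla S'k) :=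
  @TreeHom (clo (corolla S)) (clo (corolla S')) cc_fun cc_funP.
End CorollaMap.

Section EdgeMap.
Variables (k : natinf) (T : Omegac k) (e : ctree_tree T).
Fact edge_mapP s (c : clo (corolla 'I_0)) :
  free_op s c -> free_op (map (fun=> e) s) e.
Proof.
apply: independent_hom => //; first exact: ctree_closed.
by move=> [[]//|] [[]//|].
Qed.
Definition edge_map : hom (cC0 k) T :=
  @TreeHom (clo (corolla 'I_0)) T (fun=> e) edge_mapP.
End EdgeMap.

Definition subtree_inclusion (T T' : tree) (f : tree_hom T T') : Prop :=
  injective f /\
  forall (e0 e2 : T) (e' : T'), (f e0 <= e')%O -> (e' <= f e2)%O ->
    exists e, f e = e'.

Definition elementary (x : option nat) : tree :=
  if x is Some n then corolla 'I_n else eta.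

Section Elementary.
Variable T : tree.
Record el_obj := ElObj {
  el_shape : option nat;
  el_map : tree_hom (elementary el_shape) T;
  el_sub : subtree_inclusion el_map;
  el_val : forall n, el_shape = Some n -> valence (el_map (root _)) = n }.
Definition el_slice (x : el_obj) : @slice Omega T :=
  @CommaObj Omega Omega (idF Omega) T (elementary (el_shape x)) (el_map x).
Definition Omegael : category := full el_slice.
End Elementary.

Section Segal.
Variables (k : natinf) (F : psh (Omegac k)) (T : Omegac k).

Fact el_dend (x : Omegael T) : dendroidal k (clo (elementary (el_shape x))).
Proof.
case: x => [[n|] f fs fv]; last first.
  move=> e; suff e0 : valence e = 0 by rewrite e0 le_inf0.
  rewrite /valence /inputs; apply: eq_card0 => y.
  by rewrite !inE (ord1 (e : 'I_1)) (ord1 (y : 'I_1)) ltxx.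
apply: ccorolla_dend; rewrite card_ord -[n](fv n erefl); exact: (ctree_dend T).
Qed.
Definition el_clo_obj (x : Omegael T) : Omegac k :=
  CTree (erefl : closed_tree (clo (elementary (el_shape x)))) (@el_dend x).
Definition el_clo : functor (Omegael T) (Omegac k).
Proof.
apply: (@Functor (Omegael T) (Omegac k) el_clo_obj
  (fun x y (g : hom x y) => clo_hom (chom g))) => *; exact: tree_hom_eq.
Defined.
Definition segal_diag : diag (op (Omegael T)) := dcomp F (opF el_clo).

Definition el_transpose (x : Omegael T) : hom (el_clo x) T :=
  clo_adj (el_map x) (ctree_closed T).
Fact segal_coneP (x y : op (Omegael T)) (g : hom x y) n (a : F T n) :
  dact segal_diag g n (res F (el_transpose x) n a) = res F (el_transpose y) n a.
Proof.
rewrite /= /res -dactM; congr (dact F _ n a); apply: tree_hom_eq => e /=.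
exact: (congr1 (fun h : tree_hom (elementary (el_shape y)) T => h e) (chomP g)).
Qed.
Definition segal_map : smap (F T) (holim segal_diag) :=
  @to_holim _ segal_diag (F T) (fun x : op (Omegael T) => res F (el_transpose x))
    segal_coneP.
End Segal.

Definition Segal (k : natinf) (F : psh (Omegac k)) : Prop :=
  forall T : Omegac k, equivalence (segal_map F T).

Section CompleteSegal.
Variable W : psh Delta.

(* The inclusions of consecutive vertices [0] -> [n] and [1] -> [n]. *)
Record spine_obj (n : nat) := SpineObj {
  spine_dim : nat;
  spine_map : mono spine_dim n;
  spine_dim1 : spine_dim <= 1;
  spine_succ : forall i, spine_map i = spine_map ord0 + i :> nat }.
Definition spine_slice n (x : spine_obj n) : @slice Delta n :=
  @CommaObj Delta Delta (idF Delta) n (spine_dim x) (spine_map x).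
Definition spine (n : nat) : category := full (@spine_slice n).
Definition spineF (n : nat) : functor (spine n) Delta :=
  compF (comma_proj (idF Delta) n) (fullF (@spine_slice n)).
(* Its homotopy limit is W_1 x_{W_0} ... x_{W_0} W_1. *)
Definition spine_diag (n : nat) : diag (op (spine n)) := dcomp W (opF (spineF n)).

Fact spine_coneP n (x y : op (spine n)) (g : hom x y) m (a : W n m) :
  dact (spine_diag n) g m (res W (spine_map x : hom (_ : Delta) n) m a) =
  res W (spine_map y : hom (_ : Delta) n) m a.
Proof.
by rewrite /= /res -dactM; congr (dact W _ m a); exact: (chomP g).
Qed.
Definition spine_cone n : smap (W n) (holim (spine_diag n)) :=
  @to_holim _ (spine_diag n) (W n)
    (fun x : op (spine n) => res W (spine_map x : hom (_ : Delta) n)) (@spine_coneP n).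

Definition Segal_space : Prop := forall n, equivalence (spine_cone n).

Definition point := W 0 0.
Definition vertex n (i : 'I_n.+1) : smap (W n) (W 0) :=
  res W (mconst 0 i : hom (0 : Delta) n).

(* Rezk's map_W(x_0, ..., x_n), the fibre of W_n -> W_0^(n+1).  As for the Segal
   condition, no Reedy fibrancy of W is assumed: homotopy fibres and homotopy
   limits replace the strict ones. *)
Definition mapsp n (x : 'I_n.+1 -> point) : sset := hfib (@vertex n) x.

Section Face.
Variables (m n : nat) (f : mono m n).
Variables (x : 'I_n.+1 -> point) (y : 'I_m.+1 -> point).
Hypothesis xy : forall i, y i = x (f i).
Fact face_vertex i p (a : W n p) :
  vertex i p (res W (f : hom (m : Delta) n) p a) = vertex (f i) p a.
Proof. by rewrite /vertex /res -dactM; congr (dact W _ p a); exact: mono_eq. Qed.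
Definition face : smap (mapsp x) (mapsp y) := hfib_map face_vertex xy.
End Face.

Definition two (x y : point) (i : 'I_2) : point :=
  if val i is 0 then x else y.
Definition three (x y z : point) (i : 'I_3) : point :=
  match val i with 0 => x | 1 => y | _ => z end.

Definition coface n (i : 'I_n.+2) : mono n n.+1.
Proof.
exists (lift i) => a b ab; rewrite /= !/bump.
by apply: leq_add => //; case: (leqP i a) => // /leq_trans /(_ ab) ->.
Defined.

Fact face01 x y z i : two x y i = three x y z (coface ord_max i).
Proof. by case: i => [[|[|]]]. Qed.
Fact face12 x y z i : two y z i = three x y z (coface ord0 i).
Proof. by case: i => [[|[|]]]. Qed.
Fact face02 x y z i : two x z i = three x y z (coface (lift ord0 ord0) i).
Proof. by case: i => [[|[|]]]. Qed.

Definition composite (x y z : point) (f : mapsp (two x y) 0)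
    (g : mapsp (two y z) 0) (h : mapsp (two x z) 0) : Prop :=
  exists s : mapsp (three x y z) 0,
    [/\ same_component (face (face01 x y z) 0 s) f,
        same_component (face (face12 x y z) 0 s) g &
        same_component (face (face02 x y z) 0 s) h].

Definition deg n : smap (W 0) (W n) := res W (mconst n ord0 : hom (n : Delta) 0).

Fact deg_vertex n (i : 'I_n.+1) m (a : W 0 m) : vertex i m (deg n m a) = a.
Proof.
rewrite /vertex /deg /res -dactM -[RHS](dact1 (d := W)).
by congr (dact W _ m a); apply: mono_eq => j; rewrite (ord1 j).
Qed.

Fact ident_ends x (i : 'I_2) : vertex i 0 (deg 1 0 x) = two x x i.
Proof. by rewrite deg_vertex; case: i => [[|[|]]]. Qed.
Definition ident (x : point) : mapsp (two x x) 0 := hfib_const (ident_ends x).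

Definition source (g : W 1 0) : point := vertex ord0 0 g.
Definition target (g : W 1 0) : point := vertex ord_max 0 g.
Fact arrow_ends (g : W 1 0) (i : 'I_2) :
  vertex i 0 g = two (source g) (target g) i.
Proof.
by case: i => [[|[|//]] i]; rewrite /two /=; congr (vertex _ 0 g);
  apply: val_inj.
Qed.
Definition arrow (g : W 1 0) : mapsp (two (source g) (target g)) 0 :=
  hfib_const (arrow_ends g).

Definition homotopy_equivalence (g : W 1 0) : Prop :=
  exists f h : mapsp (two (target g) (source g)) 0,
    composite f (arrow g) (ident (target g)) /\
    composite (arrow g) h (ident (source g)).

(* W_hoequiv, the components of W_1 formed by homotopy equivalences. *)
Definition hoequiv_simp n (s : W 1 n) : Prop :=
  forall v : mono 0 n, homotopy_equivalence (act v s).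
Fact hoequiv_act m n (f : mono m n) (s : W 1 n) :
  hoequiv_simp s -> hoequiv_simp (act f s).
Proof. by move=> sP v; rewrite -actM. Qed.
Definition hoequiv : sset := ssub hoequiv_act.

Lemma composite_deg (x p q r : point) (a b c : W 1 0)
    (av : forall i, vertex i 0 a = two p q i)
    (bv : forall i, vertex i 0 b = two q r i)
    (cv : forall i, vertex i 0 c = two p r i) :
  p = x -> q = x -> r = x ->
  a = deg 1 0 x -> b = deg 1 0 x -> c = deg 1 0 x ->
  composite (hfib_const av) (hfib_const bv) (hfib_const cv).
Proof.
move=> ep eq er ea eb ec; subst p q r.
have sv i : vertex i 0 (deg 2 0 x) = three x x x i.
  by rewrite deg_vertex; case: i => [[|[|[|]]]].
have dd (f : mono 1 2) : deg 1 0 x = res W (f : hom (1 : Delta) 2) 0 (deg 2 0 x).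
  by rewrite /deg /res -dactM; congr (dact W _ 0 x); apply: mono_eq.
have E (y y' : 'I_2 -> point) f fx (d : W 1 0) dv : d = deg 1 0 x ->
    same_component (@face 1 2 f (three x x x) y fx 0 (hfib_const sv))
      (hfib_const (a := d) dv : mapsp y 0).
  move=> ed; have -> : face fx 0 (hfib_const sv) = hfib_const dv.
    apply: hfib_eq => [|j m t e] /=; first by rewrite ed -dd.
    by rewrite fx.
  exact: rst_refl.
by exists (hfib_const sv); split; apply: E.
Qed.

Lemma deg_homotopy_equivalence (x : W 0 0) : homotopy_equivalence (deg 1 0 x).
Proof.
have yx : target (deg 1 0 x) = x by rewrite /target deg_vertex.
have zx : source (deg 1 0 x) = x by rewrite /source deg_vertex.
have fv i : vertex i 0 (deg 1 0 x) =
    two (target (deg 1 0 x)) (source (deg 1 0 x)) i.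
  by rewrite yx zx deg_vertex; case: i => [[|[|]]].
exists (hfib_const fv), (hfib_const fv).
by split; apply: (@composite_deg x); rewrite ?yx ?zx.
Qed.

Definition deg_hoequiv : smap (W 0) hoequiv.
Proof.
have H n (a : W 0 n) : hoequiv_simp (deg 1 n a).
  by move=> v; rewrite -sfunP; apply: deg_homotopy_equivalence.
exists (fun n a => exist _ (deg 1 n a) (H n a)) => m n f a.
by apply: eq_exist; rewrite /= sfunP.
Defined.

Definition complete_Segal_space : Prop :=
  Segal_space /\ equivalence deg_hoequiv.
End CompleteSegal.

Section LinearFunctor.
Variables (k : natinf) (k1 : le_inf (Some 1) k).
Fact clinear_dend n : dendroidal k (clo (linear n)).
Proof.
by move=> e; apply: le_inf_trans k1; rewrite /=; apply: (@linear_valence n e).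
Qed.
Definition clinear_obj (n : Delta) : Omegac k :=
  CTree (erefl : closed_tree (clo (linear n))) (@clinear_dend n).
Fact clinear_mapP m n (f : mono m n) s (c : clo (linear m)) :
  free_op s c -> free_op (map (f : clo (linear m) -> clo (linear n)) s) (f c).
Proof.
apply: independent_hom => // [x y|x y]; first exact: (monoP f).
by move=> /negP[]; apply: (le_total (x : 'I_m.+1) y).
Qed.
Definition clinear : functor Delta (Omegac k).
Proof.
apply: (@Functor Delta (Omegac k) clinear_obj (fun m n (f : mono m n) =>
  @TreeHom (clo (linear m)) (clo (linear n)) f (clinear_mapP f))) => *;
  exact: tree_hom_eq.
Defined.
End LinearFunctor.

Record unital_operad (k : natinf) (k1 : le_inf (Some 1) k) := UnitalOperad {
  operad_psh :> psh (Omegac k);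
  operad_Kan : forall T, Kan (operad_psh T);
  operad_Segal : Segal operad_psh;
  operad_complete : complete_Segal_space (dcomp operad_psh (opF (clinear k1))) }.

Section Mul.
Variables (k : natinf) (F : psh (Omegac k)).

Definition colours : sset := F (cC0 k).
Definition colour := colours 0.

Section Inputs.
Variables (S : finType) (Sk : le_inf (Some #|S|) k).
Variables (X : S -> colour) (Y : colour).
Definition edge_colour (e : corolla_edge S) : colour :=
  if e is Some s then X s else Y.
Definition edge_res (e : corolla_edge S) : smap (F (ccorolla Sk)) colours :=
  res F (@edge_map k (ccorolla Sk) e).
(* Mul_F((X_s)_{s in S}; Y), for a family of inputs indexed by a finite set S *)
Definition Mul : sset := hfib edge_res edge_colour.
End Inputs.
End Mul.

Section MulEmpty.
Variables (k : natinf) (F : psh (Omegac k)).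
Variables (S : finType) (Sk : le_inf (Some #|S|) k) (S0 : S -> False).
Variables (X : S -> colour F) (Y : colour F).

Definition to_point (A : sset) : smap A (simplex 0) :=
  @SMap A (simplex 0) (fun n _ => mconst n ord0) (fun _ _ _ _ => erefl).

Let f (s : S) : 'I_0 := False_rect _ (S0 s).
Let f_inj : injective f. Proof. by move=> s; case: (S0 s). Qed.
Let r : hom (ccorolla Sk) (cC0 k) := ccorolla_map Sk (card_ord_le (le_inf0 k)) f_inj.
Let none : corolla_edge S := None.

Let resK n (a : F (ccorolla Sk) n) : res F r n (edge_res F Sk none n a) = a.
Proof.
rewrite /edge_res /res -dactM -[RHS](dact1 (d := F)); congr (dact F _ n a).
by apply: tree_hom_eq => -[s|] //; case: (S0 s).
Qed.
Let Kres n (a : colours F n) (e : corolla_edge S) : edge_res F Sk e n (res F r n a) = a.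
Proof.
rewrite /edge_res /res -dactM -[RHS](dact1 (d := F)); congr (dact F _ n a).
by apply: tree_hom_eq => -[[]|] //; case: e => // s; case: (S0 s).
Qed.
Let ends (e : corolla_edge S) : edge_res F Sk e 0 (res F r 0 Y) = edge_colour X Y e.
Proof. by rewrite Kres; case: e => // s; case: (S0 s). Qed.

Let pt : smap (simplex 0) (Mul Sk X Y).
Proof.
exists (fun n (t : simplex 0 n) => act t (hfib_const ends)) => m n t x.
exact: actM.
Defined.

Let e_none (e : corolla_edge S) : e = none.
Proof. by case: e => // s; case: (S0 s). Qed.

Let mmax n (d e : mono n 1) : mono n 1.
Proof.
exists (fun i => if d i <= e i then e i else d i) => a b ab.
have dab := monoP d ab; have eab := monoP e ab.
case: (leqP (d a) (e a)) => ?; case: (leqP (d b) (e b)) => ? //.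
  exact: leq_trans eab (ltnW _).
exact: leq_trans dab _.
Defined.

Let mmax_s n (e : mono n 1) : mmax e (mconst n ord0) = e.
Proof.
by apply: mono_eq => i /=; case: leqP => //; rewrite leqn0 => /eqP ei; apply: val_inj.
Qed.
Let mmax_0 n (e : mono n 1) : mmax (mconst n ord0) e = e.
Proof. exact: mono_eq. Qed.
Let mmax_t n (e : mono n 1) : mmax e (mconst n ord_max) = mconst n ord_max.
Proof. by apply: mono_eq => i /=; rewrite leq_ord. Qed.
Let mmax_1 n (e : mono n 1) : mmax (mconst n ord_max) e = mconst n ord_max.
Proof.
apply: mono_eq => i /=; case: leqP => // le; apply: val_inj.
by apply/eqP; rewrite eqn_leq le leq_ord.
Qed.
Let mmaxM m n (t : mono m n) (d e : mono n 1) :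
  mcomp (mmax d e) t = mmax (mcomp d t) (mcomp e t).
Proof. exact: mono_eq. Qed.

Let hpaths n (x : Mul Sk X Y n) (d : mono n 1) : paths (colours F) n.
Proof.
exists (fun m t e => hpath x none m t (mmax (mcomp d t) e)) => l m g t e.
by rewrite -pfunP mmaxM.
Defined.

Let h n (x : Mul Sk X Y n) (d : mono n 1) : Mul Sk X Y n.
Proof.
exists (res F r n (hpath x none n (mid n) d)) (fun=> hpaths x d).
- by move=> e m t; rewrite Kres -pfunP /= mmax_s.
- by move=> e m t; rewrite /= mmax_t hpath1 [e]e_none.
Defined.

Lemma Mul_empty : equivalence (to_point (Mul Sk X Y)).
Proof.
exists pt; split; last first.
  suff -> : scomp (to_point (Mul Sk X Y)) pt = sid _ by apply: rst_refl.
  apply: smap_eq => n t; apply: mono_eq => i; exact/esym/ord1.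
apply/rst_sym/rst_step; exists h; split=> [m n t x e|n x|n x].
- apply: hfib_eq => [|c l u v] /=; last by congr (hpath x _ _ _).
  by rewrite -sfunP -pfunP.
- apply: hfib_eq => [|c l u v] /=; first by rewrite hpath0 act1 resK.
  by rewrite -[mcomp _ _]/(mconst l ord0) mmax_0 [c]e_none.
- apply: hfib_eq => [|c l u v] /=.
    rewrite hpath1 sfunP; congr (act _ _); exact: mono_eq.
  rewrite -[mcomp _ _]/(mconst l ord_max) mmax_1 hpath1 [c]e_none.
  by congr (act _ _); apply: mono_eq.
Qed.
End MulEmpty.

Section Powerset.
Variables (k : natinf) (S : finType).

Definition subset_cat : category :=
  @poset_cat {set S} (fun A B => A \subset B) (fun A => subxx A)
    (fun B A C => @subset_trans _ A B C).

Record small_set := SmallSet {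
  sset_set :> {set S};
  sset_le : le_inf (Some #|sset_set|) k }.
Definition powerset_le : category := full (sset_set : small_set -> subset_cat).

Fact small_set_le (I : small_set) : le_inf (Some #|{: {s | s \in I}}|) k.
Proof. by rewrite card_sig; apply: (sset_le I). Qed.
(* The closed subcorolla {r} + I of the closed S-corolla, whose root r is None
   and whose set of inputs v(r) is identified with S. *)
Definition sub_corolla (I : powerset_le) : Omegac k := ccorolla (small_set_le I).

Section Incl.
Variables (I J : powerset_le) (IJ : hom I J).
Definition sub_incl (s : {s | s \in (I : small_set)}) : {s | s \in (J : small_set)} :=
  exist _ (val s) (subsetP IJ _ (valP s)).
Fact sub_incl_inj : injective sub_incl.
Proof. by move=> s t /(congr1 val) /= /val_inj. Qed.
Definition sub_corolla_map : hom (sub_corolla I) (sub_corolla J) :=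
  ccorolla_map _ _ sub_incl_inj.
End Incl.

Definition sub_corollaF : functor powerset_le (Omegac k).
Proof.
apply: (@Functor powerset_le (Omegac k) sub_corolla sub_corolla_map) => [I|I J K g f];
  apply: tree_hom_eq => -[s|] //; congr (Some _); exact: val_inj.
Defined.
End Powerset.

Section RightKan.
Variables (k j : natinf) (kj : le_inf k j) (F : psh (Omegac k)).

Definition Rk : psh (Omegac j) := hran (incl kj) F.

(* A colour of F as a colour of Rk, by the section hran_unit of the counit of
   the Kan extension.  The arrow cC0_incl is the identity: its source and its
   target only differ in the proof of k-dendroidality. *)
Definition cC0_incl : hom (cC0 j) (incl kj (cC0 k)) := tree_id (cC0 j).
Definition Rk_colours : smap (colours F) (colours Rk) :=
  scomp (res Rk cC0_incl)
    (@hran_unit _ _ (incl kj) F (fun _ _ f => f)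
      (fun _ _ _ => erefl) (fun _ _ _ => erefl) (cC0 k)).

Section Corolla.
Variables (S : finType) (Sj : le_inf (Some #|S|) j).

Definition sub_comma_obj (I : powerset_le k S) : comma (incl kj) (ccorolla Sj) :=
  @CommaObj (Omegac k) (Omegac j) (incl kj) (ccorolla Sj) (sub_corolla I)
    (@ccorolla_map j _ _ (le_inf_trans (small_set_le I) kj) Sj
      (fun s : {s | s \in (I : small_set k S)} => val s) val_inj).
Fact sub_commaP (I J : powerset_le k S) (IJ : hom I J) :
  comp (carr (sub_comma_obj J)) (fmap (incl kj) (sub_corolla_map IJ)) =
  carr (sub_comma_obj I).
Proof. by apply: tree_hom_eq => -[s|]. Qed.
Definition sub_comma : functor (powerset_le k S) (comma (incl kj) (ccorolla Sj)).
Proof.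
apply: (@Functor (powerset_le k S) (comma (incl kj) (ccorolla Sj)) sub_comma_obj
  (fun I J IJ => @CommaHom _ _ (incl kj) (ccorolla Sj) (sub_comma_obj I)
    (sub_comma_obj J) _ (sub_commaP IJ))) => *; apply: comma_hom_eq.
- exact: (fmap1 (sub_corollaF k S)).
- exact: (fmapM (sub_corollaF k S)).
Defined.

Definition sub_diag : diag (op (powerset_le k S)) := dcomp F (opF (sub_corollaF k S)).

Fact sub_dmapP (I J : op (powerset_le k S)) (u : hom I J) n (x : F (sub_corolla I) n) :
  sid _ n (dact (ran_diag (incl kj) F (ccorolla Sj)) (fmap (opF sub_comma) u) n x) =
  dact sub_diag u n (sid _ n x).
Proof. by []. Qed.
Definition sub_dmap :
    dmap (opF sub_comma) (ran_diag (incl kj) F (ccorolla Sj)) sub_diag :=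
  @DMap _ _ (opF sub_comma) (ran_diag (incl kj) F (ccorolla Sj)) sub_diag
    (fun I => sid (F (sub_corolla I))) sub_dmapP.

(* The canonical map, with components the restrictions to the C_I. *)
Definition comparison : smap (Rk (ccorolla Sj)) (holim sub_diag) :=
  holim_map sub_dmap.
End Corolla.

Section MulDiag.
Variables (S : finType) (X : S -> colour F) (Y : colour F).

Definition sub_Mul (I : powerset_le k S) : sset :=
  Mul (small_set_le I) (fun s : {s | s \in (I : small_set k S)} => X (val s)) Y.

Section Map.
Variables (I J : powerset_le k S) (IJ : hom I J).
Fact sub_Mul_res (e : corolla_edge {s | s \in (I : small_set k S)}) n
    (a : F (sub_corolla J) n) :
  edge_res F (small_set_le I) e n (res F (sub_corolla_map IJ) n a) =
  edge_res F (small_set_le J) (cc_fun (sub_incl IJ) e) n a.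
Proof.
by rewrite /edge_res /res -dactM; congr (dact F _ n a); apply: tree_hom_eq.
Qed.
Fact sub_Mul_colour (e : corolla_edge {s | s \in (I : small_set k S)}) :
  edge_colour (fun s : {s | s \in (I : small_set k S)} => X (val s)) Y e =
  edge_colour (fun s : {s | s \in (J : small_set k S)} => X (val s)) Y
    (cc_fun (sub_incl IJ) e).
Proof. by case: e. Qed.
Definition sub_Mul_map : smap (sub_Mul J) (sub_Mul I) :=
  hfib_map sub_Mul_res sub_Mul_colour.
End Map.

Definition Mul_diag : diag (op (powerset_le k S)).
Proof.
apply: (@Diag (op (powerset_le k S)) sub_Mul (fun J I IJ => sub_Mul_map IJ)).
- move=> I n x; apply: hfib_eq => [|e m t u] /=.
    by rewrite -[RHS](dact1 (d := sub_diag S)).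
  apply: (congr1 (fun e => hpath x e m t u)).
  by case: e => [s|] //; congr Some; apply: val_inj.
- move=> K J I JK IJ n x; apply: hfib_eq => [|e m t u] /=.
    exact: (dactM (d := sub_diag S)).
  apply: (congr1 (fun e => hpath x e m t u)).
  by case: e => [s|] //; congr Some; apply: val_inj.
Defined.

Definition Mul_dmap : dmap (idF (op (powerset_le k S))) Mul_diag (sub_diag S).
Proof. by exists (fun I => hfib_pt _ _). Defined.
End MulDiag.
End RightKan.

(* Main.v *)
Require Import Defs.
From mathcomp Require Import all_boot.
From mathcomp Require Import all_order boolp zify.
From Stdlib Require Import Relations.Relation_Operators.
(* [comp] is composition of morphisms, not of functions. *)
Import Defs.

(* For a map f from a closed tree T to the closed corolla C_n, the preimage of
   each leaf is a chain, and so is that of the root, all of whose elements are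
   comparable to every edge of T.  Hence f hits at most k leaves when T is
   k-dendroidal, and the smallest subcorolla C_I containing the image of f gives a
   left adjoint to the inclusion of the poset of the C_I, |I| <= k, in the comma
   category computing R_k F(C_n).  Limits over the two therefore agree; in the
   Bousfield-Kan model the adjunction yields explicit homotopies, since natural
   transformations of slices interpolate between simplices.  For colours one uses
   the terminal object of the comma category.

   For multimorphisms the edges of C_n are added to the poset of subcorollas:
   this is still the target of a left adjoint, and under it the homotopy fibre of
   R_k F(C_n) becomes that of the evaluation at the edges.  The remaining point is
   to concatenate, for each edge e, a homotopy parametrised by the contractible
   nerve of the subcorollas containing e with a path to the prescribed colour;
   this is an instance of the homotopy extension property of the Kan complex
   F(C_0). *)

Set Implicit Arguments.
Unset Strict Implicit.
Unset Printing Implicit Defensive.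
Import Order.TTheory.

(** * Homotopy extension for Kan complexes *)

(** A surjective self-map of a finite set is injective, so [f] is strictly increasing. Counting up
    from 0 it moves nothing down, and counting down from [n] it moves nothing up. *)
Lemma mono_sur_id n (f : mono n n) : (forall j, exists i, f i == j) -> f =1 id.
Proof.
move=> fs; have fi : injective f.
  pose g j := xchoose (fs j).
  have gK : cancel g f by move=> j; apply/eqP/(xchooseP (fs j)).
  exact: (can_inj (g := g) ((bij_can_sym (injF_bij (can_inj gK)) f).2 gK)).
have lt (i j : 'I_n.+1) : i < j -> f i < f j.
  move=> ij; rewrite ltn_neqAle (monoP f (ltnW ij)) andbT.
  by apply: contraTneq ij => /val_inj /fi ->; rewrite ltnn.
have ge m (i : 'I_n.+1) : i = m :> nat -> i <= f i.
  elim: m i => [|m IH] i im; first by rewrite im.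
  have mn : m < n.+1 by have := ltn_ord i; lia.
  have := lt (Ordinal mn) i; have := IH (Ordinal mn) erefl.
  by rewrite /= im => ? /(_ (ltnSn m)); lia.
have le m (i : 'I_n.+1) : i + m = n -> f i <= i.
  elim: m i => [|m IH] i im; first by have := ltn_ord (f i); lia.
  have mn : i.+1 < n.+1 by lia.
  have := lt i (Ordinal mn); have := IH (Ordinal mn).
  by rewrite /= => /(_ _) h1 /(_ (ltnSn i)) h2; have := h1 ltac:(lia); lia.
move=> i; apply/val_inj/eqP; rewrite eqn_leq (ge i) // (le (n - i)) //.
by have := ltn_ord i; lia.
Qed.

(** The factor [g] is the coface skipping [j], so [p] is [n - 1]; for [n = 0] no vertex would be
    left to hit. *)
Lemma mono_miss m n (f : mono m n) j : (forall i, f i != j) ->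
  exists p (g : mono p n) (h : mono m p), p < n /\ f = mcomp g h.
Proof.
case: n f j => [|n] f j fj; first by have := fj ord0; rewrite !ord1.
have hP (i : 'I_m.+1) : unbump j (f i) < n.+1.
  have := fj i; rewrite -val_eqE /= /unbump.
  by have := ltn_ord (f i); have := ltn_ord j; lia.
have hM (i i' : 'I_m.+1) : i <= i' -> Ordinal (hP i) <= Ordinal (hP i').
  by move=> /(monoP f) /=; rewrite /unbump; lia.
exists n, (coface j), (Mono hM); split=> //; apply: mono_eq => i; apply: val_inj.
rewrite /= /bump /unbump; have := fj i; rewrite -val_eqE /=; lia.
Qed.

(** The thresholds from 0 to [n.+1] give all monotone maps from [n] to [1]; every threshold beyond
    [n] gives the constant 0. *)
Definition cut_fun n (i : nat) (a : 'I_n.+1) : 'I_2 := if i <= a then ord_max else ord0.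
Fact cut_mono n i (a b : 'I_n.+1) : a <= b -> cut_fun i a <= cut_fun i b.
Proof. by move=> ab; rewrite /cut_fun; case: ifP => // ia; rewrite (leq_trans ia ab). Qed.
Definition cut n (i : nat) : mono n 1 := Mono (@cut_mono n i).

(** The degeneracy identifying [i] and [i.+1]; for [i <= n] the default value of [inord] never
    occurs. *)
Definition codeg_fun n (i : nat) (a : 'I_n.+2) : 'I_n.+1 :=
  inord (if a <= i then a : nat else a.-1).
Lemma codegE n i (a : 'I_n.+2) : i <= n ->
  codeg_fun i a = (if a <= i then a : nat else a.-1) :> nat.
Proof. by move=> le; rewrite inordK //; have := ltn_ord a; case: ifP; lia. Qed.
Fact codeg_mono n (i : 'I_n.+1) (a b : 'I_n.+2) : a <= b -> codeg_fun i a <= codeg_fun i b.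
Proof.
by move=> ab; rewrite !codegE; try (by rewrite -ltnS ltn_ord); case: ifP; case: ifP; lia.
Qed.
(* The i-th top simplex of the prism [n] x [1] is (codeg i, cut i.+1). *)
Definition codeg n (i : 'I_n.+1) : mono n.+1 n := Mono (@codeg_mono n i).
Lemma codegV n (i : 'I_n.+1) (a : 'I_n.+2) :
  codeg_fun i a = (if a <= i then a : nat else a.-1) :> nat.
Proof. by rewrite codegE // -ltnS ltn_ord. Qed.

Lemma cut_top n i : n < i -> cut n i = mconst n ord0.
Proof.
move=> ni; apply: mono_eq => a; rewrite /= /cut_fun.
by have := ltn_ord a; case: ifP => //; lia.
Qed.

Definition nondegenerate (W : sset) n (w : W n) : Prop :=
  forall m (f : mono n m) (w' : W m), m < n -> w <> act f w'.

(* The uniqueness part of the Eilenberg-Zilber lemma. *)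
Lemma nondegenerate_act (W : sset) n (w w' : W n) m (f g : mono m n) :
  nondegenerate w -> (forall j, exists i, f i == j) ->
  act f w = act g w' -> w = w' /\ f = g.
Proof.
move=> w_nd fs fg.
(* Any section [s] of [f] is monotone and exhibits [w] as the pullback of [w'] along [g] after [s].
   Nondegeneracy makes this endomap surjective, hence the identity. *)
have key (s : 'I_n.+1 -> 'I_m.+1) : (forall j, f (s j) = j) ->
    w = w' /\ (forall j, g (s j) = j).
  move=> sK; have sM (i j : 'I_n.+1) : i <= j -> s i <= s j.
    move=> ij; rewrite leqNgt; apply/negP => lt.
    have := monoP f (ltnW lt); rewrite !sK => ji.
    have e : i = j by apply/val_inj/eqP; rewrite eqn_leq ij.
    by move: lt; rewrite e ltnn.
  pose d := Mono sM.
  have wd : w = act (mcomp g d) w'.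
    rewrite actM -fg -actM -[LHS](act1 w); congr (act _ w); apply: mono_eq => j.
    by rewrite /= sK.
  have gd : mcomp g d =1 id.
    apply: mono_sur_id => j; apply/existsP; rewrite -[X in is_true X]negbK negb_exists.
    apply/negP => /forallP /mono_miss[p [g' [k [lt e]]]].
    by apply: (@w_nd _ k (act g' w') lt); rewrite -actM -e.
  split=> //; rewrite wd -[RHS]act1; congr (act _ w'); exact: mono_eq.
pose s0 (j : 'I_n.+1) := xchoose (fs j).
have s0K j : f (s0 j) = j by apply/eqP/(xchooseP (fs j)).
have [ww' _] := key s0 s0K; split=> //; apply: mono_eq => a.
(* A section of [f] through the given vertex [a], so that [key] at [f a] yields [g a = f a]. *)
pose s (j : 'I_n.+1) := if j == f a then a else s0 j.
have sK j : f (s j) = j by rewrite /s; case: eqP => [->|].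
by have [_ /(_ (f a))] := key s sK; rewrite /s eqxx.
Qed.

Section HomotopyExtension.
Variables (W A : sset) (AK : Kan A) (V : forall n, W n -> Prop).
Hypothesis Vact : forall m n (t : mono m n) (w : W n), V w -> V (act t w).
Variables (f : smap W A) (h : forall n, W n -> mono n 1 -> A n).
Hypothesis hP : forall m n (t : mono m n) (w : W n) d, V w ->
  h (act t w) (mcomp d t) = act t (h w d).
Hypothesis h0 : forall n (w : W n), V w -> h w (mconst n ord0) = f n w.

(** Partial homotopies are represented by their graphs, so that extending one is an inclusion of
    relations and stages can be united. *)
Let graph := forall n, W n -> mono n 1 -> A n -> Prop.
Let base : graph := fun n w d a =>
  (d = mconst n ord0 /\ a = f n w) \/ (V w /\ a = h w d).

Let dom (G : graph) n (w : W n) (d : mono n 1) := exists a, G n w d a.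

(* Graphs of partial homotopies.  The last clause makes it possible to adjoin
   the simplices of a prism two at a time, by filling a horn. *)
Record partial (G : graph) : Prop := Partial {
  partial_base : forall n w d a, base w d a -> G n w d a;
  partial_fun : forall n (w : W n) d a a', G n w d a -> G n w d a' -> a = a';
  partial_act : forall m n (t : mono m n) (w : W n) d a,
    G n w d a -> G m (act t w) (mcomp d t) (act t a);
  partial_sat : forall n (w : W n) (i : 'I_n.+1),
    dom G w (cut n i) -> dom G (act (codeg i) w) (cut n.+1 i.+1) }.

Lemma partial_base_ok : partial base.
Proof.
split=> // [n w d a a'|m n t w d a|n w i [a]] /=.
- case=> -[e ->] [] [e' ->] //; first by rewrite e h0.
  by rewrite e' h0.
- case=> [[-> ->]|[Vw ->]]; first by left; rewrite sfunP.
  by right; split; [apply: Vact | rewrite hP].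
(* For [i <= n] the map [cut n i] takes the value 1 at the last vertex, so it is not the constant 0
   of the bottom of the prism. *)
- case=> [[e _]|[Vw _]]; last by eexists; right; split; [apply: Vact|].
  have := congr1 (fun d : mono n 1 => val (d ord_max)) e.
  by rewrite /= /cut_fun /= -ltnS ltn_ord.
Qed.

Let dom_act G m n (t : mono m n) (w : W n) d : partial G ->
  dom G w d -> dom G (act t w) (mcomp d t).
Proof. by move=> GP [a /(partial_act GP t) Ga]; exists (act t a). Qed.

Let cyl (G : graph) n (w : W n) := forall m (t : mono m n) d, dom G (act t w) d.

Let cyl_miss G m n (t : mono m n) (w : W n) d j :
  (forall p, p < n -> forall w : W p, cyl G w) -> (forall i, t i != j) ->
  dom G (act t w) d.
Proof.
by move=> low /mono_miss[p [g [k [lt ->]]]]; rewrite actM; apply: low.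
Qed.

(** * Attaching the [i]-th top simplices of all prisms over [n]-simplices *)

Section Attach.
Variables (G : graph) (GP : partial G) (n : nat) (i : 'I_n.+1).
Hypothesis low : forall p, p < n -> forall w : W p, cyl G w.
Hypothesis top : forall w : W n, dom G w (cut n i.+1).

(** The face opposite [i.+1] is [w] with [cut n i.+1], which [top] provides. A face opposite any
    other [j] projects to a proper face of [w], namely the one missing [j'] below, and is covered by
    [low]. *)
Let face_dom (w : W n) m (t : mono m n.+1) (j : 'I_n.+2) : j != i :> nat ->
  (forall a, t a != j) -> dom G (act t (act (codeg i) w)) (mcomp (cut n.+1 i.+1) t).
Proof.
move=> ji tj; have tj' a : t a != j :> nat by rewrite (inj_eq val_inj).
have [ij|ij] := eqVneq (j : nat) i.+1.
  have -> : mcomp (cut n.+1 i.+1) t = mcomp (cut n i.+1) (mcomp (codeg i) t).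
    apply: mono_eq => a; rewrite /= /cut_fun codegV.
    by congr (if _ then _ else _); have := tj' a; case: ifP; lia.
  by rewrite -actM; apply: dom_act.
rewrite -actM; pose j' : nat := if j < i then j : nat else j.-1.
have j'n : j' < n.+1 by rewrite /j'; have := ltn_ord i; have := ltn_ord j; case: ifP; lia.
apply: (@cyl_miss G _ _ _ w _ (Ordinal j'n)) => // a; rewrite -(inj_eq val_inj) /= /j'.
rewrite codegV; have := tj' a.
by case: ifP; case: ifP; lia.
Qed.

Let miss (w : W n) : Prop := ~ dom G (act (codeg i) w) (cut n.+1 i.+1).

(** The prism over a degenerate simplex comes from a prism of lower dimension, already covered by
    [low]. *)
Let miss_nd w : miss w -> nondegenerate w.
Proof. by move=> mw m t w' lt e; apply: mw; rewrite e -actM; apply: low. Qed.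

(** If [t] hit every vertex other than [i], a monotone section would exhibit the face opposite [i],
    that is [w] with [cut n i], inside the domain. Saturation would then put the whole prism simplex
    there. *)
Let miss_horn w m (t : mono m n.+1) : miss w ->
  dom G (act t (act (codeg i) w)) (mcomp (cut n.+1 i.+1) t) ->
  exists2 j : 'I_n.+2, j != i :> nat & forall a, t a != j.
Proof.
move=> mw td; apply: contrapT => nh; apply: mw; apply: (partial_sat GP).
have ts (b : 'I_n.+1) : exists a, t a == @lift n.+2 (widen_ord (leqnSn _) i) b.
  apply/existsP; rewrite -[X in is_true X]negbK negb_exists; apply/negP => /forallP H.
  by apply: nh; exists (@lift n.+2 (widen_ord (leqnSn _) i) b); [|exact: H]; rewrite /= /bump; lia.
pose s b := xchoose (ts b).
have sK b : t (s b) = @lift n.+2 (widen_ord (leqnSn _) i) b by apply/eqP/(xchooseP (ts b)).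
have sM (b c : 'I_n.+1) : b <= c -> s b <= s c.
  move=> bc; rewrite leqNgt; apply/negP => lt; have := monoP t (ltnW lt).
  rewrite !sK /= /bump => cb.
  have e : b = c by apply/val_inj => /=; lia.
  by move: lt; rewrite e ltnn.
have := dom_act (Mono sM) GP td; rewrite -!actM.
have -> : mcomp (codeg i) (mcomp t (Mono sM)) = mid n.
  apply: mono_eq => b; apply: val_inj; rewrite /= codegV sK /= /bump; case: ifP; lia.
rewrite act1; congr dom; apply: mono_eq => b.
by rewrite /= /cut_fun sK /= /bump; congr (if _ then _ else _); lia.
Qed.

(** The values of [G] on the horn are unique, hence compatible with simplicial operators; they form
    a horn in [A], which the Kan condition fills. *)
Let filler w : miss w -> exists a : A n.+1, forall m (t : mono m n.+1) (j : 'I_n.+2),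
  j != i :> nat -> (forall b, t b != j) ->
  G (act t (act (codeg i) w)) (mcomp (cut n.+1 i.+1) t) (act t a).
Proof.
move=> mw; pose i' : 'I_n.+2 := widen_ord (leqnSn _) i.
have td m (t : horn i' m) :
    dom G (act (sval t) (act (codeg i) w)) (mcomp (cut n.+1 i.+1) (sval t)).
  by case: t => t [j ji tj]; apply: face_dom tj; rewrite (inj_eq val_inj j i').
pose k m (t : horn i' m) := sval (cid (td m t)).
have kP m t : G (act (sval t) (act (codeg i) w)) (mcomp (cut n.+1 i.+1) (sval t)) (k m t).
  exact: (svalP (cid (td m t))).
have kM m p (s : mono m p) (t : horn i' p) : k m (act s t) = act s (k p t).
  apply: (partial_fun GP) (kP m (act s t)) _ => /=.
  by have := partial_act GP s (kP p t); rewrite -actM.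
have [a aP] := AK (SMap kM).
exists a => m t j ji tj; have tH : in_horn i' t by exists j => //; rewrite -(inj_eq val_inj).
by have := kP m (exist _ t tH); have /= -> := aP m (exist _ t tH).
Qed.

Let fill (u : {w | miss w}) : A n.+1 := sval (cid (filler (svalP u))).

Let attach : graph := fun m v d b => G v d b \/
  exists (u : {w | miss w}) (t : mono m n.+1),
    [/\ v = act t (act (codeg i) (sval u)), d = mcomp (cut n.+1 i.+1) t & b = act t (fill u)].

Let attach_horn (u : {w | miss w}) m (t : mono m n.+1) :
  dom G (act t (act (codeg i) (sval u))) (mcomp (cut n.+1 i.+1) t) ->
  G (act t (act (codeg i) (sval u))) (mcomp (cut n.+1 i.+1) t) (act t (fill u)).
Proof.
case/(miss_horn (svalP u)) => j ji tj; apply: (svalP (cid (filler (svalP u)))) tj => //.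
Qed.

Let attach_sur (u : {w | miss w}) m (t : mono m n.+1) :
  ~ dom G (act t (act (codeg i) (sval u))) (mcomp (cut n.+1 i.+1) t) ->
  forall j : 'I_n.+2, j != i :> nat -> exists a, t a == j.
Proof.
move=> nd j ji; apply: contrapT => nt; apply: nd; apply: (@face_dom _ _ _ j ji) => a.
by apply/negP => ta; apply: nt; exists a.
Qed.

(** A new simplex hits every vertex except possibly [i], so its projection to [n] is surjective and
    Eilenberg-Zilber recovers [w] and this projection. The cut separates [i] from [i.+1], the only
    vertices that [codeg i] identifies. *)
Let attach_eq (u u' : {w | miss w}) m (t t' : mono m n.+1) :
  ~ dom G (act t (act (codeg i) (sval u))) (mcomp (cut n.+1 i.+1) t) ->
  act t (act (codeg i) (sval u)) = act t' (act (codeg i) (sval u')) ->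
  mcomp (cut n.+1 i.+1) t = mcomp (cut n.+1 i.+1) t' -> u = u' /\ t = t'.
Proof.
move=> nd; have ts := attach_sur nd; rewrite -!actM => e1 e2.
have [|e3 e4] := nondegenerate_act (miss_nd (svalP u)) _ e1.
  move=> j; have [a /eqP ta] := ts (lift (widen_ord (leqnSn n.+1) i) j)
    ltac:(by rewrite /= /bump; lia).
  exists a; apply/eqP/val_inj; rewrite /= codegV ta /= /bump; case: ifP; lia.
split; first by case: u u' e3 {nd ts e1} => w mw [w' mw'] /= e; apply: eq_exist.
apply: mono_eq => a; apply: val_inj.
have := congr1 (fun g : mono m n => val (g a)) e4.
have := congr1 (fun g : mono m 1 => val (g a)) e2.
by rewrite /= !codegV /cut_fun; do 4 case: ifP => //=; lia.
Qed.

Lemma attach_partial : partial attach.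
Proof.
split.
- by move=> m v d b bb; left; apply: (partial_base GP).
- move=> m v d b b'.
  have inG c c' : G v d c -> attach v d c' -> c = c'.
    move=> Gc [Gc'|[u [t [ev ed ->]]]]; first exact: (partial_fun GP) Gc Gc'.
    apply: (partial_fun GP) (Gc) _; rewrite ev ed; apply: attach_horn.
    by exists c; rewrite -ev -ed.
  case=> [Gb /(inG _ _ Gb) //|[u [t [ev ed eb]]]].
  case=> [Gb'|[u' [t' [ev' ed' eb']]]].
    by apply/esym/(inG _ _ Gb'); right; exists u, t.
  have [[c Gc]|nd] := pselect (dom G v d).
    have <- : c = b by apply: inG Gc _; right; exists u, t.
    by apply: inG Gc _; right; exists u', t'.
  have [] := @attach_eq u u' m t t'; rewrite -?ev -?ed //.
  by rewrite eb eb' => -> ->.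
- move=> l m s v d b [Gb|[u [t [-> -> ->]]]]; first by left; apply: (partial_act GP).
  by right; exists u, (mcomp t s); rewrite !actM.
move=> m v b [a [Ga|[u [t [ev ed ea]]]]].
  by have [a' Ga'] := partial_sat GP (ex_intro _ a Ga); exists a'; left.
have [td|nd] := pselect (dom G v (cut m b)).
  by have [a' Ga'] := partial_sat GP td; exists a'; left.
have ts : forall j : 'I_n.+2, j != i :> nat -> exists a, t a == j.
  by apply: (@attach_sur u); rewrite -ev -ed.
have tb x : (i < t x) = (b <= x).
  have := congr1 (fun g : mono m 1 => val (g x)) ed.
  by rewrite /= /cut_fun; case: ifP; case: ifP.
have [y /eqP ty] := ts (lift (widen_ord (leqnSn n.+1) i) i) ltac:(by rewrite /= /bump; lia).
have tbi : t b = i.+1 :> nat.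
  have le : b <= y by rewrite -tb ty /= /bump; lia.
  by have := monoP t le; have := tb b; rewrite ty leqnn /= /bump; lia.
(* This is [t] after [codeg b], except that the first of the two copies of [b] goes to [i] instead
   of [t b], which is [i.+1]. The change is invisible to [codeg i] and moves the cut from [b] to
   [b.+1]. *)
pose r (c : 'I_m.+2) : 'I_n.+2 :=
  if c == b :> nat then widen_ord (leqnSn n.+1) i else t (codeg b c).
have rE (c : 'I_m.+2) : r c = (if c == b :> nat then i : nat else t (codeg b c)) :> nat.
  by rewrite /r; case: ifP.
have rM (c d : 'I_m.+2) : c <= d -> r c <= r d.
  move=> cd; rewrite !rE; have /(monoP t) := monoP (codeg b) cd.
  have := tb (codeg b c); have := tb (codeg b d); rewrite /= !codegV.
  by case: ifP; case: ifP; case: ifP; case: ifP; lia.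
exists (act (Mono rM) (fill u)); right; exists u, (Mono rM); split=> //.
  rewrite ev -!actM; congr (act _ _); apply: mono_eq => c; apply: val_inj.
  rewrite /= !codegV !rE; case: eqP => [cb|//]; rewrite leqnn.
  have -> : t (codeg_fun b c) = t b.
    by congr (t _); apply: val_inj; rewrite /= codegV cb leqnn.
  by rewrite tbi; case: ifP; lia.
apply: mono_eq => c; rewrite /= /cut_fun rE; congr (if _ then _ else _).
have := tb (codeg b c); rewrite /= codegV; case: eqP => [->|]; first by rewrite !ltnn.
by move=> ?; case: ifP; lia.
Qed.

Lemma attach_step : exists2 G', partial G' &
  (forall m v d b, @G m v d b -> G' m v d b) /\
  (forall w : W n, dom G' (act (codeg i) w) (cut n.+1 i.+1)).
Proof.
exists attach; first exact: attach_partial.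
split=> [m v d b Gb|w]; first by left.
have [[b Gb]|nd] := pselect (dom G (act (codeg i) w) (cut n.+1 i.+1)).
  by exists b; left.
pose u : {w | miss w} := exist _ w nd.
exists (act (mid _) (fill u)); right; exists u, (mid _).
by rewrite act1; split=> //; apply: mono_eq.
Qed.
End Attach.

Let ext (G G' : graph) := forall n w d a, G n w d a -> G' n w d a.

(** The layers are attached from [i = n] down to 0: each one meets the preceding one, or the bottom
    of the prism, in its face opposite [i.+1]. *)
Let dim_step G n : partial G -> (forall p, p < n -> forall w : W p, cyl G w) ->
  exists2 G', partial G' & ext G G' /\ forall w : W n, cyl G' w.
Proof.
move=> GP low.
suff [G' G'P [GG' G's]] : exists2 G', partial G' & ext G G' /\
    forall (w : W n) (i : 'I_n.+1), dom G' (act (codeg i) w) (cut n.+1 i.+1).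
  exists G' => //; split=> // w m t d.
  (* The last value of [t] where [d] is 0, or 0 by default if there is none. The simplex [(t, d)]
     then factors through the top simplex number [b] by the map sending [c] to [t c + d c]. *)
  pose b := \max_(c : 'I_m.+1 | d c == ord0) (t c : nat).
  have bn : b < n.+1 by apply/bigmax_leqP => c _; rewrite -ltnS ltn_ord.
  have tlt (c : 'I_m.+1) : d c = ord0 -> t c <= b.
    by move=> dc; apply: (leq_bigmax_cond (F := fun c => t c : nat)); rewrite dc.
  have tge (c : 'I_m.+1) : d c != ord0 -> b <= t c.
    move=> dc; apply/bigmax_leqP => e /eqP de; apply: (monoP t).
    rewrite leqNgt; apply/negP => /ltnW /(monoP d); rewrite de leqn0 => /eqP dc0.
    by move/eqP: dc; apply; apply: val_inj.
  have sP (c : 'I_m.+1) : t c + d c < n.+2.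
    by have := ltn_ord (t c); have := ltn_ord (d c); lia.
  have sM (c e : 'I_m.+1) : c <= e -> Ordinal (sP c) <= Ordinal (sP e).
    by move=> ce; rewrite /= leq_add // ?(monoP t) ?(monoP d).
  have := dom_act (Mono sM) G'P (G's w (Ordinal bn)); rewrite -actM.
  have d01 (c : 'I_m.+1) : d c = ord0 \/ d c = ord_max.
    case: (d c) => [[|[|//]] dc]; [left | right]; exact: val_inj.
  congr dom.
    congr (act _ w); apply: mono_eq => c; apply: val_inj; rewrite /= codegE //=.
    case: (d01 c) (tlt c) (tge c) => -> /= tl tg; first by rewrite addn0 tl.
    by have := tg isT; case: ifP; lia.
  apply: mono_eq => c; rewrite /= /cut_fun /=.
  case: (d01 c) (tlt c) (tge c) => -> /= tl tg.
    by rewrite addn0 ltnNge tl.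
  by rewrite ifT //; have := tg isT; lia.
(* Here [q] counts the layers already attached, starting from the last. *)
suff H q : q <= n.+1 -> exists2 G', partial G' & ext G G' /\
    forall (w : W n) (i : 'I_n.+1), n.+1 - q <= i -> dom G' (act (codeg i) w) (cut n.+1 i.+1).
  have [G' G'P [GG' G's]] := H _ (leqnn _).
  by exists G' => //; split=> // w i; apply: G's; rewrite subnn.
elim: q => [|q IH] qn.
  rewrite subn0; exists G => //; split=> // w i; have := ltn_ord i; lia.
have [G1 G1P [GG1 G1s]] := IH (ltnW qn).
have in_ : n.+1 - q.+1 < n.+1 by lia.
have [|w|G2 G2P [G12 G2s]] := @attach_step G1 G1P n (Ordinal in_).
- by move=> p pn w m t d; have [a /GG1] := low p pn w m t d; exists a.
- rewrite /=; have [->|nz] := eqVneq q 0.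
    exists (f n w); apply: (partial_base G1P); left; split=> //.
    by apply: cut_top; lia.
  have in' : (n.+1 - q.+1).+1 < n.+1 by lia.
  have ge : n.+1 - q <= Ordinal in' by rewrite /=; lia.
  (* The face of the layer just attached, number [in'], opposite its vertex [in']: it is [w] with
     [cut n in'], the face needed by the next layer. *)
  pose s : mono n n.+1 := coface (widen_ord (leqnSn n.+1) (Ordinal in')).
  have := dom_act s G1P (G1s w (Ordinal in') ge); rewrite -actM.
  have -> : mcomp (codeg (Ordinal in')) s = mid n.
    apply: mono_eq => c; apply: val_inj; rewrite /= codegE //= /bump.
    by case: ifP; lia.
  rewrite act1; congr dom; apply: mono_eq => c.
  by rewrite /= /cut_fun /= /bump; congr (if _ then _ else _); lia.
exists G2 => //; split=> [m v d a /GG1 /G12 //|w i le].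
have [e|ne] := eqVneq (i : nat) (n.+1 - q.+1).
  by have -> : i = Ordinal in_ by apply: val_inj.
by have [|a /G12] := G1s w i; [lia | exists a].
Qed.

Let low (G : graph) n := forall p, p < n -> forall w : W p, cyl G w.

Let next n (G : {G | partial G /\ low G n}) :
  exists G' : {G | partial G /\ low G n.+1}, ext (sval G) (sval G').
Proof.
case: G => G [GP Gl] /=; have [G' G'P [GG' G'c]] := dim_step GP Gl.
have G'l : low G' n.+1.
  move=> p; rewrite ltnS leq_eqVlt => /predU1P[-> //|pn] w m t d.
  by have [a /GG'] := Gl p pn w m t d; exists a.
by exists (exist _ G' (conj G'P G'l)).
Qed.

Let start : {G | partial G /\ low G 0} :=
  exist _ base (conj partial_base_ok (fun p (p0 : p < 0) => False_ind _ (notF p0))).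

Let stage := fix stage n : {G | partial G /\ low G n} :=
  if n is m.+1 then sval (cid (next (stage m))) else start.

Let stage_ext m n : m <= n -> ext (sval (stage m)) (sval (stage n)).
Proof.
elim: n => [|n IH]; first by rewrite leqn0 => /eqP ->.
rewrite leq_eqVlt => /predU1P[-> //|mn] p w d a /(IH mn).
exact: (svalP (cid (next (stage n)))).
Qed.

(** The extension is the union of the stages. Stage [n.+1] contains all prisms over simplices of
    dimension at most [n], so the value over an [n]-simplex is read there and persists later. *)
Lemma homotopy_extension : exists H : forall n, W n -> mono n 1 -> A n,
  [/\ forall m n (t : mono m n) w d, H m (act t w) (mcomp d t) = act t (H n w d),
      forall n w, H n w (mconst n ord0) = f n w &
      forall n w d, V w -> H n w d = h w d].
Proof.
pose G n := sval (stage n); have GP n : partial (G n) := (svalP (stage n)).1.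
have tot n (w : W n) d : exists a, G n.+1 n w d a.
  have [a] := (svalP (stage n.+1)).2 n (ltnSn n) w n (mid n) d.
  by rewrite act1; exists a.
pose H n w d := sval (cid (@tot n w d)).
have HP n w d : G n.+1 n w d (H n w d) := svalP (cid (@tot n w d)).
have HE n w d a N : n < N -> G N n w d a -> H n w d = a.
  by move=> nN; apply: (partial_fun (GP N)); apply: (stage_ext nN); apply: HP.
exists H; split=> [m n t w d|n w|n w d Vw].
- apply: (HE _ _ _ _ (maxn m.+1 n.+1)); first exact: leq_maxl.
  apply: (partial_act (GP _)); apply: (stage_ext (leq_maxr m.+1 n.+1)).
  exact: HP.
- by apply: (HE _ _ _ _ n.+1) => //; apply: (partial_base (GP _)); left.
- by apply: (HE _ _ _ _ n.+1) => //; apply: (partial_base (GP _)); right.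
Qed.
End HomotopyExtension.

(** * Deformations of homotopy limits *)

(** A one-step homotopy kept as data, since its compatibility with evaluation maps is needed to pass
    to homotopy fibres. *)
Record homotopy (X Y : sset) (f g : smap X Y) := Homotopy {
  hfun :> forall n, X n -> mono n 1 -> Y n;
  hfunP : forall m n (t : mono m n) x d,
    hfun (act t x) (mcomp d t) = act t (hfun x d);
  hfun0 : forall n x, hfun x (mconst n ord0) = f n x;
  hfun1 : forall n x, hfun x (mconst n ord_max) = g n x }.

Lemma homotopy_homotopic (X Y : sset) (f g : smap X Y) : homotopy f g -> homotopic f g.
Proof. by case=> h hP h0 h1; apply: rst_step; exists h. Qed.

Lemma homotopic_compl (X Y Z : sset) (g : smap Y Z) (f f' : smap X Y) :
  homotopic f f' -> homotopic (scomp g f) (scomp g f').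
Proof.
elim=> {f f'} [f f' [h [hP h0 h1]]|f|f f' _ IH|f1 f2 f3 _ IH1 _ IH2].
- apply: rst_step; exists (fun n x d => g n (h n x d)).
  split=> [m n t x d|n x|n x]; rewrite ?hP ?sfunP //=; congr (g _ _); [exact: h0 | exact: h1].
- exact: rst_refl.
- exact: rst_sym.
- exact: rst_trans IH1 IH2.
Qed.

Lemma homotopic_compr (X Y Z : sset) (g g' : smap Y Z) (f : smap X Y) :
  homotopic g g' -> homotopic (scomp g f) (scomp g' f).
Proof.
elim=> {g g'} [g g' [h [hP h0 h1]]|g|g g' _ IH|g1 g2 g3 _ IH1 _ IH2].
- apply: rst_step; exists (fun n x d => h n (f n x) d).
  by split=> [m n t x d|n x|n x] /=; rewrite ?sfunP ?hP.
- exact: rst_refl.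
- exact: rst_sym.
- exact: rst_trans IH1 IH2.
Qed.

Lemma equivalence_comp (X Y Z : sset) (g : smap Y Z) (f : smap X Y) :
  equivalence g -> equivalence f -> equivalence (scomp g f).
Proof.
case=> g' [g'g gg'] [f' [f'f ff']]; exists (scomp f' g'); split.
- apply: rst_trans f'f; have := homotopic_compr f (homotopic_compl f' g'g).
  by congr homotopic; apply: smap_eq.
- apply: rst_trans gg'; have := homotopic_compr g' (homotopic_compl g ff').
  by congr homotopic; apply: smap_eq.
Qed.

(** * Equality of arrows with varying endpoints *)

Lemma hom_eq_cod (C : category) (a b a' b' : C) (f : hom a b) (g : hom a' b') :
  hom_eq f g -> b = b'.
Proof. by case. Qed.

Lemma hom_eq_refl (C : category) (a b : C) (f g : hom a b) : f = g -> hom_eq f g.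
Proof. by move=> ->; exact: HomEq. Qed.

Lemma hom_eq_comp (C : category) (a b c a' b' c' : C) (g : hom b c) (f : hom a b)
    (g' : hom b' c') (f' : hom a' b') :
  hom_eq g g' -> hom_eq f f' -> hom_eq (comp g f) (comp g' f').
Proof.
move=> eg ef; case: _ _ _ / ef g' eg => g' eg.
have e := hom_eq_cod eg; case: _ / e g' eg => g' /hom_eqP ->; exact: HomEq.
Qed.

Lemma hom_eq_op (C : category) (a b a' b' : C) (f : hom a b) (g : hom a' b') :
  hom_eq f g -> hom_eq (C := op C) (a := b) (b := a) f (g : hom (b' : op C) a').
Proof. by case; exact: HomEq. Qed.

Lemma hom_eq_fmap (C D : category) (F G : functor C D) (a b a' b' : C)
    (f : hom a b) (g : hom a' b') :
  F = G -> hom_eq f g -> hom_eq (fmap F f) (fmap G g).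
Proof. by move=> -> []; exact: HomEq. Qed.

Lemma comma_obj_heq (C D : category) (i : functor C D) (T : D) (x y : comma i T) :
  cdom x = cdom y -> hom_eq (carr x) (carr y) -> x = y.
Proof.
by case: x y => [c f] [c' f'] /= e; case: _ / e f' => f' /hom_eqP ->.
Qed.

Lemma comma_hom_heq2 (C D : category) (i : functor C D) (T : D)
    (x y x' y' : comma i T) (u : hom x y) (u' : hom x' y') :
  x = x' -> y = y' -> hom_eq (chom u) (chom u') -> hom_eq u u'.
Proof.
move=> ex ey; case: _ / ex u' => u'; case: _ / ey u' => u' /hom_eqP e.
by apply/hom_eq_refl/comma_hom_eq.
Qed.

(** * Natural transformations as homotopies of nerves *)

Section Interpolation.
Variables (C D : category) (F0 F1 : functor C D) (al : forall c, hom (F0 c) (F1 c)).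
Hypothesis alP : forall c c' (u : hom c c'), comp (al c') (fmap F0 u) = comp (fmap F1 u) (al c).

(** [branch] and [branch_hom] present [al] as a functor on the product of [C] with the poset 0 < 1,
    Boolean implication being the order. *)
Definition branch (b : bool) : functor C D := if b then F1 else F0.
Definition branch_hom (x y : bool) (xy : x ==> y) c : hom (branch x c) (branch y c) :=
  match x, y return x ==> y -> hom (branch x c) (branch y c) with
  | false, false => fun=> idm _
  | false, true => fun=> al c
  | true, false => fun tf => False_rect _ (notF tf)
  | true, true => fun=> idm _
  end xy.

Lemma branch_homP x y (xy : x ==> y) c c' (u : hom c c') :
  comp (branch_hom xy c') (fmap (branch x) u) = comp (fmap (branch y) u) (branch_hom xy c).
Proof. by case: x y xy => [] [] //= _; rewrite ?comp1m ?compm1. Qed.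

Lemma branch_hom1 x (xx : x ==> x) c : branch_hom xx c = idm _.
Proof. by case: x xx. Qed.

Lemma branch_homM x y z (xy : x ==> y) (yz : y ==> z) (xz : x ==> z) c :
  comp (branch_hom yz c) (branch_hom xy c) = branch_hom xz c.
Proof. by case: x y z xy yz xz => [] [] [] //= _ _ _; rewrite ?comp1m ?compm1. Qed.

Fact bit_le n (d : mono n 1) (a b : 'I_n.+1) : a <= b -> (0 < d a) ==> (0 < d b).
Proof. by move=> ab; apply/implyP => /leq_trans; apply; apply: (monoP d). Qed.

(* The simplex of D whose vertices are those of F0 s where d is 0 and those of
   F1 s where d is 1. *)
Definition interp n (s : functor (ordinal_cat n) C) (d : mono n 1) : functor (ordinal_cat n) D.
Proof.
exists (fun a : ordinal_cat n => branch (0 < d a) (s a))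
  (fun (a b : ordinal_cat n) ab =>
     comp (branch_hom (bit_le d (ab : a <= b)) (s b)) (fmap (branch (0 < d a)) (fmap s ab))).
- by move=> a; rewrite !fmap1 compm1 branch_hom1.
- move=> a b c g f; rewrite !fmapM.
  rewrite -[RHS]compA [X in _ = comp _ X]compA -branch_homP.
  rewrite -[X in _ = comp _ X]compA [RHS]compA.
  by rewrite (branch_homM _ _ (bit_le d (leq_trans (f : a <= b) (g : b <= c)))).
Defined.

Lemma interp_act m n (t : mono m n) (s : functor (ordinal_cat n) C) (d : mono n 1) :
  interp (nerve_act t s) (mcomp d t) = nerve_act t (interp s d).
Proof.
apply: functor_eq => [a|a b f] //=; apply: hom_eq_refl; congr (comp (branch_hom _ _) _).
exact: bool_irrelevance.
Qed.

Lemma interp0 n (s : functor (ordinal_cat n) C) : interp s (mconst n ord0) = compF F0 s.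
Proof.
apply: functor_eq => [a|a b f] //=; apply: hom_eq_refl; exact: comp1m.
Qed.

Lemma interp1 n (s : functor (ordinal_cat n) C) : interp s (mconst n ord_max) = compF F1 s.
Proof.
apply: functor_eq => [a|a b f] //=; apply: hom_eq_refl; exact: comp1m.
Qed.
End Interpolation.

Lemma interp_compF (C D C' D' : category) (F0 F1 : functor C D)
    (al : forall c, hom (F0 c) (F1 c)) alP (F0' F1' : functor C' D')
    (al' : forall c, hom (F0' c) (F1' c)) al'P (K : functor D D') (J : functor C C') :
  compF K F0 = compF F0' J -> compF K F1 = compF F1' J ->
  (forall c, hom_eq (fmap K (al c)) (al' (J c))) ->
  forall n (s : functor (ordinal_cat n) C) d,
    compF K (@interp _ _ F0 F1 al alP n s d) = @interp _ _ F0' F1' al' al'P n (compF J s) d.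
Proof.
move=> E0 E1 Eal n s d.
have E b : compF K (branch F0 F1 b) = compF (branch F0' F1' b) J by case: b.
have Eo b c : K (branch F0 F1 b c) = branch F0' F1' b (J c).
  exact: (congr1 (fun G : functor C D' => fobj G c) (E b)).
have Eid b c : hom_eq (fmap K (idm (branch F0 F1 b c))) (idm (branch F0' F1' b (J c))).
  by rewrite fmap1 Eo; exact: HomEq.
apply: functor_eq => [a|a b f] /=; first exact: Eo.
rewrite fmapM; apply: hom_eq_comp; last exact: hom_eq_fmap (E _) (HomEq _).
move: (bit_le _ _) => le; case: (0 < d a) (0 < d b) le => -[] //= _.
- exact: (Eid true).
- exact: (Eid false).
Qed.

Section Deformation.
Variables (E : category) (X : diag E) (H : functor E E) (al : forall e, hom (H e) e).
Hypothesis alP : forall e e' (u : hom e e'), comp (al e') (fmap H u) = comp u (al e).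

Definition deform0 (e : E) : functor (slice e) (slice e) :=
  compF (comma_post (idF E) (al e)) (slice_map H e).

Fact deform_arrP (e : E) (x : slice e) :
  comp (carr x) (al (cdom x)) = carr (deform0 e x).
Proof. exact/esym/alP. Qed.
Definition deform_arr (e : E) (x : slice e) : hom (deform0 e x) x :=
  @CommaHom _ _ (idF E) e (deform0 e x) x (al (cdom x)) (deform_arrP x).
Fact deform_natural (e : E) (x y : slice e) (u : hom x y) :
  comp (deform_arr y) (fmap (deform0 e) u) = comp (fmap (idF (slice e)) u) (deform_arr x).
Proof. by apply: comma_hom_eq; apply: alP. Qed.

Definition deform (e : E) m (s : nerve (slice e) m) (d : mono m 1) : nerve (slice e) m :=
  @interp _ _ (deform0 e) (idF (slice e)) (@deform_arr e) (@deform_natural e) m s d.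

Lemma deform_act (e : E) l m (t : mono l m) (s : nerve (slice e) m) d :
  deform (act t s) (mcomp d t) = act t (deform s d).
Proof. exact: (@interp_act _ _ _ (idF _) (@deform_arr e) (@deform_natural e) l m t s d). Qed.

Lemma deform_post (e e' : E) (u : hom e e') m (s : nerve (slice e) m) d :
  nerve_map (comma_post (idF E) u) m (deform s d) =
  deform (nerve_map (comma_post (idF E) u) m s) d.
Proof.
have k0 x : cpost_obj (i := idF E) u (deform0 e x) = deform0 e' (cpost_obj (i := idF E) u x).
  by apply: comma_obj_heq => //=; apply: hom_eq_refl; rewrite fmapM !compA alP.
apply: (@interp_compF _ _ _ _ (deform0 e) (idF _) (@deform_arr e) (@deform_natural e)
  (deform0 e') (idF _) (@deform_arr e') (@deform_natural e')).
- apply: functor_eq => [x|x y f]; first exact: k0.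
  by apply: comma_hom_heq2; [exact: k0 | exact: k0 | exact: HomEq].
- by apply: functor_eq.
- by move=> x; apply: comma_hom_heq2; [exact: k0 | | exact: HomEq].
Qed.

(** Precomposition with the prisms [deform] in the slices. It starts at the values of [x] at [H e]
    transported along [al], and ends at [x]. *)
Definition holim_deform n (x : holim X n) (d : mono n 1) : holim X n.
Proof.
exists (fun e m t s => x e m t (deform s (mcomp d t))).
- move=> e l m f t s; rewrite -lfun_act; congr (lfun x _ _).
  exact: (deform_act f s (mcomp d t)).
- move=> e e' u m t s; rewrite -lfun_nat; congr (lfun x _ _).
  exact/esym/deform_post.
Defined.

Lemma holim_deform_act m n (t : mono m n) (x : holim X n) d :
  holim_deform (act t x) (mcomp d t) = act t (holim_deform x d).
Proof. exact: holim_eq. Qed.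

Lemma holim_deform0 n (x : holim X n) e m t s :
  holim_deform x (mconst n ord0) e m t s =
  dact X (al e) m (x (H e) m t (nerve_map (slice_map H e) m s)).
Proof.
rewrite /= -lfun_nat; congr (lfun x _ _).
by rewrite -[mcomp _ _]/(mconst m ord0) /deform interp0; apply: functor_eq.
Qed.

Lemma holim_deform1 n (x : holim X n) : holim_deform x (mconst n ord_max) = x.
Proof.
apply: holim_eq => e m t s /=; congr (lfun x _ _).
by rewrite -[mcomp _ _]/(mconst m ord_max) /deform interp1; apply: functor_eq.
Qed.
End Deformation.

Section DeformationRestrict.
Variables (E E' : category) (H : functor E E) (al : forall e, hom (H e) e).
Variables (H' : functor E' E') (al' : forall e, hom (H' e) e).
Hypothesis alP : forall e e' (u : hom e e'), comp (al e') (fmap H u) = comp u (al e).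
Hypothesis al'P : forall e e' (u : hom e e'), comp (al' e') (fmap H' u) = comp u (al' e).
Variables (M : functor E' E) (X : diag E) (Y : diag E') (be : dmap M X Y).
Hypothesis MH : compF M H' = compF H M.
Hypothesis Mal : forall e, hom_eq (fmap M (al' e)) (al (M e)).

(** Used to see that restricting to an edge of the corolla carries the deformation through images to
    the contraction onto the colours. *)
Lemma holim_deform_map n (x : holim X n) d :
  holim_map be n (holim_deform alP x d) = holim_deform al'P (holim_map be n x) d.
Proof.
apply: holim_eq => e m t s /=; congr (be e m (lfun x _ _)); apply/esym.
have MHo a : M (H' a) = H (M a) := congr1 (fun G : functor E' E => fobj G a) MH.
have key (a : slice e) :
    slice_map_obj M (deform0 al' e a) = deform0 al (M e) (slice_map_obj M a).
  apply: comma_obj_heq => /=; first exact: MHo.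
  rewrite fmapM; apply: hom_eq_comp; first exact: Mal.
  exact: (hom_eq_fmap MH (HomEq _)).
apply: (@interp_compF _ _ _ _ (deform0 al' e) (idF _) (@deform_arr _ _ _ al'P e)
  (@deform_natural _ _ _ al'P e) (deform0 al (M e)) (idF _) (@deform_arr _ _ _ alP (M e))
  (@deform_natural _ _ _ alP (M e))).
- apply: functor_eq => [a|a b f]; first exact: key.
  by apply: comma_hom_heq2; [exact: key | exact: key | exact: (hom_eq_fmap MH (HomEq _))].
- exact: functor_eq.
- by move=> a; apply: comma_hom_heq2 => //; [exact: key | exact: Mal].
Qed.
End DeformationRestrict.

Lemma slice_map_comp (C C' C'' : category) (G : functor C' C'') (L : functor C C') (e : C) m
    (s : nerve (slice e) m) :
  nerve_map (slice_map G (L e)) m (nerve_map (slice_map L e) m s) =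
  nerve_map (slice_map (compF G L) e) m s.
Proof. by apply: functor_eq => [a|a b f] //=; exact: comma_hom_heq. Qed.

(** * Homotopy limits along an adjunction *)

Section Adjunction.
Variables (E E' : category) (G : functor E' E) (L : functor E E').
Variables (al : forall e, hom (G (L e)) e) (be : forall a, hom a (L (G a))).
Hypothesis alP : forall e e' (u : hom e e'),
  comp (al e') (fmap (compF G L) u) = comp u (al e).
Hypothesis beP : forall a a' (u : hom a a'),
  comp (be a') u = comp (fmap (compF L G) u) (be a).
Hypothesis albe : forall a, comp (al (G a)) (fmap G (be a)) = idm (G a).
Variables (X : diag E) (Y : diag E') (th : dmap G X Y).
Variable th' : forall a, smap (Y a) (X (G a)).
Hypothesis thK : forall a n x, th' a n (th a n x) = x.
Hypothesis th'K : forall a n y, th a n (th' a n y) = y.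

Fact th'P (a b : E') (u : hom a b) n y :
  th' b n (dact Y u n y) = dact X (fmap G u) n (th' a n y).
Proof. by rewrite -{1}(th'K y) -dfunP thK. Qed.

Fact extend_dmapP (e e' : E) (u : hom e e') n (y : Y (L e) n) :
  dact X (al e') n (th' (L e') n (dact Y (fmap L u) n y)) =
  dact X u n (dact X (al e) n (th' (L e) n y)).
Proof. by rewrite th'P -!dactM; congr (dact X _ n _); apply: alP. Qed.
Definition extend_dmap : dmap L Y X :=
  @DMap _ _ L Y X (fun e => scomp (dact X (al e)) (th' (L e))) extend_dmapP.

(** The homotopy inverse of restriction: the value at [e] is taken at [L e] and carried back along
    [al]. *)
Definition holim_extend : smap (holim Y) (holim X) := holim_map extend_dmap.
Definition holim_restrict : smap (holim X) (holim Y) := holim_map th.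

Lemma extend_restrict n (x : holim X n) :
  holim_extend n (holim_restrict n x) = holim_deform alP x (mconst n ord0).
Proof.
apply: holim_eq => e m t s; rewrite holim_deform0 /= thK.
congr (dact X (al e) m (lfun x t _)); exact: slice_map_comp.
Qed.

(** [counit0] and [counit1] are two ways from the slice over [a] to that over [L (G a)], joined by
    the natural transformation [be]. *)
Definition counit0 (a : E') : functor (slice a) (slice (L (G a))) := comma_post (idF E') (be a).
Definition counit1 (a : E') : functor (slice a) (slice (L (G a))) := slice_map (compF L G) a.
Fact counit_arrP (a : E') (x : slice a) :
  comp (carr (counit1 a x)) (be (cdom x)) = carr (counit0 a x).
Proof. exact/esym/beP. Qed.
Definition counit_arr (a : E') (x : slice a) : hom (counit0 a x) (counit1 a x) :=
  @CommaHom _ _ (idF E') (L (G a)) (counit0 a x) (counit1 a x) (be (cdom x)) (counit_arrP x).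
Fact counit_natural (a : E') (x y : slice a) (u : hom x y) :
  comp (counit_arr y) (fmap (counit0 a) u) = comp (fmap (counit1 a) u) (counit_arr x).
Proof. by apply: comma_hom_eq; apply: beP. Qed.

Definition counit_simp (a : E') m (s : nerve (slice a) m) (d : mono m 1) :
    nerve (slice (L (G a))) m :=
  @interp _ _ (counit0 a) (counit1 a) (@counit_arr a) (@counit_natural a) m s d.

Lemma counit_act (a : E') l m (t : mono l m) (s : nerve (slice a) m) d :
  counit_simp (act t s) (mcomp d t) = act t (counit_simp s d).
Proof. exact: (@interp_act _ _ _ (counit1 a) (@counit_arr a) (@counit_natural a) l m t s d). Qed.

Lemma counit_post (a a' : E') (u : hom a a') m (s : nerve (slice a) m) d :
  nerve_map (comma_post (idF E') (fmap (compF L G) u)) m (counit_simp s d) =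
  counit_simp (nerve_map (comma_post (idF E') u) m s) d.
Proof.
have k0 x : cpost_obj (i := idF E') (fmap (compF L G) u) (counit0 a x) =
            counit0 a' (cpost_obj (i := idF E') u x).
  by apply: comma_obj_heq => //=; apply: hom_eq_refl; rewrite !compA beP.
have k1 x : cpost_obj (i := idF E') (fmap (compF L G) u) (counit1 a x) =
            counit1 a' (cpost_obj (i := idF E') u x).
  by apply: comma_obj_heq => //=; apply: hom_eq_refl; rewrite !fmapM.
apply: (@interp_compF _ _ _ _ (counit0 a) (counit1 a) (@counit_arr a) (@counit_natural a)
  (counit0 a') (counit1 a') (@counit_arr a') (@counit_natural a')).
- apply: functor_eq => [x|x y f]; first exact: k0.
  by apply: comma_hom_heq2; [exact: k0 | exact: k0 | exact: HomEq].
- apply: functor_eq => [x|x y f]; first exact: k1.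
  by apply: comma_hom_heq2; [exact: k1 | exact: k1 | exact: HomEq].
- by move=> x; apply: comma_hom_heq2; [exact: k0 | exact: k1 | exact: HomEq].
Qed.

(** At the start, the triangle identity [albe] cancels the transport along [be] and leaves [y]; the
    end is extension followed by restriction. *)
Definition holim_counit n (y : holim Y n) (d : mono n 1) : holim Y n.
Proof.
exists (fun a m t s => th a m (dact X (al (G a)) m (th' (L (G a)) m
  (y (L (G a)) m t (counit_simp s (mcomp d t)))))).
- move=> a l m f t s; rewrite -!sfunP; congr (th a l (dact X _ l (th' _ l _))).
  rewrite -lfun_act; congr (lfun y _ _).
  exact: (counit_act f s (mcomp d t)).
- move=> a a' u m t s; rewrite -counit_post lfun_nat -dfunP th'P -!dactM.
  by congr (th a' m (dact X _ m _)); apply: (alP (fmap G u)).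
Defined.

Lemma holim_counit_act m n (t : mono m n) (y : holim Y n) d :
  holim_counit (act t y) (mcomp d t) = act t (holim_counit y d).
Proof. exact: holim_eq. Qed.

Lemma holim_counit0 n (y : holim Y n) : holim_counit y (mconst n ord0) = y.
Proof.
apply: holim_eq => a m t s /=; rewrite -[mcomp _ _]/(mconst m ord0) /counit_simp interp0.
rewrite -[compF _ _]/(nerve_map (comma_post (idF E') (be a)) m s) lfun_nat th'P.
by rewrite -dactM albe dact1 th'K.
Qed.

Lemma holim_counit1 n (y : holim Y n) :
  holim_counit y (mconst n ord_max) = holim_restrict n (holim_extend n y).
Proof.
apply: holim_eq => a m t s /=; rewrite -[mcomp _ _]/(mconst m ord_max) /counit_simp interp1.
congr (th a m (dact X _ m (th' _ m (lfun y t _)))); apply/esym; exact: slice_map_comp.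
Qed.

Definition unit_homotopy : homotopy (scomp holim_extend holim_restrict) (sid (holim X)).
Proof.
exists (@holim_deform E X _ _ alP) => [m n t x d|n x|n x].
- exact: holim_deform_act.
- by rewrite -extend_restrict.
- exact: holim_deform1.
Defined.

Definition counit_homotopy : homotopy (sid (holim Y)) (scomp holim_restrict holim_extend).
Proof.
exists holim_counit => [m n t y d|n y|n y].
- exact: holim_counit_act.
- exact: holim_counit0.
- exact: holim_counit1.
Defined.

Lemma restrict_equivalence : equivalence holim_restrict.
Proof.
exists holim_extend; split; first exact/homotopy_homotopic/unit_homotopy.
exact/rst_sym/homotopy_homotopic/counit_homotopy.
Qed.
End Adjunction.

(** * Deformations of homotopy fibres *)

Section HFibEquivalence.
Variables (J : Type) (A B A' B' : sset).
Variables (v : J -> smap A B) (b : J -> B 0) (v' : J -> smap A' B') (b' : J -> B' 0).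

Definition path_map (c : smap B B') n (p : paths B n) : paths B' n.
Proof. by exists (fun m t e => c m (p m t e)) => *; rewrite pfunP sfunP. Defined.

Section Push.
Variables (R : smap A A') (c : smap B B').
Hypothesis Rv : forall j n a, v' j n (R n a) = c n (v j n a).
Hypothesis cb : forall j, c 0 (b j) = b' j.

Definition hfib_push : smap (hfib v b) (hfib v' b').
Proof.
unshelve eexists (fun n (x : hfib v b n) =>
  @HFibSimp _ _ _ v' b' n (R n (hpt x)) (fun j => path_map c (hpath x j)) _ _).
- by move=> j m t; rewrite /= hpath0 -sfunP -Rv !sfunP.
- by move=> j m t; rewrite /= hpath1 sfunP cb.
- move=> m n t x; apply: hfib_eq => //=; exact: sfunP.
Defined.
End Push.
End HFibEquivalence.

Section HFibDeform.
Variables (J : Type) (A B : sset) (v : J -> smap A B) (b : J -> B 0).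
Variables (hA : forall n, A n -> mono n 1 -> A n) (hB : forall n, B n -> mono n 1 -> B n).
Hypothesis hAP : forall m n (t : mono m n) x d, hA (act t x) (mcomp d t) = act t (hA x d).
Hypothesis hBP : forall m n (t : mono m n) x d, hB (act t x) (mcomp d t) = act t (hB x d).
Hypothesis hv : forall j n a d, v j n (hA a d) = hB (v j n a) d.
Hypothesis hb : forall j n d, hB (act (mconst n ord0) (b j)) d = act (mconst n ord0) (b j).

Definition path_deform n (p : paths B n) (d : mono n 1) : paths B n.
Proof.
exists (fun m t e => hB (p m t e) (mcomp d t)) => l m f t e.
by rewrite pfunP -hBP.
Defined.

Definition hfib_deform n (x : hfib v b n) (d : mono n 1) : hfib v b n.
Proof.
exists (hA (hpt x) d) (fun j => path_deform (hpath x j) d).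
- by move=> j m t; rewrite /= hpath0 hBP hv.
- by move=> j m t; rewrite /= hpath1 hb.
Defined.

Lemma hfib_deform_act m n (t : mono m n) (x : hfib v b n) d :
  hfib_deform (act t x) (mcomp d t) = act t (hfib_deform x d).
Proof. by apply: hfib_eq => //=; apply: hAP. Qed.
End HFibDeform.

Section HFibPushEquivalence.
Variables (J : Type) (A B A' B' : sset).
Variables (v : J -> smap A B) (b : J -> B 0) (v' : J -> smap A' B') (b' : J -> B' 0).
Variables (R : smap A A') (c : smap B B') (S : smap A' A) (u : smap B' B).
Hypothesis Rv : forall j n a, v' j n (R n a) = c n (v j n a).
Hypothesis cb : forall j, c 0 (b j) = b' j.
Hypothesis Sv : forall j n a, v j n (S n a) = u n (v' j n a).
Hypothesis ub : forall j, u 0 (b' j) = b j.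
Variables (hA : homotopy (scomp S R) (sid A)) (hB : homotopy (scomp u c) (sid B)).
Variable hA' : homotopy (sid A') (scomp R S).
Hypothesis cu : forall n x, c n (u n x) = x.
Hypothesis hv : forall j n a d, v j n (hA n a d) = hB n (v j n a) d.
Hypothesis hb : forall j n d, hB n (act (mconst n ord0) (b j)) d = act (mconst n ord0) (b j).
Hypothesis hv' : forall j n a d, v' j n (hA' n a d) = v' j n a.

(** On one side [hA] moves the points and [hB] the paths, whose ends stay fixed by [hb]. On the
    other, [hA'] does not change [v'], so the paths are left alone, and [cu] says that pushing them
    back and forth returns them. *)
Lemma hfib_push_equivalence : equivalence (hfib_push Rv cb).
Proof.
exists (hfib_push Sv ub); split.
  apply: homotopy_homotopic; exists (hfib_deform (hfunP hB) hv hb).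
  - by move=> *; apply: hfib_deform_act; apply: hfunP.
  - move=> n x; apply: hfib_eq => [|j m t e] /=; first exact: (hfun0 hA).
    exact: (hfun0 hB).
  - move=> n x; apply: hfib_eq => [|j m t e] /=; first exact: (hfun1 hA).
    exact: (hfun1 hB).
apply/rst_sym/homotopy_homotopic.
pose id_h n (x : B' n) (d : mono n 1) := x.
have id_hP m n (t : mono m n) x d : id_h m (act t x) (mcomp d t) = act t (id_h n x d) by [].
exists (hfib_deform (hA := hfun hA') (b := b') id_hP hv' (fun j n d => erefl)).
- by move=> *; apply: hfib_deform_act; apply: hfunP.
- by move=> n x; apply: hfib_eq => [|j m t e] //=; exact: (hfun0 hA').
- by move=> n x; apply: hfib_eq => [|j m t e] /=; rewrite ?cu //; exact: (hfun1 hA').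
Qed.
End HFibPushEquivalence.

Section Initial.
Variables (E : category) (X : diag E) (e0 : E) (al : forall e, hom e0 e).
Hypothesis al_uniq : forall e (u v : hom e0 e), u = v.

Fact initialP (e e' : E) (u : hom e e') :
  comp (al e') (fmap (constF E e0) u) = comp u (al e).
Proof. exact: al_uniq. Qed.

Definition holim_eval : smap (holim X) (X e0).
Proof.
exists (fun n (x : holim X n) => x e0 n (mid n) (constF (ordinal_cat n) (slice_id e0))).
move=> m n f x; apply: etrans (lfun_act x f (mid n) _); congr (lfun x _ _).
exact: functor_eq.
Defined.

Fact initial_coneP (e e' : E) (u : hom e e') n (a : X e0 n) :
  dact X u n (dact X (al e) n a) = dact X (al e') n a.
Proof. by rewrite -dactM; congr (dact X _ n a); apply: al_uniq. Qed.
Definition initial_cone : smap (X e0) (holim X) := to_holim initial_coneP.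

Lemma initial_coneK n (a : X e0 n) : holim_eval n (initial_cone n a) = a.
Proof. by rewrite /= act1 (al_uniq (al e0) (idm e0)) dact1. Qed.

(** The arrows out of [e0] form a natural transformation from the constant functor at [e0] to the
    identity, so the deformation above applies. *)
Definition initial_homotopy : homotopy (scomp initial_cone holim_eval) (sid (holim X)).
Proof.
exists (@holim_deform E X (constF E e0) al initialP) => [m n t x d|n x|n x].
- exact: holim_deform_act.
- apply: holim_eq => e m t s; rewrite holim_deform0 /=.
  congr (dact X _ m _); rewrite -[LHS]/(lfun x (mcomp (mid n) t) _) -lfun_act.
  congr (lfun x _ _); apply: functor_eq => [a|a b f] //=.
  exact/hom_eq_refl/comma_hom_eq.
- exact: holim_deform1.
Defined.

Lemma initial_equivalence : equivalence initial_cone.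
Proof.
exists holim_eval; split; last exact/homotopy_homotopic/initial_homotopy.
by rewrite (_ : scomp _ _ = sid _); [exact: rst_refl | apply: smap_eq; exact: initial_coneK].
Qed.
End Initial.

(** * Images of closed trees in a corolla *)

Section Image.
Variables (k : natinf) (k1 : le_inf (Some 1) k) (T : ctree k) (S : finType).
Variable f : tree_hom T (clo (corolla S)).

Definition leaf_image : {set S} := [set s | [exists x, f x == Some s]].

Lemma leaf_imageP s : reflect (exists x, f x = Some s) (s \in leaf_image).
Proof.
by rewrite inE; apply: (iffP existsP) => -[x /eqP]; exists x => //; apply/eqP.
Qed.

Lemma image_root s x : f (root T) = Some s -> f x = Some s.
Proof.
by move=> fr; have := tree_hom_le f (rootP x); rewrite fr corolla_leE => /eqP <-.
Qed.

(** If the root goes to a leaf, only that leaf is hit. Otherwise take an edge [e] over the root of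
    the corolla with as many edges below it as possible. An edge over a leaf is comparable to [e],
    as independence is preserved, hence lies above [e]; by the choice of [e] the input of [e] below
    it goes to the same leaf. So the leaves hit are images of inputs of [e]. *)
Lemma leaf_image_small : le_inf (Some #|leaf_image|) k.
Proof.
case fr : (f (root T)) => [s|].
  apply: le_inf_trans k1 => /=; rewrite -(cards1 s); apply: subset_leq_card.
  by apply/subsetP => t /leaf_imageP[x]; rewrite (image_root _ fr) inE => -[->].
pose P x := f x == None; have Pr : P (root T) by rewrite /P fr.
have [e /eqP fe emax] := arg_maxnP (fun x : T => #|[set z | (z <= x)%O]|) Pr.
apply: le_inf_trans (ctree_dend T e) => /=.
apply: leq_trans (leq_imset_card f (inputs e)).
have inj : injective (@Some S) by move=> y z [].
rewrite -(card_imset _ inj); apply: subset_leq_card.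
apply/subsetP => _ /imsetP[s /leaf_imageP[x fx] ->].
have ex : (e < x)%O.
  rewrite lt_neqAle; apply/andP; split.
    by apply/negP => /eqP ex; move: fx; rewrite -ex fe.
  have : (e >=< x)%O.
    apply: contraT => /(tree_hom_independent f).
    by rewrite fe /Order.comparable corolla_leE.
  case/orP=> // /(tree_hom_le f); rewrite fe fx corolla_leE.
  by [].
have [d de dx] := input_below ex.
apply/imsetP; exists d => //; move: de; rewrite inE => /andP[ed _].
have := tree_hom_le f dx; rewrite fx corolla_leE => /orP[Pd|/eqP //].
have := emax d Pd; apply: contraTeq => _; rewrite -ltnNge; apply: proper_card.
apply/properP; split; first by apply/subsetP => z; rewrite !inE => /le_trans; apply; apply: ltW.
by exists d; rewrite !inE ?lexx // lt_geF.
Qed.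
End Image.

(** * The adjunction between trees over the corolla and its subtrees *)

Section Subtrees.
Variables (k : natinf) (k1 : le_inf (Some 1) k) (S : finType).

(* The closed subcorollas C_I with |I| <= k and, separately, the edges of the
   closed S-corolla; the edge r lies below C_0 although both are the tree r. *)
Definition subtree : Type := small_set k S + corolla_edge S.

Definition sub_mem (a : subtree) (x : corolla_edge S) : bool :=
  match a with
  | inl M => if x is Some s then s \in (M : {set S}) else true
  | inr e => x == e
  end.

Definition sub_le (a b : subtree) : bool :=
  match a, b with
  | inl M, inl N => (M : {set S}) \subset N
  | inr e, inl _ => sub_mem b e
  | inr e, inr e' => e == e'
  | inl _, inr _ => false
  end.

Fact sub_le_refl : reflexive sub_le.
Proof. by case=> [I|e] /=. Qed.
Lemma sub_le_mem a b x : sub_le a b -> sub_mem a x -> sub_mem b x.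
Proof.
case: a b => [A|e] [B|e'] //=.
- by case: x => // s /subsetP; apply.
- by move=> eB /eqP ->.
- by move=> /eqP ->.
Qed.
Fact sub_le_trans : transitive sub_le.
Proof.
move=> [I|e] [J|e'] [K|e''] //=.
- by move=> JI IK; apply: subset_trans IK.
- by case: e' => // s sI /subsetP; apply.
- by move=> /eqP ->.
- by move=> /eqP -> /eqP ->.
Qed.

Definition subtree_cat : category := poset_cat sub_le_refl sub_le_trans.

Definition edge_set (e : corolla_edge S) : {set S} := if e is Some s then [set s] else set0.
Fact edge_set_small (e : corolla_edge S) : le_inf (Some #|edge_set e|) k.
Proof. by rewrite /edge_set; case: e => [s|]; rewrite ?cards1 ?cards0 ?le_inf0. Qed.
(** The smallest subcorolla containing [e]; it is admissible for a leaf because [1 <= k]. *)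
Definition base_set (e : corolla_edge S) : small_set k S := SmallSet (edge_set_small e).

Definition sub_hull (a : subtree) : small_set k S :=
  match a with inl M => M | inr e => base_set e end.
Fact sub_hull_le (a b : subtree) : sub_le a b -> sub_hull a \subset (sub_hull b : {set S}).
Proof.
case: a b => [I|e] [J|e'] //=; last by move=> /eqP ->.
by case: e => [s|] // sJ; rewrite ?sub1set ?sub0set.
Qed.
Lemma sub_le_hull a : sub_le a (inl (sub_hull a)).
Proof. by case: a => [I|[s|]] //=; rewrite inE. Qed.

Definition hull : functor subtree_cat (powerset_le k S).
Proof.
by apply: (@Functor subtree_cat (powerset_le k S) sub_hull sub_hull_le) => *;
  apply: bool_irrelevance.
Defined.

Definition subcorolla : functor (powerset_le k S) subtree_cat.
Proof.
by apply: (@Functor (powerset_le k S) subtree_cat inl (fun I J IJ => IJ)) => *;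
  apply: bool_irrelevance.
Defined.

Variables (j : natinf) (kj : le_inf k j) (Sj : le_inf (Some #|S|) j).
Let CS : Omegac j := ccorolla Sj.

Lemma cC0_eq (x y : ctree_tree (cC0 k)) : x = y.
Proof. by case: x => [[]//|]; case: y => [[]//|]. Qed.

Definition cC0_id : comma (incl kj) (cC0 j) :=
  @CommaObj (Omegac k) (Omegac j) (incl kj) (cC0 j) (cC0 k) (tree_id (cC0 j)).

(** An edge is entered as a composite with [cC0_id], so that evaluation at it matches restriction
    along [edge_map] by conversion. *)
Definition sub_obj (a : subtree) : comma (incl kj) CS :=
  match a with
  | inl M => sub_comma_obj kj Sj M
  | inr e => cpost_obj (@edge_map j CS e) cC0_id
  end.

Lemma sub_obj_le a (x y : ctree_tree (cdom (sub_obj a))) :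
  (x <= y)%O = (carr (sub_obj a) x <= carr (sub_obj a) y)%O.
Proof.
case: a x y => [I|e] x y; last by rewrite (cC0_eq x y) !lexx.
by case: x => [x|]; case: y => [y|]; rewrite !corolla_leE //= -!(inj_eq val_inj).
Qed.

Lemma sub_obj_mem a (x : ctree_tree (cdom (sub_obj a))) : sub_mem a (carr (sub_obj a) x).
Proof. by case: a x => [I|e] //= [[s sI]|]. Qed.

Lemma sub_obj_inj a : injective (carr (sub_obj a)).
Proof. by move=> x y xy; apply/le_anti; rewrite !sub_obj_le xy lexx. Qed.

(** Subtrees are monomorphisms: their structure maps are injective on edges. *)
Lemma sub_obj_uniq (x : comma (incl kj) CS) a (u v : hom x (sub_obj a)) : u = v.
Proof.
apply/comma_hom_eq/tree_hom_eq => e; apply: (@sub_obj_inj a).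
have eu := congr1 (fun h : tree_hom _ _ => h e) (chomP u).
have ev := congr1 (fun h : tree_hom _ _ => h e) (chomP v).
exact: etrans eu (esym ev).
Qed.

(** For a single edge [None] is the only possible value; for a subcorolla it is also the junk value
    at leaves outside it. *)
Definition sub_lift_fun (a : subtree) (x : corolla_edge S) : ctree_tree (cdom (sub_obj a)) :=
  match a return ctree_tree (cdom (sub_obj a)) with
  | inl M => if x is Some s then (if insub s is Some u then Some u else None) else None
  | inr e => None
  end.

Lemma sub_lift_funK a x : sub_mem a x -> carr (sub_obj a) (sub_lift_fun a x) = x.
Proof.
case: a => [I|e] /=; last by move/eqP.
by case: x => [s|] //= sI; rewrite insubT.
Qed.

Section Lift.
Variables (x : comma (incl kj) CS) (a : subtree).
Hypothesis xa : forall e, sub_mem a (carr x e).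

Fact sub_liftP s (c : ctree_tree (cdom x)) : free_op s c ->
  free_op (map (fun e => sub_lift_fun a (carr x e)) s) (sub_lift_fun a (carr x c)).
Proof.
apply: (@independent_hom (cdom x) (cdom (sub_obj a)) (fun e => sub_lift_fun a (carr x e))) => //.
- exact: ctree_closed.
- by move=> y z yz; rewrite sub_obj_le !sub_lift_funK //; apply: (tree_hom_le (carr x)).
- move=> y z yz; rewrite /Order.comparable !sub_obj_le !sub_lift_funK //.
  exact: (tree_hom_independent (carr x)).
Qed.

Definition sub_lift : hom x (sub_obj a).
Proof.
by apply: (@CommaHom _ _ (incl kj) CS x (sub_obj a) (TreeHom sub_liftP));
  apply: tree_hom_eq => e; apply: sub_lift_funK.
Defined.
End Lift.

(** When only the root of the corolla is hit, the edge [None] is chosen, as it lies below the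
    subcorolla with the same edges. *)
Definition sub_image (x : comma (incl kj) CS) : subtree :=
  if carr x (root (ctree_tree (cdom x))) is Some s then inr (Some s)
  else if leaf_image (T := cdom x) (carr x) == set0 then inr None
  else inl (SmallSet (leaf_image_small k1 (T := cdom x) (carr x))).

(** The universal property making [sub_image] left adjoint to the inclusion of subtrees. *)
Lemma sub_image_le (x : comma (incl kj) CS) b :
  reflect (forall e, sub_mem b (carr x e)) (sub_le (sub_image x) b).
Proof.
rewrite /sub_image; case fr : (carr x (root (ctree_tree (cdom x)))) => [s|].
  apply: (iffP idP) => [sb e|H].
    by rewrite (image_root (T := cdom x) _ fr); case: b sb.
  by have := H (root (ctree_tree (cdom x))); rewrite fr; case: b {H}.
case: eqP => [I0|I0].
  have fN e : carr x e = None.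
    case fe : (carr x e) => [s|//].
    have : s \in leaf_image (T := cdom x) (carr x) by apply/leaf_imageP; exists e.
    by rewrite I0 in_set0.
  apply: (iffP idP) => [sb e|H]; first by rewrite fN; case: b sb.
  by have := H (root (ctree_tree (cdom x))); rewrite fr; case: b {H}.
apply: (iffP idP) => [sb e|H].
  case fe : (carr x e) => [s|]; last by case: b sb.
  by case: b sb => //= J /subsetP; apply; apply/leaf_imageP; exists e.
case: b H => [J|e] H /=.
  by apply/subsetP => s /leaf_imageP[e fe]; have := H e; rewrite fe.
(* A single edge cannot contain the image here: the root of the corolla is hit, and so is a leaf. *)
case: I0; apply/setP => s; rewrite [RHS]inE; apply/negP => /leaf_imageP[y fy].
by have := H y; have := H (root (ctree_tree (cdom x))); rewrite /= fr fy => /eqP <-.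
Qed.

Lemma sub_image_mem (x : comma (incl kj) CS) e : sub_mem (sub_image x) (carr x e).
Proof. by move: e; apply/sub_image_le; apply: sub_le_refl. Qed.

Definition subtreeF : functor (subtree_cat) (comma (incl kj) CS).
Proof.
by apply: (@Functor subtree_cat (comma (incl kj) CS) sub_obj
  (fun a b ab => sub_lift (fun e => sub_le_mem ab (sub_obj_mem e)))) => *;
  apply: sub_obj_uniq.
Defined.

Fact sub_image_hom (x y : comma (incl kj) CS) (u : hom x y) :
  sub_le (sub_image x) (sub_image y).
Proof.
apply/sub_image_le => e.
rewrite -(congr1 (fun h : tree_hom _ _ => h e) (chomP u)); exact: sub_image_mem.
Qed.

Definition imageF : functor (comma (incl kj) CS) subtree_cat.
Proof.
by apply: (@Functor (comma (incl kj) CS) subtree_cat sub_image sub_image_hom) => *;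
  apply: bool_irrelevance.
Defined.

Lemma sub_image_obj_le a : sub_le (sub_image (sub_obj a)) a.
Proof. apply/sub_image_le => e; exact: sub_obj_mem. Qed.

Section AdjunctionData.
Variable F : psh (Omegac k).
Let E := op (comma (incl kj) CS).
Let X : diag E := ran_diag (incl kj) F CS.

Definition image_unit (x : E) : hom (opF subtreeF (opF imageF x)) x :=
  sub_lift (x := x) (@sub_image_mem x).
Definition image_counit (a : op subtree_cat) : hom a (opF imageF (opF subtreeF a)) :=
  sub_image_obj_le a.

Fact image_unitP (x y : E) (u : hom x y) :
  comp (image_unit y) (fmap (compF (opF subtreeF) (opF imageF)) u) = comp u (image_unit x).
Proof. exact: sub_obj_uniq. Qed.
Fact image_counitP (a b : op subtree_cat) (u : hom a b) :
  comp (image_counit b) u = comp (fmap (compF (opF imageF) (opF subtreeF)) u) (image_counit a).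
Proof. exact: bool_irrelevance. Qed.
Fact image_unit_counit (a : op subtree_cat) :
  comp (image_unit (opF subtreeF a)) (fmap (opF subtreeF) (image_counit a)) =
  idm (opF subtreeF a).
Proof. exact: sub_obj_uniq. Qed.

Fact corolla_image_mem (x : E) e : sub_mem (inl (sub_hull (sub_image x))) (carr x e).
Proof. exact: (sub_le_mem (sub_le_hull (sub_image x)) (sub_image_mem e)). Qed.
Definition corolla_imageF : functor E (op (powerset_le k S)) := opF (compF hull imageF).
Definition corolla_unit (x : E) : hom (opF (sub_comma kj Sj) (corolla_imageF x)) x :=
  sub_lift (x := x) (@corolla_image_mem x).
Definition corolla_counit (A : op (powerset_le k S)) :
    hom A (corolla_imageF (opF (sub_comma kj Sj) A)) :=
  sub_hull_le (sub_image_obj_le (inl A)).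

Fact corolla_unitP (x y : E) (u : hom x y) :
  comp (corolla_unit y) (fmap (compF (opF (sub_comma kj Sj)) corolla_imageF) u) =
  comp u (corolla_unit x).
Proof. exact: (sub_obj_uniq (a := inl _)). Qed.
Fact corolla_counitP (A B : op (powerset_le k S)) (u : hom A B) :
  comp (corolla_counit B) u =
  comp (fmap (compF corolla_imageF (opF (sub_comma kj Sj))) u) (corolla_counit A).
Proof. exact: bool_irrelevance. Qed.
Fact corolla_unit_counit (A : op (powerset_le k S)) :
  comp (corolla_unit (opF (sub_comma kj Sj) A))
    (fmap (opF (sub_comma kj Sj)) (corolla_counit A)) = idm (opF (sub_comma kj Sj) A).
Proof. exact: (sub_obj_uniq (a := inl A)). Qed.

(** The hull of the image is left adjoint to the inclusion of subcorollas; both diagrams have the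
    same values there, so identities serve as [th']. *)
Lemma comparison_equivalence : equivalence (comparison kj F Sj).
Proof.
exact: (restrict_equivalence corolla_unitP corolla_counitP corolla_unit_counit
  (th := sub_dmap kj F Sj) (th' := fun A => sid (F (sub_corolla A)))
  (fun _ _ _ => erefl) (fun _ _ _ => erefl)).
Qed.
End AdjunctionData.
End Subtrees.

(** * Multimorphisms of the Kan extension *)

Section Thin.
Variable C : category.
Hypothesis thin : forall (a b : C) (u v : hom a b), u = v.

Lemma thin_heq (a b a' b' : C) (u : hom a b) (u' : hom a' b') :
  a = a' -> b = b' -> hom_eq u u'.
Proof.
move=> ea eb; case: _ / ea u' => u'; case: _ / eb u' => u'.
exact/hom_eq_refl/thin.
Qed.

(** Without parallel arrows, a simplex in the nerve of a slice is determined by the sources of its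
    vertices. *)
Lemma thin_slice_eq (c : C) n (s s' : nerve (slice c) n) :
  (forall a, cdom (fobj s a) = cdom (fobj s' a)) -> s = s'.
Proof.
move=> e; have eo a : fobj s a = fobj s' a.
  by apply: comma_obj_heq; [exact: e | apply: thin_heq; [exact: e |]].
apply: functor_eq => // a b f.
by apply: comma_hom_heq2; [exact: eo | exact: eo | apply: thin_heq; exact: e].
Qed.
End Thin.

(** * Colours of the Kan extension *)

Section Colours.
Variables (k j : natinf) (kj : le_inf k j) (F : psh (Omegac k)).
Let E := op (comma (incl kj) (cC0 j)).

Fact cC0_terminalP (x : comma (incl kj) (cC0 j)) :
  comp (carr (cC0_id kj)) (fmap (incl kj) (carr x : hom (cdom x) (cC0 k))) = carr x.
Proof. exact: tree_hom_eq. Qed.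
(** The structure map of [x] is itself the arrow to [cC0_id]: the two closed 0-corollas have the
    same underlying tree. *)
Definition cC0_terminal (x : E) : hom (cC0_id kj : E) x :=
  @CommaHom _ _ (incl kj) (cC0 j) x (cC0_id kj) (carr x : hom (cdom x) (cC0 k)) (cC0_terminalP x).
Fact cC0_terminal_uniq (x : E) (u v : hom (cC0_id kj : E) x) : u = v.
Proof. by apply/comma_hom_eq/tree_hom_eq => e; apply: cC0_eq. Qed.

Definition colour_cone : smap (colours F) (colours (Rk kj F)) :=
  initial_cone (ran_diag (incl kj) F (cC0 j)) cC0_terminal cC0_terminal_uniq.

Lemma Rk_coloursE n x : Rk_colours kj F n x = colour_cone n x.
Proof.
apply: holim_eq => e m t s /=; rewrite /res.
by congr (dact F _ m _); apply: tree_hom_eq.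
Qed.

Lemma Rk_colours_equivalence : equivalence (Rk_colours kj F).
Proof.
have -> : Rk_colours kj F = colour_cone by apply: smap_eq => n x; apply: Rk_coloursE.
exact: (initial_equivalence (ran_diag (incl kj) F (cC0 j)) cC0_terminal cC0_terminal_uniq).
Qed.
End Colours.

(** * Passing to homotopy fibres over the diagram of subtrees *)

Section MulSubtree.
Variables (k : natinf) (k1 : le_inf (Some 1) k) (j : natinf) (kj : le_inf k j).
Variables (F : psh (Omegac k)) (S : finType) (Sj : le_inf (Some #|S|) j).
Variables (X : S -> colour F) (Y : colour F).
Let CS : Omegac j := ccorolla Sj.
Let E := op (comma (incl kj) CS).
Let Q := op (subtree_cat k S).

Definition subtree_diag : diag Q := dcomp (ran_diag (incl kj) F CS) (opF (subtreeF kj Sj)).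

Fact subtree_dmapP (a b : Q) (u : hom a b) n (x : F (cdom (sub_obj kj Sj a)) n) :
  sid _ n (dact (ran_diag (incl kj) F CS) (fmap (opF (subtreeF kj Sj)) u) n x) =
  dact subtree_diag u n (sid _ n x).
Proof. by []. Qed.
Definition subtree_dmap : dmap (opF (subtreeF kj Sj)) (ran_diag (incl kj) F CS) subtree_diag :=
  @DMap _ _ (opF (subtreeF kj Sj)) (ran_diag (incl kj) F CS) subtree_diag
    (fun a => sid (F (cdom (sub_obj kj Sj a)))) subtree_dmapP.

Definition edge_eval (e : corolla_edge S) : smap (holim subtree_diag) (colours F) :=
  holim_eval subtree_diag (inr e : Q).

Definition Mul_subtree : sset := hfib edge_eval (edge_colour X Y).

Lemma subtree_thin (a b : Q) (u v : hom a b) : u = v.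
Proof. exact: bool_irrelevance. Qed.

(** A simplex with all vertices at [e] is the degenerate one used by [edge_eval], and all maps into
    the closed 0-corolla agree. *)
Lemma edge_eval_res (e : corolla_edge S) (a : Q) (T : ctree k)
    (h : tree_hom T (cdom (sub_obj kj Sj a))) (g : tree_hom T (cC0 k))
    n (y : holim subtree_diag n) m (t : mono m n) (s : nerve (slice a) m) :
  a = inr e -> (forall i, cdom (fobj s i) = inr e) ->
  res F (h : hom (T : Omegac k) _) m (y a m t s) =
  res F (g : hom (T : Omegac k) (cC0 k)) m (act t (edge_eval e n y)).
Proof.
move=> ae; subst a => se.
rewrite -[act t _](lfun_act y t (mid n) _).
have -> : s = act t (constF (ordinal_cat n) (slice_id (inr e : Q)) : nerve (slice (inr e : Q)) n).
  exact: (thin_slice_eq subtree_thin).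
congr (dact F _ m _); apply: tree_hom_eq => x; exact: cC0_eq.
Qed.

Lemma sub_image_edge (e : corolla_edge S) (x : comma (incl kj) (cC0 j)) :
  sub_image k1 (cpost_obj (i := incl kj) (@edge_map j CS e) x) = inr e.
Proof.
case: e => [s|] //; rewrite /sub_image /= ifT //.
apply/eqP/setP => s; rewrite in_set0; apply/negP => /leaf_imageP[y] //.
Qed.

Lemma sub_obj_heq (x y x' y' : comma (incl kj) CS) (u : hom x y) (u' : hom x' y') a :
  x = x' -> y = y' -> y = sub_obj kj Sj a -> hom_eq u u'.
Proof.
move=> ex ey; subst x' y' => ea; subst y.
exact/hom_eq_refl/sub_obj_uniq.
Qed.

Let X_id (a : Q) : smap (subtree_diag a) (ran_diag (incl kj) F CS (opF (subtreeF kj Sj) a)) :=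
  sid _.
Let XK a n (x : ran_diag (incl kj) F CS (opF (subtreeF kj Sj) a) n) :
  X_id a n (subtree_dmap a n x) = x.
Proof. by []. Qed.
Let X'K a n (y : subtree_diag a n) : subtree_dmap a n (X_id a n y) = y.
Proof. by []. Qed.

Definition subtree_restrict : smap (Rk kj F CS) (holim subtree_diag) := holim_restrict subtree_dmap.
Definition subtree_extend : smap (holim subtree_diag) (Rk kj F CS) :=
  holim_extend (@image_unitP k k1 S j kj Sj) XK X'K.

Let hA : homotopy (scomp subtree_extend subtree_restrict) (sid _) :=
  unit_homotopy (@image_unitP k k1 S j kj Sj) XK X'K.
Let hA' : homotopy (sid _) (scomp subtree_restrict subtree_extend) :=
  counit_homotopy (@image_unitP k k1 S j kj Sj) (@image_counitP k k1 S j kj Sj)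
    (@image_unit_counit k k1 S j kj Sj) XK X'K.
Let col_eval : smap (colours (Rk kj F)) (colours F) :=
  holim_eval (ran_diag (incl kj) F (cC0 j)) (cC0_id kj : op (comma (incl kj) (cC0 j))).
Let hB : homotopy (scomp (colour_cone kj F) col_eval) (sid _) :=
  initial_homotopy (ran_diag (incl kj) F (cC0 j)) (@cC0_terminal k j kj)
    (@cC0_terminal_uniq k j kj).

Let Rk_edge_colour : corolla_edge S -> colour (Rk kj F) :=
  edge_colour (fun s => Rk_colours kj F 0 (X s)) (Rk_colours kj F 0 Y).

Let Rk_edge_colourE e : colour_cone kj F 0 (edge_colour X Y e) = Rk_edge_colour e.
Proof. by case: e => [s|]; apply/esym/Rk_coloursE. Qed.

Let Rv e n (x : Rk kj F CS n) :
  edge_eval e n (subtree_restrict n x) = col_eval n (edge_res (Rk kj F) Sj e n x).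
Proof.
apply: (congr1 (x (sub_obj kj Sj (inr e)) n (mid n))).
pose uniq := @sub_obj_uniq k S j kj Sj _ (inr e).
have eo : slice_map_obj (opF (subtreeF kj Sj)) (slice_id (inr e : Q)) =
    slice_map_obj (opF (comma_post (incl kj) (@edge_map j CS e)))
      (slice_id (cC0_id kj : op (comma (incl kj) (cC0 j)))).
  by apply: comma_obj_heq => //=; apply/hom_eq_refl/uniq.
apply: functor_eq => [a|a b f]; first exact: eo.
apply: comma_hom_heq2; [exact: eo | exact: eo | exact/hom_eq_refl/uniq].
Qed.

Let colK n (a : colours F n) : col_eval n (colour_cone kj F n a) = a.
Proof.
exact: (initial_coneK (X := ran_diag (incl kj) F (cC0 j)) (@cC0_terminal k j kj)
  (@cC0_terminal_uniq k j kj)).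
Qed.

Let cb e : col_eval 0 (Rk_edge_colour e) = edge_colour X Y e.
Proof. by rewrite -Rk_edge_colourE colK. Qed.

Let Sv e n (y : holim subtree_diag n) :
  edge_res (Rk kj F) Sj e n (subtree_extend n y) = colour_cone kj F n (edge_eval e n y).
Proof.
apply: holim_eq => x m t s; apply: edge_eval_res; first exact: sub_image_edge.
move=> i; exact: sub_image_edge.
Qed.

(** Every object over the edge [e] has image [e], so composing with [edge_map] turns the image
    functor into the constant functor at the terminal object. *)
Let hv e n (x : Rk kj F CS n) d :
  edge_res (Rk kj F) Sj e n (hA n x d) = hB n (edge_res (Rk kj F) Sj e n x) d.
Proof.
apply: holim_deform_map.
  have eo a : sub_obj kj Sj (inr e) = sub_obj kj Sj (sub_image k1
      (cpost_obj (i := incl kj) (@edge_map j CS e) a)).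
    by rewrite sub_image_edge.
  apply: functor_eq => [a|a b f]; first exact: (eo a).
  apply: hom_eq_op; exact: (@sub_obj_heq _ _ _ _ _ _ (inr e) (eo _) (eo _) erefl).
move=> a; apply: hom_eq_op; apply: (@sub_obj_heq _ _ _ _ _ _ (inr e)) => //=.
by rewrite sub_image_edge.
Qed.

(** A point coming from a cone does not depend on the simplex of the slice, hence is fixed by the
    deformation. *)
Let hb e n d : hB n (act (mconst n ord0) (Rk_edge_colour e)) d =
  act (mconst n ord0) (Rk_edge_colour e).
Proof. by rewrite -Rk_edge_colourE; apply: holim_eq. Qed.

Let sub_image_obj e : sub_image k1 (sub_obj kj Sj (inr e)) = inr e.
Proof. exact: sub_image_edge. Qed.

(** An edge is its own image, so both ends of the interpolated simplex stay at [e] throughout. *)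
Let hv' e n (y : holim subtree_diag n) d : edge_eval e n (hA' n y d) = edge_eval e n y.
Proof.
pose h := chom (image_unit k1 (Sj := Sj) (kj := kj) (sub_obj kj Sj (inr e))).
rewrite -[RHS]act1 -[RHS](dact1 (d := F)).
apply: (edge_eval_res h (tree_id (cC0 k)) y (mid n)); first exact: sub_image_obj.
move=> i /=; case: (0 < _) => //; exact: sub_image_obj.
Qed.

Definition Mul_to_subtree : smap (Mul (F := Rk kj F) Sj (fun s => Rk_colours kj F 0 (X s))
    (Rk_colours kj F 0 Y)) Mul_subtree :=
  hfib_push Rv cb.

Lemma Mul_to_subtree_equivalence : equivalence Mul_to_subtree.
Proof.
exact: (hfib_push_equivalence Rv cb Sv Rk_edge_colourE (hA := hA) (hB := hB) (hA' := hA')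
  colK hv hb hv').
Qed.
End MulSubtree.

(** * Lattice operations on the 1-simplex *)

Section MonoLattice.
Variable n : nat.
Fact mono_min_le (d e : mono n 1) (a b : 'I_n.+1) : a <= b ->
  (if d a <= e a then d a else e a) <= (if d b <= e b then d b else e b).
Proof.
move=> ab; have hd := monoP d ab; have he := monoP e ab.
by case: (leqP (d a) (e a)) => ?; case: (leqP (d b) (e b)) => ?; lia.
Qed.
Definition mono_min (d e : mono n 1) : mono n 1 := Mono (@mono_min_le d e).
Fact mono_max_le (d e : mono n 1) (a b : 'I_n.+1) : a <= b ->
  (if d a <= e a then e a else d a) <= (if d b <= e b then e b else d b).
Proof.
move=> ab; have hd := monoP d ab; have he := monoP e ab.
by case: (leqP (d a) (e a)) => ?; case: (leqP (d b) (e b)) => ?; lia.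
Qed.
Definition mono_max (d e : mono n 1) : mono n 1 := Mono (@mono_max_le d e).

Lemma mono_min0l e : mono_min (mconst n ord0) e = mconst n ord0.
Proof. exact: mono_eq. Qed.
Lemma mono_min0r e : mono_min e (mconst n ord0) = mconst n ord0.
Proof.
apply: mono_eq => a /=; case: leqP => // le; apply: val_inj => /=; apply/eqP.
by rewrite -leqn0.
Qed.
Lemma mono_min1r e : mono_min e (mconst n ord_max) = e.
Proof. by apply: mono_eq => a /=; rewrite leq_ord. Qed.
Lemma mono_max0l e : mono_max (mconst n ord0) e = e.
Proof. exact: mono_eq. Qed.
Lemma mono_max0r e : mono_max e (mconst n ord0) = e.
Proof.
apply: mono_eq => a /=; case: leqP => // le; apply: val_inj => /=; apply/esym/eqP.
by rewrite -leqn0.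
Qed.
Lemma mono_max1l e : mono_max (mconst n ord_max) e = mconst n ord_max.
Proof.
apply: mono_eq => a /=; case: leqP => // le; apply: val_inj; apply/eqP.
by rewrite eqn_leq le leq_ord.
Qed.
Lemma mono_max1r e : mono_max e (mconst n ord_max) = mconst n ord_max.
Proof. by apply: mono_eq => a /=; rewrite leq_ord. Qed.
End MonoLattice.

Section Product.
Variables X Y : sset.
Definition sprod : sset.
Proof.
exists (fun n => (X n * Y n)%type) (fun m n t x => (act t x.1, act t x.2)).
- by move=> n [x y]; rewrite !act1.
- by move=> m n p g f [x y]; rewrite !actM.
Defined.
End Product.

(** * The cylinder model of multimorphisms *)

Section MulCylinder.
Variables (k : natinf) (k1 : le_inf (Some 1) k) (F : psh (Omegac k)) (S : finType).
Variables (X : S -> colour F) (Y : colour F).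
Let P := op (powerset_le k S).
Let B : diag P := sub_diag F S.

Definition base_edge (e : corolla_edge S) :
    corolla_edge {s | s \in (base_set k1 e : small_set k S)} :=
  match e return corolla_edge {s | s \in (base_set k1 e : small_set k S)} with
  | Some s => Some (exist _ s (set11 s))
  | None => None
  end.

Definition base_res (e : corolla_edge S) : smap (B (base_set k1 e)) (colours F) :=
  edge_res F (small_set_le (base_set k1 e)) (base_edge e).

Record cyl_simp (n : nat) := CylSimp {
  cyl_pt : holim B n;
  cyl_map : forall e m, mono m n -> nerve (slice (base_set k1 e : P)) m -> mono m 1 ->
    colours F m;
  cyl_path : corolla_edge S -> paths (colours F) n;
  cyl_act : forall e l m (f : mono l m) t s d,
    @cyl_map e l (mcomp t f) (act f s) (mcomp d f) = act f (@cyl_map e m t s d);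
  cyl_map0 : forall e m t s,
    @cyl_map e m t s (mconst m ord0) = base_res e m (cyl_pt (base_set k1 e) m t s);
  cyl_map1 : forall e m t s,
    @cyl_map e m t s (mconst m ord_max) = cyl_path e m t (mconst m ord0);
  cyl_path1 : forall e m t,
    cyl_path e m t (mconst m ord_max) = act (mconst m ord0) (edge_colour X Y e) }.

Lemma cyl_eq n (x y : cyl_simp n) : cyl_pt x = cyl_pt y ->
  (forall e m t s d, @cyl_map _ x e m t s d = @cyl_map _ y e m t s d) ->
  (forall e m t d, cyl_path x e m t d = cyl_path y e m t d) -> x = y.
Proof.
case: x y => [p f q a f0 f1 q1] [p' f' q' a' f0' f1' q1'] /= ep ef eq.
have {}ef : f = f'.
  apply: functional_extensionality_dep => e; apply: functional_extensionality_dep => m.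
  by apply/funext => t; apply/funext => s; apply/funext => d.
have {}eq : q = q' by apply/funext => e; apply: path_eq.
subst p' f' q'; congr CylSimp; exact: Prop_irrelevance.
Qed.

Definition cyl_simp_act m n (f : mono m n) (x : cyl_simp n) : cyl_simp m.
Proof.
exists (act f (cyl_pt x)) (fun e l t s d => @cyl_map _ x e l (mcomp f t) s d)
  (fun e => act f (cyl_path x e)).
- by move=> e l p g t s d; rewrite -cyl_act.
- by move=> e l t s; rewrite cyl_map0.
- by move=> e l t s; rewrite cyl_map1.
- by move=> e l t; rewrite /= cyl_path1.
Defined.

(* A point of holim B together with, for each edge e of the S-corolla, a homotopy
   from its restrictions to e, parametrised by the subcorollas containing e, to
   a point, and a path from that point to the colour of e. *)
Definition Mul_cylinder : sset.
Proof.
exists cyl_simp cyl_simp_act => [n x|m n p g f x]; apply: cyl_eq => //=.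
- exact: (act1 (cyl_pt x)).
- exact: (actM _ _ (cyl_pt x)).
Defined.

Let Mul_d : diag P := Mul_diag X Y.

Section Parts.
Variables (n : nat) (y : holim Mul_d n).

Definition Mul_pt : holim B n.
Proof.
exists (fun I m t s => hpt (y I m t s)).
- by move=> e l m f t s; rewrite lfun_act.
- by move=> e e' u m t s; rewrite lfun_nat.
Defined.
End Parts.

Definition base_edge_in (I : small_set k S) (e : corolla_edge {s | s \in (I : {set S})}) :
  corolla_edge S := if e is Some s then Some (val s) else None.

Fact base_set_sub (I : small_set k S) (e : corolla_edge {s | s \in (I : {set S})}) :
  (base_set k1 (base_edge_in e) : {set S}) \subset I.
Proof. by case: e => [[s sI]|] /=; rewrite /edge_set ?sub1set ?sub0set. Qed.
Definition base_arr (I : P) (e : corolla_edge {s | s \in ((I : small_set k S) : {set S})}) :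
  hom I (base_set k1 (base_edge_in e) : P) := base_set_sub e.

Lemma base_edge_inK e : base_edge_in (base_edge e) = e.
Proof. by case: e. Qed.

Lemma base_res_edge (I : small_set k S) (e : corolla_edge {s | s \in (I : {set S})}) n
    (a : F (sub_corolla I) n) :
  base_res (base_edge_in e) n (dact B (base_arr (I := I) e) n a) =
  edge_res F (small_set_le I) e n a.
Proof.
rewrite [LHS](sub_Mul_res (I := base_set k1 (base_edge_in e))).
congr (edge_res F _ _ n a); case: e => [[s sI]|] //=.
by congr (Some _); apply: val_inj.
Qed.

Let edge_colour_base (I : small_set k S) (e : corolla_edge {s | s \in (I : {set S})}) :
  edge_colour X Y (base_edge_in e) =
  edge_colour (fun s : {s | s \in (I : {set S})} => X (val s)) Y e.
Proof. by case: e. Qed.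

Let act_const m n (t : mono m n) (c : colour F) :
  act t (act (mconst n ord0) c) = act (mconst m ord0) c.
Proof. by rewrite -actM; congr (act _ c); apply: mono_eq => i; rewrite !ord1. Qed.

Lemma powerset_thin (I J : P) (u v : hom I J) : u = v.
Proof. exact: bool_irrelevance. Qed.

Section ToMul.
Variables (n : nat) (z : Mul_cylinder n).

(** The simplex is pushed to the smallest subcorolla containing [e]; the homotopy coordinate of the
    cylinder becomes the path parameter. *)
Definition mul_path (I : P) (e : corolla_edge {s | s \in ((I : small_set k S) : {set S})})
  m (t : mono m n) (s : nerve (slice I) m) : paths (colours F) m.
Proof.
exists (fun l f d => @cyl_map _ z (base_edge_in e) l (mcomp t f)
  (nerve_map (comma_post (idF P) (base_arr e)) l (act f s)) d) => p l g f d.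
by rewrite -cyl_act actM sfunP.
Defined.

Hypothesis z_const : forall e m t d,
  cyl_path z e m t d = act (mconst m ord0) (edge_colour X Y e).

Definition cyl_to_Mul_fun (I : P) m (t : mono m n) (s : nerve (slice I) m) : Mul_d I m.
Proof.
exists (cyl_pt z I m t s) (fun e => mul_path e t s).
- move=> e l f; rewrite /= cyl_map0 lfun_nat base_res_edge lfun_act.
  by rewrite sfunP.
- by move=> e l f; rewrite /= cyl_map1 z_const edge_colour_base.
Defined.

(** Once the final paths are constant, the homotopies of [z] end at the prescribed colours.
    Naturality holds because pushing a simplex to the smallest subcorolla containing an edge is
    independent of the route. *)
Definition cyl_to_Mul : holim Mul_d n.
Proof.
exists cyl_to_Mul_fun => [I l m f t s|I J u m t s]; apply: hfib_eq => [|e p g d] /=.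
- exact: (lfun_act (cyl_pt z)).
- congr (cyl_map z _ _ _); exact: (thin_slice_eq powerset_thin).
- exact: (lfun_nat (cyl_pt z) u t s).
- set e' := cc_fun _ e; have ee : base_edge_in e = base_edge_in e' by rewrite /e'; case: (e).
  move: (base_arr e) (base_arr e'); rewrite -ee => v w.
  congr (cyl_map z _ _ _); exact: (thin_slice_eq powerset_thin).
Defined.
End ToMul.

Section OfMul.
Variables (n : nat) (y : holim Mul_d n).

Definition Mul_to_cyl : Mul_cylinder n.
Proof.
exists (Mul_pt y) (fun e m t s d => hpath (y (base_set k1 e) m t s) (base_edge e) m (mid m) d)
  (fun e => path_const (act (mconst n ord0) (edge_colour X Y e))).
- by move=> e l m f t s d; rewrite lfun_act -pfunP.
- by move=> e m t s; rewrite hpath0 act1.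
- move=> e m t s; rewrite hpath1 /= act_const.
  by have := edge_colour_base (base_edge e); rewrite base_edge_inK => ->.
- by move=> e m t; rewrite /= act_const.
Defined.

Lemma Mul_to_cyl_const e m t d :
  cyl_path Mul_to_cyl e m t d = act (mconst m ord0) (edge_colour X Y e).
Proof. exact: act_const. Qed.
End OfMul.

Section Filling.
Hypothesis FK : Kan (colours F).

Section FillingEdge.
Variable e : corolla_edge S.
Let K : sset := nerve (slice (base_set k1 e : P)).
Let W : sset := sprod (sprod Mul_cylinder K) (simplex 1).

Let f : smap W (colours F).
Proof.
exists (fun n (w : W n) => cyl_map w.1.1 (mid n) w.1.2 w.2) => m n t [[y s] d] /=.
exact: (cyl_act y t (mid n) s d).
Defined.

Let V n (w : W n) := w.2 = mconst n ord0 \/ w.2 = mconst n ord_max.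
Let Vact m n (t : mono m n) (w : W n) : V w -> V (act t w).
Proof. by case: w => [ys d] [] /= ->; [left | right]. Qed.

(** The partial homotopy is stationary over the end 0 of the cylinder and follows the given path
    over the end 1; values off [V] are junk. *)
Let h n (w : W n) (d : mono n 1) : colours F n :=
  if `[< w.2 = mconst n ord0 >] then base_res e n (cyl_pt w.1.1 (base_set k1 e) n (mid n) w.1.2)
  else cyl_path w.1.1 e n (mid n) d.

Let const01 n : mconst n (ord_max : 'I_2) <> mconst n ord0.
Proof. by move/(congr1 (fun d : mono n 1 => val (d ord0))). Qed.

Let hP m n (t : mono m n) (w : W n) d : V w -> h (act t w) (mcomp d t) = act t (h w d).
Proof.
case: w => [[y s] c] []; rewrite /h /= => ->.
  rewrite !asboolT // -sfunP; congr (base_res e m _).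
  exact: (lfun_act (cyl_pt y) t (mid n) s).
rewrite !asboolF; [|exact: const01|exact: const01].
exact: (pfunP (cyl_path y e) t (mid n) d).
Qed.

Let h0 n (w : W n) : V w -> h w (mconst n ord0) = f n w.
Proof.
case: w => [[y s] c] []; rewrite /h /= => ->.
  by rewrite asboolT // cyl_map0.
by rewrite asboolF; [rewrite cyl_map1 | exact: const01].
Qed.

(** Homotopy extension is applied once, with the point [y] and the simplex [s] as coordinates of
    [W]; this makes the filler natural in both. *)
Lemma exists_cyl_fill : exists H : forall n, Mul_cylinder n -> K n -> mono n 1 -> mono n 1 ->
    colours F n,
  [/\ forall m n (t : mono m n) y s c d,
        H m (act t y) (act t s) (mcomp c t) (mcomp d t) = act t (H n y s c d),
      forall n y s c, H n y s c (mconst n ord0) = cyl_map y (mid n) s c,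
      forall n y s d, H n y s (mconst n ord0) d =
        base_res e n (cyl_pt y (base_set k1 e) n (mid n) s) &
      forall n y s d, H n y s (mconst n ord_max) d = cyl_path y e n (mid n) d].
Proof.
have [H [HP H0 HV]] := homotopy_extension FK Vact hP h0.
exists (fun n y s c d => H n (y, s, c) d); split=> [m n t y s c d|n y s c|n y s d|n y s d].
- exact: (HP m n t (y, s, c) d).
- exact: H0.
- by rewrite HV; [rewrite /h asboolT | left].
- by rewrite HV; [rewrite /h asboolF; [|exact: const01] | right].
Qed.
End FillingEdge.

Let fill e := sval (cid (exists_cyl_fill e)).
Let fill_act e : forall m n (t : mono m n) y s c d,
  fill (act t y) (act t s) (mcomp c t) (mcomp d t) = act t (@fill e n y s c d).
Proof. by case: (svalP (cid (exists_cyl_fill e))). Qed.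
Let fill_start e : forall n y s c, @fill e n y s c (mconst n ord0) = cyl_map y (mid n) s c.
Proof. by case: (svalP (cid (exists_cyl_fill e))). Qed.
Let fill0 e : forall n y s d, @fill e n y s (mconst n ord0) d =
  base_res e n (cyl_pt y (base_set k1 e) n (mid n) s).
Proof. by case: (svalP (cid (exists_cyl_fill e))). Qed.
Let fill1 e : forall n y s d, @fill e n y s (mconst n ord_max) d = cyl_path y e n (mid n) d.
Proof. by case: (svalP (cid (exists_cyl_fill e))). Qed.

(** The part of the path [p] that remains after time [d], reparametrised by a maximum. *)
Definition path_contract n (p : paths (colours F) n) (d : mono n 1) : paths (colours F) n.
Proof.
exists (fun m t c => p m t (mono_max c (mcomp d t))) => l m f t c.
by rewrite -pfunP; congr (p l _ _); apply: mono_eq.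
Defined.

(* Slides the homotopy of y across its filler while shortening its path. *)
Definition cyl_slide n (y : Mul_cylinder n) (d : mono n 1) : Mul_cylinder n.
Proof.
exists (cyl_pt y) (fun e m t s c => fill (e := e) (act t y) s c (mcomp d t))
  (fun e => path_contract (cyl_path y e) d).
- move=> e l m f t s c; rewrite (actM t f y).
  exact: (fill_act f (act t y) s c (mcomp d t)).
- by move=> e m t s; rewrite fill0.
- by move=> e m t s; rewrite fill1 /= mono_max0l.
- by move=> e m t; rewrite /= mono_max1l cyl_path1.
Defined.

Let cyl_slide_act m n (t : mono m n) y d :
  cyl_slide (act t y) (mcomp d t) = act t (cyl_slide y d).
Proof.
apply: cyl_eq => // e l f s c.
exact: (congr1 (fun z => fill z s c (mcomp d (mcomp t f))) (esym (actM t f y))).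
Qed.

Let cyl_slide0 n (y : Mul_cylinder n) : cyl_slide y (mconst n ord0) = y.
Proof.
apply: cyl_eq => // [e m t s c|e m t c] /=; first by rewrite [LHS]fill_start.
by rewrite -[mcomp _ _]/(mconst m ord0) mono_max0r.
Qed.

Let cyl_slide_const n (y : Mul_cylinder n) :
  forall e m t c, cyl_path (cyl_slide y (mconst n ord_max)) e m t c =
    act (mconst m ord0) (edge_colour X Y e).
Proof.
by move=> e m t c; rewrite /= -[mcomp _ _]/(mconst m ord_max) mono_max1r cyl_path1.
Qed.

Definition cylinder_to_Mul : smap Mul_cylinder (holim Mul_d).
Proof.
exists (fun n y => cyl_to_Mul (@cyl_slide_const n y)) => m n t y.
apply: holim_eq => I l f s; apply: hfib_eq => // e p g d.
exact: (congr1 (fun z => fill (e := base_edge_in e) z _ d _) (esym (actM t (mcomp f g) y))).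
Defined.

Definition Mul_to_cylinder : smap (holim Mul_d) Mul_cylinder.
Proof.
exists (fun n y => Mul_to_cyl y) => m n t y; apply: cyl_eq => //.
- exact: holim_eq.
- by move=> e l f c /=; rewrite -!actM.
Defined.

Let slide_const n (y : holim Mul_d n) d :
  forall e m t c, cyl_path (cyl_slide (Mul_to_cyl y) d) e m t c =
    act (mconst m ord0) (edge_colour X Y e).
Proof. by move=> e m t c /=; rewrite act_const. Qed.

Let cyl_to_Mul_eq n (z z' : Mul_cylinder n) zc z'c : z = z' ->
  cyl_to_Mul (z := z) zc = cyl_to_Mul (z := z') z'c.
Proof. by move=> e; subst z'; rewrite (Prop_irrelevance zc z'c). Qed.

Lemma Mul_to_cylK n (y : holim Mul_d n) yc : cyl_to_Mul (z := Mul_to_cyl y) yc = y.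
Proof.
apply: holim_eq => I m t s; apply: hfib_eq => // e l f d /=.
rewrite -[compF _ _]/(nerve_map (comma_post (idF P) (base_arr e)) l (act f s)).
rewrite lfun_nat lfun_act /=.
apply: (congr1 (fun e' => hpath (y I m t s) e' l f d)); case: e => [[x xI]|] //=.
by congr Some; apply: val_inj.
Qed.

Lemma cyl_to_MulK n (z : Mul_cylinder n) zc : Mul_to_cyl (cyl_to_Mul (z := z) zc) = z.
Proof.
apply: cyl_eq => [|e m t s d|e m t d].
- exact: holim_eq.
- rewrite /= -[compF _ _]/(nerve_map (comma_post (idF P) (base_arr (base_edge e))) m
    (act (mid m) s)).
  move: (base_arr (base_edge e)); rewrite base_edge_inK => u.
  congr (cyl_map z _ _ _); exact: (thin_slice_eq powerset_thin).
- by rewrite Mul_to_cyl_const zc.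
Qed.

(** Sliding connects the identity of the cylinder to one composite. It keeps constant paths
    constant, so through [Mul_to_cyl] it also gives the homotopy for the other. *)
Lemma cylinder_to_Mul_equivalence : equivalence cylinder_to_Mul.
Proof.
exists Mul_to_cylinder; split; apply/rst_sym/homotopy_homotopic.
  exists (@cyl_slide) => [m n t y d|n y|n y].
  - exact: cyl_slide_act.
  - exact: cyl_slide0.
  - by rewrite /= cyl_to_MulK.
exists (fun n y d => cyl_to_Mul (@slide_const n y d)) => [m n t y d|n y|n y].
- pose z : Mul_cylinder m := act t (cyl_slide (Mul_to_cyl y) d).
  have zc e l f c : cyl_path z e l f c = act (mconst l ord0) (edge_colour X Y e).
    exact: slide_const.
  have -> : cyl_to_Mul (@slide_const m (act t y) (mcomp d t)) = cyl_to_Mul zc.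
    apply: cyl_to_Mul_eq; rewrite /z -cyl_slide_act.
    exact: (congr1 (fun z => cyl_slide z _) (sfunP Mul_to_cylinder t y)).
  by apply: holim_eq => I l f s; apply: hfib_eq.
- rewrite -[RHS](Mul_to_cylK (Mul_to_cyl_const y)).
  by apply: cyl_to_Mul_eq; apply: cyl_slide0.
- by apply: cyl_to_Mul_eq.
Qed.
End Filling.
End MulCylinder.

(** * Comparing the subtree model with the cylinder model *)

Section Glue.
Variables (k : natinf) (k1 : le_inf (Some 1) k) (j : natinf) (kj : le_inf k j).
Variables (F : psh (Omegac k)) (S : finType) (Sj : le_inf (Some #|S|) j).
Variables (X : S -> colour F) (Y : colour F).
Let P := op (powerset_le k S).
Let Q := op (subtree_cat k S).
Let B : diag P := sub_diag F S.
Let XQ : diag Q := subtree_diag kj F Sj.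
Let Cyl := Mul_cylinder k1 X Y.
Let Sub := Mul_subtree kj Sj X Y.

Lemma subtree_diag_edge (I : small_set k S) (e : corolla_edge S)
    (e' : corolla_edge {s | s \in (I : {set S})}) (u : hom (inl I : Q) (inr e)) n
    (a : F (sub_corolla I) n) :
  base_edge_in e' = e -> dact XQ u n a = edge_res F (small_set_le I) e' n a.
Proof.
move=> ee; rewrite /edge_res /res; congr (dact F _ n a); apply: tree_hom_eq => x.
apply: (@sub_obj_inj k S j kj Sj (inl I)).
have E := congr1 (fun h : tree_hom _ _ => h x) (chomP (fmap (subtreeF kj Sj) u)).
apply: etrans E _; rewrite /= -ee; by case: (e').
Qed.

Lemma subtree_diag_corolla (I J : small_set k S) (u : hom (inl I : Q) (inl J))
    (v : hom (I : P) J) n (a : F (sub_corolla I) n) :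
  dact XQ u n a = dact B v n a.
Proof.
rewrite /= /res; congr (dact F _ n a); apply: tree_hom_eq => x.
apply: (@sub_obj_inj k S j kj Sj (inl I)).
have E := congr1 (fun h : tree_hom _ _ => h x) (chomP (fmap (subtreeF kj Sj) u)).
by apply: etrans E _; case: x.
Qed.

Fact subcorolla_dmapP (I J : P) (u : hom I J) n (a : XQ (inl I) n) :
  sid _ n (dact XQ (fmap (opF (subcorolla k S)) u) n a) = dact B u n (sid _ n a).
Proof. exact: subtree_diag_corolla. Qed.
Definition subcorolla_dmap : dmap (opF (subcorolla k S)) XQ B :=
  @DMap _ _ (opF (subcorolla k S)) XQ B (fun I => sid (F (sub_corolla I))) subcorolla_dmapP.

(** Restricting through all subtrees first does not alter the comparison map; this gives the
    compatibility clause of the theorem. *)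
Lemma comparison_subtree n (x : Rk kj F (ccorolla Sj) n) :
  holim_map subcorolla_dmap n (subtree_restrict kj F Sj n x) = comparison kj F Sj n x.
Proof.
apply: holim_eq => I m t s /=.
apply: (congr1 (x (sub_comma_obj kj Sj I) m t)).
have eo (a : slice (I : P)) :
    slice_map_obj (opF (subtreeF kj Sj)) (slice_map_obj (opF (subcorolla k S)) a) =
    slice_map_obj (opF (sub_comma kj Sj)) a.
  apply: comma_obj_heq => //=; apply: hom_eq_refl.
  exact: (@sub_obj_uniq k S j kj Sj _ (inl (cdom a))).
apply: functor_eq => [a|a b f]; first exact: eo.
apply: comma_hom_heq2; [exact: eo | exact: eo |].
apply: hom_eq_refl; exact: (@sub_obj_uniq k S j kj Sj _ (inl (cdom (fobj s a)))).
Qed.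

Section Join.
Variable e : corolla_edge S.
Let m_e : P := base_set k1 e.

Definition edge_arr : hom (inl (base_set k1 e) : Q) (inr e) := sub_le_hull k1 (inr e).

Definition join0 : functor (slice m_e) (slice (inr e : Q)) :=
  compF (comma_post (idF Q) edge_arr) (slice_map (opF (subcorolla k S)) m_e).
Definition join1 : functor (slice m_e) (slice (inr e : Q)) :=
  constF (slice m_e) (slice_id (inr e : Q)).
Fact join_arrP (x : slice m_e) :
  comp (carr (join1 x)) (carr (join0 x) : hom (cdom (join0 x)) (inr e)) = carr (join0 x).
Proof. exact: subtree_thin. Qed.
Definition join_arr (x : slice m_e) : hom (join0 x) (join1 x) :=
  @CommaHom _ _ (idF Q) (inr e : Q) (join0 x) (join1 x) (carr (join0 x)) (join_arrP x).
Fact join_natural (x y : slice m_e) (u : hom x y) :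
  comp (join_arr y) (fmap join0 u) = comp (fmap join1 u) (join_arr x).
Proof. by apply: comma_hom_eq; apply: subtree_thin. Qed.

(** A simplex of subtrees containing [e] consists of subcorollas followed by copies of [e]; [join]
    replaces by [e] the vertices of [s] where [d] is 1. Thus the nerve of subtrees containing [e] is
    a cylinder collapsed at its end 1. *)
Definition join m (s : nerve (slice m_e) m) (d : mono m 1) : nerve (slice (inr e : Q)) m :=
  @interp _ _ join0 join1 join_arr join_natural m s d.

Lemma join_act l m (t : mono l m) (s : nerve (slice m_e) m) d :
  join (act t s) (mcomp d t) = act t (join s d).
Proof. exact: (@interp_act _ _ _ join1 join_arr join_natural l m t s d). Qed.

Lemma join_at0 m (s : nerve (slice m_e) m) :
  join s (mconst m ord0) = nerve_map (comma_post (idF Q) edge_arr) m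
    (nerve_map (slice_map (opF (subcorolla k S)) m_e) m s).
Proof. by rewrite /join interp0; apply: functor_eq. Qed.

Lemma join_at1 m (s : nerve (slice m_e) m) :
  join s (mconst m ord_max) = constF (ordinal_cat m) (slice_id (inr e : Q)).
Proof. by rewrite /join interp1; apply: functor_eq. Qed.
End Join.

Definition is_edge (a : Q) : bool := if a is inr _ then true else false.

Fact edge_bits_le (a : Q) m (s : nerve (slice a) m) (i i' : 'I_m.+1) : i <= i' ->
  (if is_edge (cdom (fobj s i)) then ord_max else ord0 : 'I_2) <=
  (if is_edge (cdom (fobj s i')) then ord_max else ord0 : 'I_2).
Proof.
move=> ii'; have : sub_le (cdom (fobj s i')) (cdom (fobj s i)) := chom (fmap s ii').
by case: (cdom (fobj s i')) => [I|e]; case: (cdom (fobj s i)) => [I'|e'].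
Qed.
Definition edge_bits (a : Q) m (s : nerve (slice a) m) : mono m 1 := Mono (@edge_bits_le a m s).

Lemma edge_bits_corolla (I : small_set k S) m (s : nerve (slice (inl I : Q)) m) :
  edge_bits s = mconst m ord0.
Proof.
apply: mono_eq => i /=; have : sub_le (inl I) (cdom (fobj s i)) := carr (fobj s i).
by case: (cdom (fobj s i)).
Qed.

Lemma edge_bits_join e m (s : nerve (slice (base_set k1 e : P)) m) d :
  edge_bits (join s d) = d.
Proof.
apply: mono_eq => i /=; case: (d i) => [[|[|//]] di] /=; exact: val_inj.
Qed.

Let hull_map (a : Q) m (s : nerve (slice a) m) : nerve (slice (sub_hull k1 a : P)) m :=
  nerve_map (slice_map (opF (hull k1 S)) a) m s.

Lemma hull_subcorolla (I : P) m (s : nerve (slice I) m) :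
  hull_map (nerve_map (slice_map (opF (subcorolla k S)) I) m s) = s.
Proof. exact: (thin_slice_eq (@powerset_thin k S)). Qed.

Lemma subcorolla_hull (I : small_set k S) m (s : nerve (slice (inl I : Q)) m) :
  nerve_map (slice_map (opF (subcorolla k S)) (I : P)) m (hull_map s) = s.
Proof.
apply: (thin_slice_eq (@subtree_thin k S)) => i /=.
have : sub_le (inl I) (cdom (fobj s i)) := carr (fobj s i).
by case: (cdom (fobj s i)).
Qed.

Lemma join_hull e m (s : nerve (slice (inr e : Q)) m) : join (hull_map s) (edge_bits s) = s.
Proof.
apply: (thin_slice_eq (@subtree_thin k S)) => i /=.
have : sub_le (inr e) (cdom (fobj s i)) := carr (fobj s i).
by case: (fobj s i) => -[I|e'] c /=; [move=> _ | move=> /eqP ->].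
Qed.

Lemma hull_join e m (s : nerve (slice (base_set k1 e : P)) m) :
  hull_map (join s (mconst m ord0)) = s.
Proof. exact: (thin_slice_eq (@powerset_thin k S)). Qed.

Definition subtree_to_cyl n (x : Sub n) : Cyl n.
Proof.
exists (holim_map subcorolla_dmap n (hpt x))
  (fun e m t s d => hpt x (inr e) m t (join s d)) (hpath x).
- by move=> e l m f t s d; rewrite join_act lfun_act.
- move=> e m t s; rewrite join_at0 lfun_nat; apply: subtree_diag_edge.
  exact: base_edge_inK.
- move=> e m t s; rewrite join_at1 hpath0.
  rewrite -[RHS](lfun_act (hpt x) t (mid n)).
  apply: (congr1 (hpt x (inr e) m t)); exact: functor_eq.
- by move=> e m t; rewrite hpath1.
Defined.

Definition subtree_to_cylinder : smap Sub Cyl.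
Proof.
exists subtree_to_cyl => m n t x; apply: cyl_eq => //; exact: holim_eq.
Defined.

(** Over an edge, a simplex is split into its hull and its edge bits, the coordinates recovered by
    [join_hull]. *)
Definition glue_fun n (y : Cyl n) (a : Q) m (t : mono m n) (s : nerve (slice a) m) : XQ a m :=
  match a as a' return nerve (slice (a' : Q)) m -> XQ (a' : Q) m with
  | inl M => fun s => cyl_pt y (M : P) m t (hull_map (a := inl M) s)
  | inr e => fun s => cyl_map y t
      (hull_map (a := inr e) s : nerve (slice (base_set k1 e : P)) m) (edge_bits (a := inr e) s)
  end s.

Definition glue n (y : Cyl n) : holim XQ n.
Proof.
exists (glue_fun y).
- move=> [I|e] l m f t s; [rewrite -[RHS](lfun_act (cyl_pt y))|rewrite -[RHS](cyl_act y)].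
    apply: (congr1 (cyl_pt y (I : P) l (mcomp t f))).
    exact: (thin_slice_eq (@powerset_thin k S)).
  congr (cyl_map y _ _ _); last exact: mono_eq.
  exact: (thin_slice_eq (@powerset_thin k S)).
- move=> [I|e] [J|e'] u m t s.
  + rewrite (subtree_diag_corolla _ (u : hom (I : P) J)) -[RHS](lfun_nat (cyl_pt y)).
    apply: (congr1 (cyl_pt y (J : P) m t)); exact: (thin_slice_eq (@powerset_thin k S)).
  (* From a subcorolla to an edge, all edge bits are 0, so the homotopy is at its start and agrees
     with restriction to [e']. *)
  + have v : hom (I : P) (base_set k1 e') := sub_hull_le k1 u.
    have eb : edge_bits (nerve_map (comma_post (idF Q) u) m s) = mconst m ord0.
      by rewrite -(edge_bits_corolla s); apply: mono_eq.
    rewrite -[LHS]/(cyl_map y t (hull_map (nerve_map (comma_post (idF Q) u) m s)) _).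
    rewrite eb cyl_map0.
    have -> : dact XQ u m (glue_fun y t s) =
        base_res k1 F e' m (dact B v m (cyl_pt y (I : P) m t (hull_map s))).
      rewrite (sub_Mul_res v); apply: subtree_diag_edge.
      by clear eb; case: e' u v => [x|] u v.
    congr (base_res k1 F e' m _); rewrite -lfun_nat.
    apply: (congr1 (cyl_pt y (base_set k1 e' : P) m t)).
    exact: (thin_slice_eq (@powerset_thin k S)).
  + by [].
  + have ee : e' = e := eqP u.
    subst e'; rewrite (subtree_thin u (idm _)) dact1.
    congr (cyl_map y _ _ _); last exact: mono_eq.
    exact: (thin_slice_eq (@powerset_thin k S)).
Defined.

Definition cyl_to_subtree n (y : Cyl n) : Sub n.
Proof.
exists (glue y) (cyl_path y).
- move=> e m t.
  (* The simplex constant at [e] has all bits 1, where the homotopy meets the start of the path. *)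
  have eb : edge_bits (constF (ordinal_cat n) (slice_id (inr e : Q)) : nerve _ n) =
    mconst n ord_max by exact: mono_eq.
  rewrite -[RHS]/(act t (cyl_map y (e := e) (mid n)
    (hull_map (constF (ordinal_cat n) (slice_id (inr e : Q)) : nerve _ n)) _)).
  by rewrite eb cyl_map1 -pfunP; congr (cyl_path y e m _ _); apply: mono_eq.
- exact: cyl_path1.
Defined.

Definition cylinder_to_subtree : smap Cyl Sub.
Proof.
exists cyl_to_subtree => m n t y; apply: hfib_eq => //.
by apply: holim_eq => -[I|e] l f s.
Defined.

Lemma cylinder_to_subtreeK n (x : Sub n) :
  cylinder_to_subtree n (subtree_to_cylinder n x) = x.
Proof.
apply: hfib_eq => //; apply: holim_eq => -[I|e] m t s.
- exact: (congr1 (hpt x (inl I) m t) (subcorolla_hull s)).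
- exact: (congr1 (hpt x (inr e) m t) (join_hull s)).
Qed.

Let hull_mapM (a : Q) l m (f : mono l m) (s : nerve (slice a) m) :
  hull_map (act f s) = act f (hull_map s).
Proof. exact: (thin_slice_eq (@powerset_thin k S)). Qed.

(* Deforms the simplices of subcorollas containing e to the smallest one where
   the second coordinate of the cylinder is 1; there the cylinder is constant. *)
Definition cyl_collapse n (y : Cyl n) (d : mono n 1) : Cyl n.
Proof.
exists (cyl_pt y)
  (fun e m t s c => cyl_map y t (hull_map (join s (mono_min c (mcomp d t)))) c) (cyl_path y).
- move=> e l m f t s c; rewrite -cyl_act.
  have -> : mono_min (mcomp c f) (mcomp d (mcomp t f)) = mcomp (mono_min c (mcomp d t)) f.
    exact: mono_eq.
  by rewrite join_act hull_mapM.
- by move=> e m t s; rewrite mono_min0l hull_join cyl_map0.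
- by move=> e m t s; rewrite cyl_map1.
- exact: cyl_path1.
Defined.

(** One composite is the identity by [join_hull]. The other replaces [s] by the hull of [join s c],
    which is the end of [cyl_collapse]. *)
Lemma subtree_to_cylinder_equivalence : equivalence subtree_to_cylinder.
Proof.
exists cylinder_to_subtree; split.
  rewrite (_ : scomp _ _ = sid _); first exact: rst_refl.
  by apply: smap_eq => n x; apply: cylinder_to_subtreeK.
apply/rst_sym/homotopy_homotopic; exists cyl_collapse => [m n t y d|n y|n y].
- exact: cyl_eq.
- apply: cyl_eq => // e m t s c /=; rewrite -[mcomp _ _]/(mconst m ord0).
  by rewrite mono_min0r hull_join.
- apply: cyl_eq => // [|e m t s c].
    apply: holim_eq => I m t s; exact/esym/(congr1 (cyl_pt y I m t) (hull_subcorolla s)).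
  rewrite /= -[mcomp _ _]/(mconst m ord_max) mono_min1r.
  by apply: (congr1 (cyl_map y t _)); rewrite edge_bits_join.
Qed.
End Glue.

Theorem corollary5p18 (k j : natinf) (k1 : le_inf (Some 1) k) (kj : le_inf k j)
    (F : unital_operad k1) :
  (forall (n : nat) (kn : le_inf k (Some n)) (nj : le_inf (Some n) j),
     equivalence (comparison kj F (card_ord_le nj) :
       smap (Rk kj F (cC nj)) (holim (sub_diag F 'I_n)))) /\
  equivalence (Rk_colours kj F) /\
  (forall (n : nat) (kn : le_inf k (Some n)) (nj : le_inf (Some n) j)
     (X : 'I_n -> colour F) (Y : colour F),
     exists w : smap (Mul (card_ord_le nj)
                          (fun i => Rk_colours kj F 0 (X i))
                          (Rk_colours kj F 0 Y))
                     (holim (Mul_diag X Y)),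
       equivalence w /\
       homotopic (scomp (holim_map (Mul_dmap X Y)) w)
                 (scomp (comparison kj F (card_ord_le nj)) (hfib_pt _ _))).
Proof.
split; first by move=> n _ nj; apply: comparison_equivalence.
split; first exact: Rk_colours_equivalence.
move=> n _ nj X Y; have FK : Kan (colours F) := @operad_Kan _ _ F (cC0 k).
exists (scomp (@cylinder_to_Mul k k1 F 'I_n X Y FK)
  (scomp (@subtree_to_cylinder k k1 j kj F 'I_n (card_ord_le nj) X Y)
  (@Mul_to_subtree k j kj F 'I_n (card_ord_le nj) X Y))); split.
  apply: equivalence_comp; first exact: cylinder_to_Mul_equivalence.
  apply: equivalence_comp; first exact: subtree_to_cylinder_equivalence.
  exact: Mul_to_subtree_equivalence.
(* The triangle commutes strictly: sliding leaves the point of the homotopy limit in place and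
   alters only homotopies and paths. *)
rewrite (_ : scomp _ _ = scomp (comparison kj F (card_ord_le nj)) (hfib_pt _ _)).
  exact: rst_refl.
apply: smap_eq => m x; rewrite -[RHS]/(comparison kj F (card_ord_le nj) m (hpt x)).
rewrite -comparison_subtree; apply: holim_eq => I l t s.
apply: (congr1 (holim_map (subcorolla_dmap kj F (card_ord_le nj)) m
  (subtree_restrict kj F (card_ord_le nj) m (hpt x)) I l t)).
exact: (thin_slice_eq (@powerset_thin k _)).
Qed.
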